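(* Let $1<p<\infty$ and $\mathbf{A}=\{a_n\}_{n\ge1}\in NBVS$, and let $f$ be a sum-function of either of the series $$\sum_{n=1}^\infty a_n\cos nx\qquad\text{or}\qquad\sum_{n=1}^\infty a_n\sin nx .$$ Then the condition $$\sum_{n=1}^\infty n^{2p-2}a_n^p<\infty$$ is necessary and sufficient for (i) $f$ to belong to $\Lambda_p$; and it is likewise necessary and sufficient for (ii) $f$ to be equivalent to (i.e. equal almost everywhere to) an absolutely continuous function whose derivative belongs to $L^p$.
   Context: A sequence $\mathbf{A}=\{a_n\}_{n\ge1}$ of nonnegative real numbers belongs to $NBVS$ if there is a constant $K(\mathbf{A})$, depending only on $\mathbf{A}$, such that $\sum_{m=n}^{2n}|\Delta a_m|\le K(\mathbf{A})(a_n+a_{2n})$ for all $n=1,2,\dots$, where $\Delta a_m=a_m-a_{m+1}$. $L^p$ is the space of $2\pi$-periodic functions that are $p$-power integrable over a period, with usual norm $\|\cdot\|_p$. For $f\in L^p$ and $h>0$, $\omega_p(f,h):=\sup_{|t|\le h}\|f(x+t)-f(x)\|_p$. The Lipschitz class is $\Lambda_p:=\{f\in L^p:\ \omega_p(f,h)=O(h)\}$ (as $h\to0^+$). A sum-function of a trigonometric series is the function $f$ that is the sum of the series. *)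

(* Defs.v *)
(* MathComp-Analysis *)
From HB Require Import structures.
From mathcomp Require Import all_boot all_order all_algebra.
From mathcomp Require Import all_classical all_reals all_analysis.

Set Implicit Arguments.
Unset Strict Implicit.
Unset Printing Implicit Defensive.
Import Order.TTheory GRing.Theory Num.Theory.
Import numFieldNormedType.Exports.

Local Open Scope classical_set_scope.
Local Open Scope ring_scope.

(* Sequences are indexed from 1: the value [a 0%N] is never used. *)
Definition NBVS (R : realType) (a : nat -> R) : Prop :=
  (forall n, (1 <= n)%N -> 0 <= a n) /\
  exists K : R, forall n, (1 <= n)%N ->
    \sum_(n <= m < (2 * n).+1) `|a m - a m.+1| <= K * (a n + a (2 * n)%N).

(* [e] is [cos] or [sin].  The points of 2piZ are excluded because a cosine
   series with coefficients in NBVS may diverge there while converging at every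
   other point.  Convergence merely almost everywhere would be too weak: there
   are nontrivial trigonometric series that converge to 0 almost everywhere. *)
Definition sum_function (R : realType) (e : R -> R) (a : nat -> R)
    (f : R -> R) : Prop :=
  periodic f (pi *+ 2) /\
  forall x : R, (forall k : int, x != (pi *+ 2) *~ k) ->
    (fun N : nat => \sum_(1 <= n < N.+1) a n * e (n%:R * x)) @ \oo --> f x.

Definition period_measure (R : realType) :
    {measure set (measurableTypeR R) -> \bar R} :=
  mrestr (@lebesgue_measure R) (measurable_itv `[- (@pi R), pi]).

Definition Lp_2pi (R : realType) (p : R) (f : R -> R) : Prop :=
  periodic f (pi *+ 2) /\ f \in Lfun (period_measure R) p%:E.

Definition norm_p (R : realType) (p : R) (f : R -> R) : \bar R :=
  'N[period_measure R]_(p%:E)[EFin \o f]%E.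

Definition modulus_p (R : realType) (p : R) (f : R -> R) (h : R) : \bar R :=
  ereal_sup [set norm_p p (fun x => f (x + t) - f x)
            | t in [set t : R | `|t| <= h]].

Definition Lipschitz_p (R : realType) (p : R) (f : R -> R) : Prop :=
  Lp_2pi p f /\
  exists C : R, \forall h \near (0 : R)^'+, (modulus_p p f h <= (C * h)%:E)%E.

Definition abs_continuous_on (R : realType) (a b : R) (g : R -> R) : Prop :=
  forall eps : R, 0 < eps -> exists2 delta : R, 0 < delta &
  forall (n : nat) (u v : 'I_n -> R),
    (forall i, a <= u i /\ u i <= v i /\ v i <= b) ->
    trivIset setT (fun i => [set` `]u i, v i[]) ->
    \sum_(i < n) (v i - u i) < delta ->
    \sum_(i < n) `|g (v i) - g (u i)| < eps.

Definition abs_continuous (R : realType) (g : R -> R) : Prop :=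
  forall a b : R, abs_continuous_on a b g.

(* The derivative of an absolutely continuous function exists only almost
   everywhere; [dg] is a representative of its class. *)
Definition equiv_AC_deriv_Lp (R : realType) (p : R) (f : R -> R) : Prop :=
  exists g dg : R -> R,
    [/\ {ae @lebesgue_measure R, forall x, f x = g x},
        abs_continuous g,
        {ae @lebesgue_measure R, forall x, is_derive (x : R) (1 : R) g (dg x)}
      & Lp_2pi p dg].

(* Main.v *)
Require Import Defs.
From HB Require Import structures.
From mathcomp Require Import all_boot all_order all_algebra.
From mathcomp Require Import all_classical all_reals all_analysis.
From mathcomp Require Import measurable_realfun.
From mathcomp Require Import ring lra zify.

Import Order.TTheory GRing.Theory Num.Theory.
Import numFieldNormedType.Exports.

Local Open Scope classical_set_scope.
Local Open Scope ring_scope.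

(** The proof runs through the dyadic samples of the coefficients. For
    [a] in [NBVS], the terms of a dyadic block are bounded by its two endpoints,
    so that the test series converges if and only if the sum of
    [(2 ^ j) ^ (2 p - 1) * a (2 ^ j) ^ p] does ([NBVS_condition_dyadic]). Three
    implications then close a circle.

    Dyadic condition to absolute continuity ([dyadic_equiv_AC]). Differentiate the
    series termwise and group it into dyadic blocks. Trivially, or by summation
    by parts against the Dirichlet kernel, the [j]-th block is at most a constant
    times [min (2 ^ j, 1 / |sin (x / 2)|) * t j], with [t j] the block weight.
    On the shell [|x| ~ 2 ^- k] the sum of these majorants is a discrete
    convolution with a geometrically decaying kernel, and Schur's test puts
    their supremum in [L^p]. Dominated convergence then exhibits the sum of the
    series as an integral of an [L^p] function.

    Absolute continuity to the Lipschitz condition ([equiv_AC_Lipschitz]).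
    Increments of an absolutely continuous function are integrals of its
    derivative ([abs_continuous_FTC]); Hölder's inequality and Tonelli's theorem
    bound their [L^p] norm.

    Lipschitz condition to the dyadic condition ([Lipschitz_p_dyadic]). The series
    is not assumed to be the Fourier series of its sum, and this is where
    convergence everywhere off the multiples of [2 pi] matters. The coefficients
    tend to 0. Riemann's function [F], the series integrated twice, has the sum
    [f] as second symmetric derivative off the origin and is smooth at the origin
    ([riemann_first], [riemann_second]). The second primitive [Q] of [f] has the
    same second symmetric derivative almost everywhere, and bounded second
    difference quotients everywhere near the origin, because the Lipschitz
    condition makes the first primitive Lipschitz ([primitive_lip]). Schwarz's
    uniqueness theorem, with a convex barrier for the exceptional null set, shows
    that [F - Q] is affine ([schwarz_affine], [riemann_fun_second_primitive]).
    Hence second differences of [F] with step [h] are differences of values of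
    [P (x + h) - P x], with [P] the first primitive; they are controlled by the
    integral of [|f (s + h) - f s|] over [|s| <= 2 ^- j]. Compared with the
    expansion of [F], whose relevant terms are nonnegative, this bounds the
    coefficients at the scale [2 ^ j] ([cos_block_le], [sin_block_le]), and a
    dyadic Hardy inequality ([dyadic_hardy]) sums the bounds over [j], uniformly
    in [h].

    Cosine and sine series are treated together as series in [cos (n x + c)]
    with [c = 0] or [c = - (pi / 2)]. *)

Set Implicit Arguments.
Unset Strict Implicit.

(** * Translations and integration over a period *)

Section translation.
Local Open Scope ereal_scope.
Context {R : realType}.
Notation mu := (@lebesgue_measure R).
Implicit Types (f : R -> \bar R) (a b t : R).

Lemma measurable_shift t :
  measurable_fun setT ((fun x => x + t)%R : measurableTypeR R -> measurableTypeR R).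
Proof. by apply: measurable_funD => //; exact: measurable_cst. Qed.

Lemma preimage_shift_itv t a b (x y : bool) :
  (fun z : R => z + t)%R @^-1` [set` Interval (BSide x (a + t)%R) (BSide y (b + t)%R)]
  = [set` Interval (BSide x a) (BSide y b)].
Proof.
apply/seteqP; split=> z /=; rewrite !in_itv/=.
  by case: x; case: y; rewrite /= ?lerD2r ?ltrD2r.
by case: x; case: y; rewrite /= ?lerD2r ?ltrD2r.
Qed.

Lemma lebesgue_measure_shift t (A : set R) : measurable A ->
  pushforward mu ((fun x => x + t)%R : measurableTypeR R -> measurableTypeR R) A = mu A.
Proof.
have mt := measurable_shift t.
pose mt_mixin := isMeasurableFun.Build _ _ _ _ _ mt.
pose mt_pack : {mfun _ >-> _} := HB.pack (fun x : measurableTypeR R => x + t : measurableTypeR R)%R mt_mixin.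
move=> mA.
apply/esym; rewrite -[RHS]/(pushforward mu mt_pack A).
apply: lebesgue_measure_unique => //= _ [[a b]] _ <-.
rewrite /pushforward/=.
have -> : ((fun x : measurableTypeR R => x + t : measurableTypeR R)%R @^-1` `]a, b]%classic) = `](a - t)%R, (b - t)%R]%classic.
  by rewrite -[RHS](preimage_shift_itv t) !subrK.
rewrite !lebesgue_measure_itv/= !lte_fin ltrD2r.
by case: ifP => // _; rewrite -!EFinD; congr (_%:E); ring.
Qed.

Lemma ge0_integral_shift t (D : set R) f : measurable D -> measurable_fun D f ->
  (forall x, D x -> 0 <= f x) ->
  \int[mu]_(x in D) f x = \int[mu]_(x in (fun z => z + t)%R @^-1` D) f (x + t)%R.
Proof.
have mt := measurable_shift t.
pose mt_mixin := isMeasurableFun.Build _ _ _ _ _ mt.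
pose mt_pack : {mfun _ >-> _} := HB.pack (fun x : measurableTypeR R => x + t : measurableTypeR R)%R mt_mixin.
move=> mD mf f0.
rewrite -[RHS](@ge0_integral_pushforward _ _ _ _ _ _ mt mu D f)//; last first.
  by move=> x; rewrite inE; exact: f0.
by apply: eq_measure_integral => A mA _; exact: (esym (lebesgue_measure_shift t mA)).
Qed.

Lemma ge0_integral_itv_shift t a b f : measurable_fun `[(a + t)%R, (b + t)%R] f ->
  (forall x, `[(a + t)%R, (b + t)%R]%classic x -> 0 <= f x) ->
  \int[mu]_(x in `[(a + t)%R, (b + t)%R]) f x = \int[mu]_(x in `[a, b]) f (x + t)%R.
Proof.
move=> mf f0; rewrite (@ge0_integral_shift t)//.
by congr (integral _ _ _); exact: preimage_shift_itv.
Qed.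

Lemma integral_itv_shift t a b f : measurable_fun setT f ->
  mu.-integrable `[(a + t)%R, (b + t)%R] f ->
  \int[mu]_(x in `[(a + t)%R, (b + t)%R]) f x = \int[mu]_(x in `[a, b]) f (x + t)%R.
Proof.
move=> mf fi; rewrite integralE [RHS]integralE.
have mp : measurable_fun `[(a + t)%R, (b + t)%R] f^\+.
  by apply: measurable_funepos; exact: measurable_funTS.
have mn : measurable_fun `[(a + t)%R, (b + t)%R] f^\-.
  by apply: measurable_funeneg; exact: measurable_funTS.
rewrite (ge0_integral_itv_shift mp); last by move=> x _; exact: funepos_ge0.
rewrite (ge0_integral_itv_shift mn); last by move=> x _; exact: funeneg_ge0.
by congr (_ - _); apply: eq_integral => x _; rewrite !(funeposE, funenegE).
Qed.

End translation.

Section period_measure_integral.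
Local Open Scope ereal_scope.
Context {R : realType}.
Notation mu := (@lebesgue_measure R).

(** The measure of the definitions is Lebesgue measure restricted to a period. *)
Lemma integral_period_measure (f : R -> \bar R) : measurable_fun setT f ->
  (forall x, 0 <= f x) ->
  \int[period_measure R]_x f x = \int[mu]_(x in `[(- (pi : R))%R, pi%R]) f x.
Proof.
move=> mf f0; set D := `[(- (pi : R))%R, pi%R]%classic.
have mD : measurable (D : set (measurableTypeR R)) by exact: measurable_itv.
rewrite (@ge0_negligible_integral _ _ _ (period_measure R) setT (~` D))//=.
- rewrite setTD setCK; apply: eq_measure_integral => A mA AD.
  by rewrite -[RHS](congr1 mu (setIidl AD)).
- exact: measurableC.
- by rewrite -[LHS]/(mu (~` D `&` D)) setICl measure0.
Qed.

Lemma measurable_powR_norm (p : R) (f : R -> R) : measurable_fun setT f ->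
  measurable_fun setT (fun x => (`|f x| `^ p)%R).
Proof.
move=> mf; apply: (measurableT_comp (measurable_powR p)).
exact: measurableT_comp.
Qed.

Lemma norm_p_powR (p : R) (f : R -> R) : (0 < p)%R -> measurable_fun setT f ->
  norm_p p f `^ p = \int[mu]_(x in `[(- (pi : R))%R, pi%R]) (`|f x| `^ p)%:E.
Proof.
move=> p0 mf; rewrite /norm_p powR_Lnorm ?gt_eqF//.
transitivity (\int[period_measure R]_x (`|f x| `^ p)%:E); first exact: eq_integral.
by rewrite integral_period_measure//; apply/measurable_EFinP; exact: measurable_powR_norm.
Qed.

Lemma norm_p_le (p c : R) (f : R -> R) : (0 < p)%R -> (0 <= c)%R ->
  measurable_fun setT f ->
  (norm_p p f <= c%:E) =
  (\int[mu]_(x in `[(- (pi : R))%R, pi%R]) (`|f x| `^ p)%:E <= (c `^ p)%:E).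
Proof.
move=> p0 c0 mf; rewrite -norm_p_powR// -poweR_EFin.
have n0 : 0 <= norm_p p f by rewrite /norm_p; exact: Lnorm_ge0.
case: (norm_p p f) n0 => [r|_|//]; last by rewrite poweRyr ?gt_eqF// !leye_eq.
rewrite lee_fin => r0; rewrite poweR_EFin !lee_fin.
have [rc|cr] := leP r c; first by rewrite ge0_ler_powR// ?nnegrE// ltW.
by apply/esym/negbTE; rewrite -ltNge gt0_ltr_powR.
Qed.

Lemma Lp_2piP (p : R) (f : R -> R) : (0 < p)%R ->
  Lp_2pi p f <-> [/\ periodic f (pi *+ 2), measurable_fun setT f &
  \int[mu]_(x in `[(- (pi : R))%R, pi%R]) (`|f x| `^ p)%:E < +oo].
Proof.
move=> p0.
have key : measurable_fun setT f -> (norm_p p f < +oo) =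
  (\int[mu]_(x in `[(- (pi : R))%R, pi%R]) (`|f x| `^ p)%:E < +oo).
  move=> mf; rewrite -norm_p_powR//.
  have n0 : 0 <= norm_p p f by rewrite /norm_p; exact: Lnorm_ge0.
  move: n0; case: (norm_p p f) => [r|//|//] r0; first by rewrite poweR_EFin !ltry.
  by rewrite poweRyr ?gt_eqF.
split=> [[pf /andP[mf nf]]|[pf mf fi]].
  split => //; first by rewrite inE in mf.
  by rewrite -key; [rewrite inE in nf|rewrite inE in mf].
split => //; apply/andP; split; rewrite inE//.
by have := key mf; rewrite fi.
Qed.

End period_measure_integral.

(** * Power means, a geometric Schur test and the ratio of Hardy's inequality *)

Section power_means.
Context {R : realType}.
Implicit Types (p : R).

Lemma geometric_sum_le (rho : R) (n : nat) : 0 <= rho < 1 ->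
  \sum_(i < n) rho ^+ i <= (1 - rho)^-1.
Proof.
move=> /andP[r0 r1]; rewrite -[leRHS]mul1r ler_pdivlMr ?subr_gt0// mulrC.
by rewrite -opprB mulNr -subrX1 opprB gerBl exprn_ge0.
Qed.

(** Dyadic scales enter the estimates through powers of this ratio. *)
Definition hardy_ratio p : R := (1 / 2) `^ (1 - p^-1).

Lemma hardy_exponent_gt0 p : 1 < p -> 0 < 1 - p^-1.
Proof. by move=> p1; rewrite subr_gt0 invf_lt1// (lt_trans _ p1). Qed.

Lemma hardy_ratio_ge0 p : 0 <= hardy_ratio p.
Proof. exact: powR_ge0. Qed.

Lemma hardy_ratio_lt1 p : 1 < p -> hardy_ratio p < 1.
Proof.
move=> p1; have := @gt0_ltr_powR R _ (hardy_exponent_gt0 p1) (1 / 2) 1.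
by rewrite !nnegrE powR1; apply; lra.
Qed.

Lemma powR_mulS (x r : R) : 0 < x -> x `^ r * x = x `^ (r + 1).
Proof.
move=> x0; rewrite powRD; first by rewrite powRr1// ltW.
by apply/implyP => _; exact: lt0r_neq0.
Qed.

Lemma young_powR p (a b : R) : 1 < p -> 0 <= a -> 0 <= b ->
  a * b `^ (p - 1) <= a `^ p / p + b `^ p * (1 - p^-1).
Proof.
move=> p1 a0 b0; have p0 : 0 < p by rewrite (lt_trans _ p1).
have p10 : 0 < p - 1 by rewrite subr_gt0.
have := @conjugate_powR R a (b `^ (p - 1)) p (p / (p - 1)) a0 (powR_ge0 _ _) p0.
rewrite divr_gt0// => /(_ isT).
have -> : p^-1 + (p / (p - 1))^-1 = 1.
  by rewrite invf_div -[X in X + _]mul1r -mulrDl addrC subrK divff ?gt_eqF.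
move=> /(_ erefl); rewrite -powRrM.
have -> : (p - 1) * (p / (p - 1)) = p by rewrite mulrC divfK// gt_eqF.
by rewrite invf_div mulrBl divff ?gt_eqF// mul1r.
Qed.

(** Jensen's inequality for the convex function [x ^ p] and finite weights. *)
Lemma jensen_powR p (I : Type) (r : seq I) (w e : I -> R) : 1 < p ->
  (forall i, 0 <= w i) -> (forall i, 0 <= e i) ->
  (\sum_(i <- r) w i * e i) `^ p <=
  (\sum_(i <- r) w i) `^ (p - 1) * \sum_(i <- r) w i * e i `^ p.
Proof.
move=> p1 w0 e0; have p0 : 0 < p by rewrite (lt_trans _ p1).
set W := \sum_(i <- r) w i; set S := \sum_(i <- r) w i * e i.
have W0 : 0 <= W by apply: sumr_ge0.
have S0 : 0 <= S by apply: sumr_ge0 => i _; rewrite mulr_ge0.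
have [WE|Wn0] := eqVneq W 0.
  have -> : S = 0.
    move: WE; rewrite /W /S; elim: r {W S W0 S0} => [|i r IH]; first by rewrite !big_nil.
    rewrite !big_cons => /eqP; rewrite paddr_eq0// ?sumr_ge0// => /andP[/eqP-> /eqP/IH->].
    by rewrite mul0r addr0.
  rewrite powR0 ?gt_eqF// mulr_ge0 ?powR_ge0// sumr_ge0// => i _.
  by rewrite mulr_ge0// powR_ge0.
have Wp : 0 < W by rewrite lt_def Wn0.
pose m := S / W.
have m0 : 0 <= m by rewrite divr_ge0.
have SE : S = W * m by rewrite /m mulrC divfK.
have key : S * m `^ (p - 1) <=
    (\sum_(i <- r) w i * e i `^ p) / p + W * (m `^ p * (1 - p^-1)).
  rewrite !mulr_suml -big_split/=; apply: ler_sum => i _.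
  by rewrite -!mulrA -mulrDr ler_wpM2l// young_powR.
have mm : m * m `^ (p - 1) = m `^ p by rewrite mulr_powRB1.
rewrite SE -mulrA mm in key.
have key2 : W * m `^ p <= \sum_(i <- r) w i * e i `^ p.
  set T := \sum_(i <- r) _ in key *.
  have : W * m `^ p / p <= T / p.
    rewrite -(lerD2r (W * (m `^ p * (1 - p^-1)))) (le_trans _ key)//.
    by rewrite le_eqVlt; apply/orP; left; apply/eqP; ring.
  by rewrite ler_pM2r ?invr_gt0.
rewrite SE powRM// -(mulr_powRB1 W0 p0) mulrAC mulrC ler_wpM2l ?powR_ge0//.
Qed.

(** Schur's test: a convolution with a geometric kernel is bounded on l^p. *)
Lemma schur_geometric p (rho : R) (N M : nat) (e : nat -> R) : 1 < p ->
  0 <= rho < 1 -> (forall j, 0 <= e j) ->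
  \sum_(k < M) (\sum_(j < N) rho ^+ (k - j + (j - k)) * e j) `^ p <=
  (2 / (1 - rho)) `^ p * \sum_(j < N) e j `^ p.
Proof.
move=> p1 /andP[r0 r1] e0; have p0 : 0 < p by rewrite (lt_trans _ p1).
set W := 2 / (1 - rho).
have W0 : 0 <= W by rewrite divr_ge0// subr_ge0 ltW.
have geo n : \sum_(i < n) rho ^+ i <= (1 - rho)^-1 by rewrite geometric_sum_le ?r0.
have row n k : \sum_(j < n) rho ^+ (k - j + (j - k)) <= W.
  rewrite (big_ord_widen_cond (n + k)%N predT (fun j => rho ^+ (k - j + (j - k)))) ?leq_addr//.
  apply: (@le_trans _ _ (\sum_(j < n + k) rho ^+ (k - j + (j - k)))).
    by rewrite big_mkcond/=; apply: ler_sum => i _; case: ifP => // _; rewrite exprn_ge0.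
  rewrite -(big_mkord predT (fun j => rho ^+ (k - j + (j - k)))) (big_cat_nat (n := k))//= ?leq_addl//.
  rewrite /W mulrC mulrDr mulr1 lerD//.
    rewrite big_nat_rev/= add0n (le_trans _ (geo k.+1))// big_ord_recl expr0.
    rewrite ler_wpDl// big_mkord; apply: ler_sum => i _.
    rewrite lift0; have := ltn_ord i; move: (nat_of_ord i) => j jk.
    by have -> : (k - (k - j.+1) + (k - j.+1 - k))%N = j.+1 by lia.
  rewrite -{1}(add0n k) big_addn addnK big_mkord (le_trans _ (geo n))//.
  by apply: ler_sum => i _; have -> : (k - (i + k) + (i + k - k))%N = i by lia.
apply: (@le_trans _ _ (\sum_(k < M) W `^ (p - 1) *
    \sum_(j < N) rho ^+ (k - j + (j - k)) * e j `^ p)).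
  apply: ler_sum => k _; apply: (le_trans (jensen_powR _ p1 _ _)) => //.
    by move=> i; rewrite exprn_ge0.
  rewrite ler_wpM2r ?sumr_ge0//; first by move=> i _; rewrite mulr_ge0 ?exprn_ge0 ?powR_ge0.
  by rewrite ge0_ler_powR ?nnegrE ?subr_ge0 ?(ltW p1)// sumr_ge0// => i _; rewrite exprn_ge0.
rewrite -mulr_sumr -(mulr_powRB1 W0 p0) mulrAC [leRHS]mulrC ler_wpM2l ?powR_ge0//.
rewrite exchange_big/= mulr_sumr; apply: ler_sum => j _.
rewrite -mulr_suml ler_wpM2r ?powR_ge0//.
by under eq_bigr => k _ do rewrite addnC; exact: row.
Qed.

End power_means.

Section integral_power_mean.
Local Open Scope ereal_scope.
Context d (T : measurableType d) (R : realType) (mu : {measure set T -> \bar R}).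

(** The power mean inequality in multiplicative form: when the [p]-th power
    mean of [u] over [A] is at most [B], so is its mean. *)
Lemma integral_power_mean (A : set T) (u : T -> R) (p c B : R) :
  (1 < p)%R -> measurable A -> measurable_fun A u ->
  (forall x, A x -> 0 <= u x)%R -> (0 <= c)%R -> mu A <= c%:E -> (0 <= B)%R ->
  \int[mu]_(x in A) (u x `^ p)%:E <= (c * B `^ p)%:E ->
  \int[mu]_(x in A) (u x)%:E <= (c * B)%:E.
Proof.
move=> p1 mA mU u0 c0 muA B0 uB; have p0 : (0 < p)%R by rewrite (lt_trans _ p1).
suff main : forall B', (B < B')%R -> \int[mu]_(x in A) (u x)%:E <= (c * B')%:E.
  apply/lee_addgt0Pr => e e0.
  apply: (le_trans (main (B + e / (c + 1))%R _)).
    by rewrite ltrDl divr_gt0// ltr_wpDl.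
  rewrite -EFinD lee_fin mulrDr lerD2l mulrA ler_pdivrMr ?ltr_wpDl// mulrC.
  by rewrite ler_wpM2l ?lerDl// ltW.
(* Young's inequality with the constant [B'] as second factor. *)
move=> B' BB'; have B'0 : (0 < B')%R by rewrite (le_lt_trans B0).
have B'p : (0 < B' `^ (p - 1))%R by rewrite powR_gt0.
have mup : measurable_fun A (fun x => (u x `^ p)%R).
  by apply: (measurableT_comp (measurable_powR p)).
have step : \int[mu]_(x in A) ((B' `^ (p - 1))%:E * (u x)%:E) <= (B' `^ (p - 1) * (c * B'))%:E.
  apply: (@le_trans _ _ (\int[mu]_(x in A) ((p^-1)%:E * (u x `^ p)%:E + (B' `^ p * (1 - p^-1))%:E))).
    apply: ge0_le_integral => //.
    - by move=> x Ax; rewrite mule_ge0// lee_fin ?powR_ge0 ?u0.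
    - by apply: measurable_funeM; exact/measurable_EFinP.
    - by apply: emeasurable_funD => //; apply: measurable_funeM; exact/measurable_EFinP.
    - move=> x Ax; rewrite -!EFinM -EFinD lee_fin mulrC (le_trans (young_powR p1 (u0 _ Ax) (ltW B'0)))//.
      by rewrite [(p^-1 * _)%R]mulrC.
  have pp : (0 <= 1 - p^-1)%R by rewrite subr_ge0 invf_le1// ltW.
  rewrite ge0_integralD//; last 3 first.
  - by move=> x Ax; rewrite mule_ge0// lee_fin ?invr_ge0 ?powR_ge0// ltW.
  - by apply: measurable_funeM; exact/measurable_EFinP.
  - by move=> x Ax; rewrite lee_fin mulr_ge0 ?powR_ge0.
  rewrite ge0_integralZl_EFin ?invr_ge0 ?(ltW p0)//; last 2 first.
  - by move=> x Ax; rewrite lee_fin powR_ge0.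
  - exact/measurable_EFinP.
  rewrite integral_cst//.
  apply: (@le_trans _ _ ((p^-1)%:E * (c * B `^ p)%:E + (B' `^ p * (1 - p^-1))%:E * c%:E)).
    apply: leeD; first by rewrite lee_pmul2l// lte_fin invr_gt0.
    by rewrite lee_wpmul2l// lee_fin mulr_ge0 ?powR_ge0.
  rewrite -!EFinM -EFinD lee_fin.
  have -> : (B' `^ (p - 1) * (c * B') = c * B' `^ p)%R.
    by rewrite mulrCA [(_ * B')%R]mulrC mulr_powRB1// ltW.
  rewrite mulrCA.
  apply: (@le_trans _ _ (c * (p^-1 * B' `^ p) + B' `^ p * (1 - p^-1) * c)%R).
    rewrite lerD2r ler_wpM2l// ler_wpM2l ?invr_ge0 ?(ltW p0)//.
    by rewrite ge0_ler_powR ?nnegrE// ltW.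
  by rewrite le_eqVlt; apply/orP; left; apply/eqP; ring.
move: step; rewrite ge0_integralZl_EFin ?(ltW B'p)//; last exact/measurable_EFinP.
by rewrite EFinM lee_pmul2l.
Qed.
End integral_power_mean.

(** * Reduction of the test series to dyadic samples *)

Section nonneg_series.
Context {R : realType}.

Lemma nneseries_ltyP (u : nat -> R) : (forall n, 0 <= u n) ->
  (\sum_(1 <= n <oo) (u n)%:E < +oo)%E <->
  exists B, forall N, \sum_(1 <= n < N) u n <= B.
Proof.
move=> u0; have ue0 n : (1 <= n)%N -> true -> (0 <= (u n)%:E)%E by rewrite lee_fin.
split=> [lty|[B uB]].
  exists (fine (\sum_(1 <= n <oo) (u n)%:E)%E) => N.
  rewrite -lee_fin fineK; last by rewrite ge0_fin_numE// nneseries_ge0.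
  by rewrite -sumEFin; exact: nneseries_lim_ge.
apply: (@le_lt_trans _ _ B%:E); last exact: ltry.
apply: lime_le; first exact: is_cvg_nneseries.
by apply: nearW => N; rewrite sumEFin lee_fin.
Qed.

Lemma sum_dyadic (g : nat -> R) (J : nat) :
  \sum_(1 <= n < 2 ^ J) g n = \sum_(j < J) \sum_(2 ^ j <= n < 2 ^ j.+1) g n.
Proof.
elim: J => [|J IH]; first by rewrite big_ord0 expn0 big_geq.
rewrite big_ord_recr/= -IH -big_cat_nat//=; first exact: expn_gt0.
by rewrite leq_exp2l.
Qed.

Lemma powRD_le (p x y : R) : 0 < p -> 0 <= x -> 0 <= y ->
  (x + y) `^ p <= 2 `^ p * (x `^ p + y `^ p).
Proof.
move=> p0 x0 y0; wlog xy : x y x0 y0 / x <= y => [H|].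
  by case/orP: (le_total x y) => ?; [exact: H|rewrite addrC (addrC (x `^ p)); exact: H].
apply: (@le_trans _ _ ((2 * y) `^ p)).
  by rewrite ge0_ler_powR ?nnegrE ?(ltW p0) ?addr_ge0 ?mulr_ge0//; lra.
by rewrite powRM// ler_wpM2l ?powR_ge0// lerDr powR_ge0.
Qed.

Lemma sum_dyadic_cst (x : R) (j : nat) :
  \sum_(2 ^ j <= m < 2 ^ j.+1) x = (2 ^ j)%:R * x.
Proof.
by rewrite sumr_const_nat (_ : (2 ^ j.+1 - 2 ^ j = 2 ^ j)%N) ?mulr_natl// expnS; lia.
Qed.

Lemma sum_even_block_le (g : nat -> R) (L M : nat) : (0 < L)%N ->
  (forall n, (0 < n)%N -> 0 <= g n) ->
  \sum_(L <= n < M) g (2 * n)%N <= \sum_(2 * L <= n < 2 * M) g n.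
Proof.
move=> L0 g0; have [ML|LM] := leqP M L; first by rewrite !big_geq//; lia.
elim: M LM => // M IH LM.
have [ML|LM'] := leqP M L.
  have -> : M = L by lia.
  rewrite big_nat1 (_ : (2 * L.+1 = (2 * L).+2)%N); last by rewrite mulnS.
  by rewrite big_ltn// lerDl big_nat1 g0//; lia.
rewrite big_nat_recr//= (_ : (2 * M.+1 = (2 * M).+2)%N); last by rewrite mulnS.
rewrite [leRHS]big_nat_recr/=; last by lia.
rewrite [in leRHS]big_nat_recr/=; last by lia.
by rewrite ler_wpDr ?g0//; rewrite lerD// IH.
Qed.

End nonneg_series.

Section NBVS_facts.
Context {R : realType}.
Implicit Types (a : nat -> R) (p : R).

(** The defining inequality of [NBVS] with a given constant. *)
Definition NBVS_bound a (K : R) : Prop := forall n, (1 <= n)%N -> 0 <= a n /\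
  \sum_(n <= m < (2 * n).+1) `|a m - a m.+1| <= K * (a n + a (2 * n)%N).

Lemma NBVS_const a : NBVS a -> exists2 K, 1 <= K & NBVS_bound a K.
Proof.
move=> [a0 [K aK]]; exists (Num.max 1 K); first by rewrite le_max lexx.
move=> n n1; split; first exact: a0.
apply: (le_trans (aK n n1)); rewrite ler_wpM2r ?le_max ?lexx ?orbT//.
by rewrite addr_ge0// a0// muln_gt0.
Qed.

(** One step of the inequality bounds every term of a dyadic block by its two
    endpoints. *)
Lemma NBVS_le a (K : R) (n m : nat) :
  NBVS_bound a K ->
  1 <= K -> (1 <= n)%N -> (n <= m <= 2 * n)%N -> a m <= 2 * K * (a n + a (2 * n)%N).
Proof.
move=> aK K1 n1 /andP[nm m2n]; have [an0 aKn] := aK n n1.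
have a2n0 : 0 <= a (2 * n)%N by apply: (aK _ _).1; rewrite muln_gt0.
have : a m - a n <= K * (a n + a (2 * n)%N).
  apply: le_trans aKn.
  rewrite -(telescope_sumr a nm) [leRHS](big_cat_nat nm)/=; last exact: leq_trans m2n (leqnSn _).
  apply: ler_wpDr; first by apply: sumr_ge0.
  by apply: ler_sum => i _; rewrite distrC ler_norm.
rewrite lerBlDr => /le_trans; apply.
set S := a n + a (2 * n)%N; have S0 : a n <= S by rewrite lerDl.
have : S <= K * S by rewrite ler_peMl// addr_ge0.
lra.
Qed.

Lemma NBVS_powR_le p a (K : R) (n m : nat) : 0 < p -> NBVS_bound a K -> 1 <= K ->
  (1 <= n)%N -> (n <= m <= 2 * n)%N ->
  a m `^ p <= (2 * K) `^ p * 2 `^ p * (a n `^ p + a (2 * n)%N `^ p).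
Proof.
move=> p0 aK K1 n1 nm.
have am0 : 0 <= a m by apply: (aK _ _).1; case/andP: nm => /(leq_trans n1).
have an0 : 0 <= a n by apply: (aK _ _).1.
have a2n0 : 0 <= a (2 * n)%N by apply: (aK _ _).1; rewrite muln_gt0.
have K0 : 0 <= 2 * K by lra.
apply: (@le_trans _ _ ((2 * K * (a n + a (2 * n)%N)) `^ p)).
  apply: ge0_ler_powR; rewrite ?nnegrE ?(ltW p0)//; last exact: NBVS_le.
  by rewrite mulr_ge0// addr_ge0.
by rewrite powRM ?addr_ge0// -mulrA ler_wpM2l ?powR_ge0// powRD_le.
Qed.

(** The terms of the test series, sampled at powers of two and weighted by the
    length of the dyadic block that follows. *)
Definition dyadic_term p a (j : nat) : R :=
  (2 ^ j)%:R `^ (2 * p - 1) * a (2 ^ j)%N `^ p.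

Lemma dyadic_term_ge0 p a j : 0 <= dyadic_term p a j.
Proof. by rewrite mulr_ge0// powR_ge0. Qed.

Lemma dyadic_block_le p a (K : R) (j n : nat) : 1 < p ->
  NBVS_bound a K ->
  1 <= K -> (2 ^ j <= n < 2 ^ j.+1)%N ->
  (2 ^ j)%:R * (n%:R `^ (2 * p - 2) * a n `^ p) <=
  2 `^ (2 * p - 2) * ((2 * K) `^ p * 2 `^ p) *
    (dyadic_term p a j + dyadic_term p a j.+1).
Proof.
move=> p1 aK K1 /andP[jn nj]; have p0 : 0 < p by rewrite (lt_trans _ p1).
have tj : (0 < 2 ^ j)%N by rewrite expn_gt0.
have aDp : a n `^ p <= (2 * K) `^ p * 2 `^ p * (a (2 ^ j)%N `^ p + a (2 ^ j.+1)%N `^ p).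
  by rewrite expnS; apply: NBVS_powR_le; rewrite // jn -expnS ltnW.
have q0 : 0 <= 2 * p - 2 by lra.
have nD : n%:R `^ (2 * p - 2) <= 2 `^ (2 * p - 2) * (2 ^ j)%:R `^ (2 * p - 2) :> R.
  rewrite -powRM// ge0_ler_powR ?nnegrE ?mulr_ge0// -natrM ler_nat -expnS.
  exact: ltnW.
set X := 2 `^ (2 * p - 2); set Y := (2 * K) `^ p * 2 `^ p.
have XX : (2 ^ j)%:R * (2 ^ j)%:R `^ (2 * p - 2) = (2 ^ j)%:R `^ (2 * p - 1) :> R.
  by rewrite (_ : 2 * p - 2 = 2 * p - 1 - 1) ?mulr_powRB1//; [lra|ring].
apply: (@le_trans _ _ ((2 ^ j)%:R * (X * (2 ^ j)%:R `^ (2 * p - 2) *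
    (Y * (a (2 ^ j)%N `^ p + a (2 ^ j.+1)%N `^ p))))).
  by rewrite ler_wpM2l// ler_pM ?powR_ge0.
have -> : (2 ^ j)%:R * (X * (2 ^ j)%:R `^ (2 * p - 2) *
    (Y * (a (2 ^ j)%N `^ p + a (2 ^ j.+1)%N `^ p))) =
  X * Y * ((2 ^ j)%:R * (2 ^ j)%:R `^ (2 * p - 2) *
    (a (2 ^ j)%N `^ p + a (2 ^ j.+1)%N `^ p)) by ring.
rewrite XX ler_wpM2l ?mulr_ge0 ?powR_ge0// mulrDr lerD2l.
rewrite ler_wpM2r ?powR_ge0// ge0_ler_powR ?nnegrE//; first by lra.
by rewrite ler_nat leq_exp2l.
Qed.

Lemma dyadic_term_le p a (K : R) (j m : nat) : 1 < p ->
  NBVS_bound a K ->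
  1 <= K -> (2 ^ j <= m < 2 ^ j.+1)%N ->
  dyadic_term p a j.+1 <=
  2 `^ (2 * p - 1) * ((2 * K) `^ p * 2 `^ p) * (2 ^ j)%:R *
   (m%:R `^ (2 * p - 2) * a m `^ p +
    (2 * m)%:R `^ (2 * p - 2) * a (2 * m)%N `^ p).
Proof.
move=> p1 aK K1 /andP[jm mj]; have p0 : 0 < p by rewrite (lt_trans _ p1).
have tj : (0 < 2 ^ j)%N by rewrite expn_gt0.
have m1 : (1 <= m)%N by exact: leq_trans jm.
have aDp : a (2 ^ j.+1)%N `^ p <= (2 * K) `^ p * 2 `^ p * (a m `^ p + a (2 * m)%N `^ p).
  by apply: NBVS_powR_le; rewrite // (ltnW mj)/= expnS leq_mul2l jm.
have q0 : 0 <= 2 * p - 2 by lra.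
have XX : (2 ^ j)%:R `^ (2 * p - 1) = (2 ^ j)%:R * (2 ^ j)%:R `^ (2 * p - 2) :> R.
  by rewrite (_ : 2 * p - 2 = 2 * p - 1 - 1) ?mulr_powRB1//; [lra|ring].
rewrite /dyadic_term expnS natrM powRM// XX.
set X := 2 `^ _; set Y := (2 * K) `^ p * 2 `^ p.
apply: (@le_trans _ _ (X * ((2 ^ j)%:R * (2 ^ j)%:R `^ (2 * p - 2)) *
   (Y * (a m `^ p + a (2 * m)%N `^ p)))).
  by rewrite -expnS ler_wpM2l// !mulr_ge0 ?powR_ge0.
have -> : X * ((2 ^ j)%:R * (2 ^ j)%:R `^ (2 * p - 2)) * (Y * (a m `^ p + a (2 * m)%N `^ p)) =
  X * Y * (2 ^ j)%:R * ((2 ^ j)%:R `^ (2 * p - 2) * a m `^ p + (2 ^ j)%:R `^ (2 * p - 2) * a (2 * m)%N `^ p) by ring.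
rewrite ler_wpM2l ?mulr_ge0 ?powR_ge0//.
apply: lerD; rewrite ler_wpM2r ?powR_ge0// ge0_ler_powR ?nnegrE// ler_nat//.
by rewrite (leq_trans jm)// leq_pmull.
Qed.

(** For a sequence in [NBVS] the test series converges exactly when its dyadic
    samples do. *)
Lemma NBVS_condition_dyadic p a : 1 < p -> NBVS a ->
  (\sum_(1 <= n <oo) (n%:R `^ (2 * p - 2) * a n `^ p)%:E < +oo)%E <->
  exists B, forall J, \sum_(j < J) dyadic_term p a j <= B.
Proof.
move=> p1 /NBVS_const[K K1 aK].
pose g n := n%:R `^ (2 * p - 2) * a n `^ p.
have g0 n : 0 <= g n by rewrite mulr_ge0 ?powR_ge0.
rewrite (nneseries_ltyP g0); split=> [[B gB]|[B dB]].
  pose C := 2 `^ (2 * p - 1) * ((2 * K) `^ p * 2 `^ p).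
  have C0 : 0 <= C by rewrite !mulr_ge0 ?powR_ge0.
  exists (dyadic_term p a 0 + C * (B + B)) => J.
  have B0 : 0 <= B by rewrite (le_trans _ (gB 1%N))// big_geq.
  case: J => [|J]; first by rewrite big_ord0 addr_ge0 ?dyadic_term_ge0// mulr_ge0 ?addr_ge0.
  rewrite big_ord_recl lerD2l.
  apply: (@le_trans _ _ (\sum_(j < J) \sum_(2 ^ j <= m < 2 ^ j.+1) C * (g m + g (2 * m)%N))).
    apply: ler_sum => j _; rewrite lift0.
    have tj : (0 : R) < (2 ^ j)%:R by rewrite ltr0n expn_gt0.
    rewrite -(ler_pM2l tj).
    rewrite -sum_dyadic_cst.
    rewrite mulr_sumr; apply: ler_sum_nat => m mj.
    rewrite (le_trans (dyadic_term_le p1 aK K1 mj))// -/C.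
    by rewrite le_eqVlt; apply/orP; left; apply/eqP; rewrite /g; ring.
  rewrite -sum_dyadic -mulr_sumr ler_wpM2l// big_split/= lerD//.
  apply: le_trans (gB (2 * 2 ^ J)%N).
  apply: (le_trans (sum_even_block_le _ (ltn0Sn 0) (fun n _ => g0 n))).
  by rewrite muln1 [leRHS]big_ltn ?lerDr//; have := expn_gt0 2 J; lia.
pose C := 2 `^ (2 * p - 2) * ((2 * K) `^ p * 2 `^ p).
have C0 : 0 <= C by rewrite !mulr_ge0 ?powR_ge0.
have d0 := dyadic_term_ge0 p a.
exists (C * (B + B)) => N.
apply: (@le_trans _ _ (\sum_(1 <= n < 2 ^ N) g n)).
  have NN : (N <= 2 ^ N)%N by rewrite ltnW// ltn_expl.
  have [N0|N0] := posnP N; first by rewrite N0 big_geq// sumr_ge0.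
  by rewrite [leRHS](big_cat_nat N0 NN)/= lerDl sumr_ge0.
rewrite sum_dyadic.
apply: (@le_trans _ _ (\sum_(j < N) C * (dyadic_term p a j + dyadic_term p a j.+1))).
  apply: ler_sum => j _.
  have tj : (0 : R) < (2 ^ j)%:R by rewrite ltr0n expn_gt0.
  rewrite -(ler_pM2l tj) mulr_sumr.
  rewrite -sum_dyadic_cst.
  by apply: ler_sum_nat => m mj; exact: dyadic_block_le.
rewrite -mulr_sumr ler_wpM2l// big_split/=; apply: lerD; first exact: dB.
by apply: le_trans (dB N.+1); rewrite big_ord_recl lerDr.
Qed.

End NBVS_facts.

(** * Trigonometric inequalities and Riemann's summation kernel *)

Section trigonometric_inequalities.
Context {R : realType}.
Implicit Types (x u v t c : R).

Lemma is_derive_ge0 (f df : R -> R) : (forall x, is_derive x (1 : R) f (df x)) ->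
  f 0 = 0 -> (forall x, 0 <= x -> 0 <= df x) -> forall x, 0 <= x -> 0 <= f x.
Proof.
move=> fdf f0 df0 x x0.
have [|y] := @MVT_segment R f df 0 x x0.
  apply: continuous_subspaceT => z.
  by apply: differentiable_continuous; apply/derivable1_diffP; case: (fdf z).
rewrite in_itv/= => /andP[y0 _].
by rewrite f0 !subr0 => ->; rewrite mulr_ge0// df0.
Qed.

Lemma sin_le_id x : 0 <= x -> sin x <= x.
Proof.
have D y : is_derive y (1 : R) (fun x => x - sin x) (1 - cos y) by apply: is_derive_eq.
move=> x0; rewrite -subr_ge0; apply: (is_derive_ge0 D) x0.
  by rewrite sin0 subr0.
by move=> y _; rewrite subr_ge0 cos_le1.
Qed.

Lemma cos_ge_taylor2 x : 1 - x ^+ 2 / 2 <= cos x.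
Proof.
wlog x0 : x / 0 <= x => [H|].
  by case/orP: (le_total 0 x) => [/H//|x0]; rewrite -cosN -sqrrN H// oppr_ge0.
have D y : is_derive y (1 : R) (fun x => cos x - (1 - x ^+ 2 / 2)) (y - sin y).
  by apply: is_derive_eq; rewrite /GRing.scale/=; field.
rewrite -subr_ge0; apply: (is_derive_ge0 D) x0.
  by rewrite cos0 expr0n/=; ring.
by move=> y y0; rewrite subr_ge0 sin_le_id.
Qed.

Lemma sin_ge_taylor3 x : 0 <= x -> x - x ^+ 3 / 6 <= sin x.
Proof.
have D y : is_derive y (1 : R) (fun x => sin x - (x - x ^+ 3 / 6))
    (cos y - (1 - y ^+ 2 / 2)).
  by apply: is_derive_eq; rewrite /GRing.scale/=; field.
move=> x0; rewrite -subr_ge0; apply: (is_derive_ge0 D) x0.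
  by rewrite sin0 expr0n/=; ring.
by move=> y _; rewrite subr_ge0 cos_ge_taylor2.
Qed.

Lemma cos_le_taylor4 x : cos x <= 1 - x ^+ 2 / 2 + x ^+ 4 / 24.
Proof.
wlog x0 : x / 0 <= x => [H|].
  case/orP: (le_total 0 x) => [/H//|x0]; rewrite -cosN -sqrrN.
  have -> : x ^+ 4 = (- x) ^+ 4 by ring.
  by rewrite H// oppr_ge0.
have D y : is_derive y (1 : R) (fun x => 1 - x ^+ 2 / 2 + x ^+ 4 / 24 - cos x)
    (sin y - (y - y ^+ 3 / 6)).
  by apply: is_derive_eq; rewrite /GRing.scale/=; field.
rewrite -subr_ge0; apply: (is_derive_ge0 D) x0.
  by rewrite cos0 !expr0n/=; ring.
by move=> y y0; rewrite subr_ge0 sin_ge_taylor3.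
Qed.

Lemma one_sub_cos_ge u : 0 <= u <= 2 -> u ^+ 2 / 4 <= 1 - cos u.
Proof.
move=> /andP[u0 u2]; have := cos_le_taylor4 u; have := sqr_ge0 u.
have : u ^+ 4 <= 4 * u ^+ 2.
  rewrite (exprD u 2 2) ler_wpM2r ?sqr_ge0//.
  have : 0 <= (2 - u) * (2 + u) by rewrite mulr_ge0//; lra.
  lra.
lra.
Qed.

Lemma abs_sin_half_ge x : `|x| <= 4 -> `|x| / 6 <= `|sin (x / 2)|.
Proof.
wlog x0 : x / 0 <= x => [H|].
  case/orP: (le_total 0 x) => [/H//|x0] x4.
  by rewrite -normrN -[leRHS]normrN -sinN -mulNr H ?normrN// oppr_ge0.
rewrite ger0_norm// => x4; have x20 : 0 <= x / 2 by rewrite divr_ge0.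
rewrite (le_trans _ (ler_norm _))// (le_trans _ (sin_ge_taylor3 x20))//.
have : (x / 2) ^+ 3 <= 4 * (x / 2).
  rewrite exprS mulrC ler_wpM2r//.
  have : 0 <= (2 - x / 2) * (2 + x / 2) by rewrite mulr_ge0//; lra.
  lra.
lra.
Qed.

(** The Dirichlet kernel bound; any consecutive block of frequencies and any
    phase are allowed. *)
Lemma dirichlet_sin c x (m n : nat) :
  `|sin (x / 2)| * `|\sum_(m <= i < n) sin (i%:R * x + c)| <= 1.
Proof.
have [nm|mn] := leqP n m; first by rewrite big_geq// normr0 mulr0.
rewrite -normrM mulr_sumr.
have -> : \sum_(m <= i < n) sin (x / 2) * sin (i%:R * x + c) =
   \sum_(m <= i < n) (- cos ((i.+1)%:R * x - x / 2 + c) / 2 - (- cos (i%:R * x - x / 2 + c) / 2)).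
  apply: eq_bigr => i _.
  have -> : (i.+1)%:R * x - x / 2 + c = (i%:R * x + c) + x / 2 by rewrite -natr1; field.
  have -> : i%:R * x - x / 2 + c = (i%:R * x + c) - x / 2 by ring.
  by rewrite cosD cosB; field.
rewrite (telescope_sumr (fun i => - cos (i%:R * x - x / 2 + c) / 2)) ?(ltnW mn)//.
have := cos_le1 (n%:R * x - x / 2 + c); have := cos_geN1 (n%:R * x - x / 2 + c).
have := cos_le1 (m%:R * x - x / 2 + c); have := cos_geN1 (m%:R * x - x / 2 + c).
by move=> *; rewrite ler_norml; lra.
Qed.

End trigonometric_inequalities.

Section riemann_kernel.
Context {R : realType}.
Implicit Types (x u v t c : R).

(** Riemann's summation kernel [(sin (u / 2) / (u / 2)) ^ 2]. *)
Definition riemann_kernel u : R := 2 * (1 - cos u) / u ^+ 2.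

Local Notation phi := riemann_kernel.

Lemma riemann_kernel_ge0 u : 0 <= phi u.
Proof. by rewrite /phi divr_ge0 ?sqr_ge0// mulr_ge0// subr_ge0 cos_le1. Qed.

Lemma riemann_kernel_le1 u : 0 < u -> phi u <= 1.
Proof.
move=> u0; rewrite /phi ler_pdivrMr ?exprn_gt0//.
by have := cos_ge_taylor2 u; lra.
Qed.

Lemma riemann_kernel_ge u : 0 < u -> 1 - u ^+ 2 <= phi u.
Proof.
move=> u0; rewrite /phi ler_pdivlMr ?exprn_gt0//.
have := cos_le_taylor4 u; have : 0 <= u ^+ 4 by rewrite exprn_ge0// ltW.
rewrite mulrBl mul1r -exprD; lra.
Qed.

Lemma riemann_kernel_le u : 0 < u -> phi u <= 4 / u ^+ 2.
Proof.
move=> u0; rewrite /phi ler_wpM2r ?invr_ge0 ?sqr_ge0//.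
by have := cos_geN1 u; lra.
Qed.

Lemma cos_lipschitz u v : u <= v -> `|cos u - cos v| <= v - u.
Proof.
move=> uv.
have [|y _ E] := @MVT_segment R cos (fun x => - sin x) u v uv.
  by apply: continuous_subspaceT => x; exact: continuous_cos.
rewrite distrC E normrM normrN [`|v - u|]ger0_norm ?subr_ge0//.
by rewrite ler_piMl ?subr_ge0// sin_max.
Qed.

(** The kernel has bounded variation, in a quantitative form: its increments
    are dominated by an integrable function. *)
Lemma riemann_kernel_diff u t : 0 < t <= u ->
  `|phi u - phi (u + t)| <= 14 * t * Num.min 1 (1 / u ^+ 2).
Proof.
move=> /andP[t0 tu]; have u0 : 0 < u by rewrite (lt_le_trans t0).
set v := u + t; have v0 : 0 < v by rewrite addr_gt0.
have uv : u < v by rewrite ltrDl.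
have v2u : v <= 2 * u by rewrite /v; lra.
have vu : v ^+ 2 - u ^+ 2 <= 3 * u * t.
  have -> : v ^+ 2 - u ^+ 2 = t * (u + v) by rewrite /v; ring.
  by rewrite [leRHS]mulrC ler_wpM2l ?(ltW t0)//; lra.
have vu0 : 0 <= v ^+ 2 - u ^+ 2 by rewrite subr_ge0 ler_sqr ?nnegrE ?(ltW u0) ?(ltW v0)// ltW.
pose N := (1 - cos u) * (v ^+ 2 - u ^+ 2) - u ^+ 2 * (cos u - cos v).
have u20 : 0 < u ^+ 2 by rewrite exprn_gt0.
have v20 : 0 < v ^+ 2 by rewrite exprn_gt0.
have phiE : phi u - phi v = 2 * N / (u ^+ 2 * v ^+ 2).
  by rewrite /phi /N; field; rewrite !gt_eqF.
rewrite phiE normrM normfV [`|u ^+ 2 * _|]gtr0_norm ?mulr_gt0//.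
rewrite ler_pdivrMr ?mulr_gt0// normrM ger0_norm//.
have cu0 : 0 <= 1 - cos u by rewrite subr_ge0 cos_le1.
have cu2 : 1 - cos u <= 2 by have := cos_geN1 u; lra.
have [u1|u1] := leP u 1.
- have -> : Num.min 1 (1 / u ^+ 2) = 1.
    by rewrite min_l// ler_pdivlMr// mul1r expr_le1// ltW.
  pose r x : R := cos x - (1 - x ^+ 2 / 2).
  have r0 : 0 <= r u by rewrite subr_ge0 cos_ge_taylor2.
  have r4 : r u <= u ^+ 4 / 24 by rewrite /r; have := cos_le_taylor4 u; lra.
  have rE : exists2 y, u <= y <= v & r v - r u = (y - sin y) * t.
    have [|||y uyv E] := @MVT_segment R r (fun x => x - sin x) u v.
    + exact: ltW.
    + by move=> x _; apply: is_derive_eq; rewrite /GRing.scale/=; field.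
    + apply: continuous_subspaceT => x.
      by apply: differentiable_continuous; apply/derivable1_diffP.
    by exists y => //; rewrite E /v; congr (_ * _); ring.
  have [y /andP[uy yv] rvu] := rE.
  have y0 : 0 <= y by rewrite (le_trans (ltW u0)).
  have ry0 : 0 <= y - sin y by rewrite subr_ge0 sin_le_id.
  have ry1 : y - sin y <= v ^+ 3 / 6.
    have := sin_ge_taylor3 y0.
    have : y ^+ 3 <= v ^+ 3 by rewrite lerXn2r ?nnegrE// ltW.
    lra.
  have NE : N = - r u * (v ^+ 2 - u ^+ 2) + u ^+ 2 * (r v - r u).
    by rewrite /N /r; field.
  have v3 : v ^+ 3 <= 8 * u ^+ 3.
    have -> : 8 * u ^+ 3 = (2 * u) ^+ 3 by ring.
    by rewrite lerXn2r ?nnegrE ?mulr_ge0 ?(ltW u0) ?(ltW v0).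
  have b1 : r u * (v ^+ 2 - u ^+ 2) <= u ^+ 4 / 24 * (3 * u * t) by rewrite ler_pM.
  have b2 : (y - sin y) * t <= 8 * u ^+ 3 / 6 * t by rewrite ler_wpM2r ?(ltW t0)//; lra.
  have b2' : 0 <= u ^+ 2 * ((y - sin y) * t) by rewrite mulr_ge0 ?sqr_ge0// mulr_ge0// ltW.
  have b3 : u ^+ 2 * ((y - sin y) * t) <= u ^+ 2 * (8 * u ^+ 3 / 6 * t).
    by rewrite ler_wpM2l// ltW.
  have b1' : 0 <= r u * (v ^+ 2 - u ^+ 2) by rewrite mulr_ge0.
  have u5 : u ^+ 5 * t <= u ^+ 2 * v ^+ 2 * t.
    rewrite ler_wpM2r ?(ltW t0)// (exprD u 2 3) ler_wpM2l ?(ltW u20)//.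
    rewrite exprSr (le_trans (y := u ^+ 2))// ?ler_piMr ?(ltW u20)//.
    by rewrite ler_sqr ?nnegrE ?(ltW u0) ?(ltW v0)// ltW.
  have u50 : 0 <= u ^+ 2 * v ^+ 2 * t by rewrite !mulr_ge0// ltW.
  have Nb : `|N| <= 2 * (u ^+ 5 * t).
    rewrite NE rvu ler_norml; apply/andP; split; lra.
  rewrite mulr1; lra.
- have u12 : 1 < u ^+ 2 by rewrite expr_gt1// ltW.
  have -> : Num.min 1 (1 / u ^+ 2) = 1 / u ^+ 2.
    by rewrite min_r// ler_pdivrMr// mul1r ltW.
  have -> : 14 * t * (1 / u ^+ 2) * (u ^+ 2 * v ^+ 2) = 14 * t * v ^+ 2.
    by field; rewrite gt_eqF.
  have b1 : `|(1 - cos u) * (v ^+ 2 - u ^+ 2)| <= 2 * (3 * u * t).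
    by rewrite ger0_norm ?mulr_ge0// ler_pM.
  have b2 : `|u ^+ 2 * (cos u - cos v)| <= u ^+ 2 * t.
    rewrite normrM ger0_norm ?(ltW u20)// ler_wpM2l ?(ltW u20)//.
    by rewrite (le_trans (cos_lipschitz (ltW uv)))// /v; lra.
  have b3 : u * t <= u ^+ 2 * t by rewrite ler_wpM2r ?(ltW t0)// expr2 ler_peMr// ltW.
  have b4 : u ^+ 2 * t <= v ^+ 2 * t.
    by rewrite ler_wpM2r ?(ltW t0)// ler_sqr ?nnegrE ?(ltW u0) ?(ltW v0)// ltW.
  have := ler_normB ((1 - cos u) * (v ^+ 2 - u ^+ 2)) (u ^+ 2 * (cos u - cos v)).
  rewrite -/N; lra.
Qed.

(** The majorant of the increments of [riemann_kernel] along an arithmetic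
    progression is summable, uniformly in the step [t]; the sum telescopes
    against [x / (1 + x)]. *)
Lemma sum_min_le t (N : nat) : 0 < t ->
  \sum_(1 <= n < N) t * Num.min 1 (1 / (n%:R * t) ^+ 2) <= 4.
Proof.
move=> t0.
pose psi (n : nat) : R := n.-1%:R * t / (1 + n.-1%:R * t).
have pos (n : nat) : 0 < 1 + n%:R * t by rewrite ltr_pwDl// mulr_ge0// ltW.
apply: (@le_trans _ _ (\sum_(1 <= n < N) (4 * psi n.+1 - 4 * psi n))).
  apply: ler_sum_nat => n /andP[n1 _].
  have nt0 : 0 < n%:R * t by rewrite mulr_gt0// ltr0n.
  have E : 4 * psi n.+1 - 4 * psi n = 4 * t / ((1 + n%:R * t) * (1 + n.-1%:R * t)).
    rewrite /psi/= -{1 2 5 6}(prednK n1) -natr1.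
    have := pos n.-1; have := pos n; rewrite -{1}(prednK n1) -natr1.
    by move=> *; field; rewrite !gt_eqF.
  rewrite E ler_pdivlMr ?mulr_gt0// -mulrA [4 * t]mulrC ler_wpM2l ?(ltW t0)//.
  set w := n%:R * t.
  have w1 : 1 + n.-1%:R * t <= 1 + w by rewrite lerD2l ler_wpM2r ?(ltW t0)// ler_nat leq_pred.
  apply: (@le_trans _ _ (Num.min 1 (1 / w ^+ 2) * ((1 + w) * (1 + w)))).
    apply: ler_wpM2l; first by rewrite le_min ler01 divr_ge0// sqr_ge0.
    by apply: ler_wpM2l => //; exact: ltW (pos n).
  have w0 : 0 < w by [].
  have [w1'|w1'] := leP w 1.
    apply: (@le_trans _ _ (1 * ((1 + w) * (1 + w)))).
      by rewrite ler_wpM2r ?ge_min ?lexx// mulr_ge0//; lra.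
    have : 0 <= (1 - w) * (3 + w) by rewrite mulr_ge0//; lra.
    lra.
  apply: (@le_trans _ _ (1 / w ^+ 2 * ((1 + w) * (1 + w)))).
    by rewrite ler_wpM2r ?ge_min ?lexx ?orbT// mulr_ge0//; lra.
  rewrite mulrAC mul1r ler_pdivrMr ?exprn_gt0//.
  have : 0 <= (w - 1) * (3 * w + 1) by rewrite mulr_ge0//; lra.
  lra.
have [N1|N1] := leqP N 1; first by rewrite big_geq.
rewrite (telescope_sumr (fun n => 4 * psi n)) 1?ltnW//.
rewrite {2}/psi/= mul0r mul0r mulr0 subr0 -[leRHS]mulr1 ler_wpM2l//.
by rewrite /psi ler_pdivrMr// mul1r lerDr.
Qed.

(** A Toeplitz summability theorem, in a form uniform in the length [N]. *)
Lemma toeplitz_null (s : nat -> R) (w : R -> nat -> R) (C : R) :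
  s @ \oo --> (0 : R) ->
  (forall t N, 0 < t -> \sum_(1 <= n < N) `|w t n| <= C) ->
  (forall n, (1 <= n)%N -> w t n @[t --> (0 : R)^'+] --> (0 : R)) ->
  forall eps : R, 0 < eps -> \forall t \near (0 : R)^'+,
    forall N, `|\sum_(1 <= n < N) s n * w t n| <= eps.
Proof.
move=> s0 wC w0 eps eps0.
have C0 : 0 <= C by rewrite (le_trans _ (wC 1 0%N ltr01))// big_geq.
have e2 : 0 < eps / 2 / (C + 1) by rewrite !divr_gt0// ltr_wpDl.
move/cvgrPdist_le : s0 => /(_ _ e2)[M _ sM].
pose M1 := M.+1.
have head : \sum_(1 <= n < M1) `|s n| * `|w t n| @[t --> (0 : R)^'+] --> (0 : R).
  elim: M1 => [|m IH].
    under eq_fun do rewrite big_geq//; exact: cvg_cst.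
  have [->|m0] := posnP m; first by under eq_fun do rewrite big_geq//; exact: cvg_cst.
  under eq_fun do rewrite big_nat_recr//=.
  have h : `|s m| * `|w t m| @[t --> (0 : R)^'+] --> `|s m| * 0.
    by apply: cvgMl_tmp; have := cvg_norm (w0 m m0); rewrite normr0; exact.
  have := @cvgD R R R (0 : R)^'+ _ _ _ _ _ IH h; rewrite mulr0 addr0; exact.
have e20 : 0 < eps / 2 by rewrite divr_gt0.
move/cvgrPdist_le : head => /(_ _ e20) head.
move: head; apply: filter_app; near=> t.
rewrite sub0r normrN ger0_norm; last by rewrite sumr_ge0// => n _; rewrite mulr_ge0.
move=> head; have t0 : 0 < t by near: t; exact: nbhs_right_gt.
move=> N; rewrite (le_trans (ler_norm_sum _ _ _))//.
apply: (@le_trans _ _ (\sum_(1 <= n < M1) `|s n| * `|w t n| +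
     \sum_(1 <= n < N) eps / 2 / (C + 1) * `|w t n|)).
  under eq_bigr do rewrite normrM.
  have tail n : (M <= n)%N -> `|s n| <= eps / 2 / (C + 1).
    by move=> /sM; rewrite /= sub0r normrN.
  have [NM|NM] := leqP N M1.
    apply: (@le_trans _ _ (\sum_(1 <= n < M1) `|s n| * `|w t n|)).
      have [N1|N1] := leqP N 1; first by rewrite big_geq// sumr_ge0// => n _; rewrite mulr_ge0.
      by rewrite [leRHS](big_cat_nat (ltnW N1) NM)/= lerDl; apply: sumr_ge0 => n _; exact: mulr_ge0.
    by rewrite lerDl sumr_ge0// => n _; rewrite mulr_ge0// ltW.
  rewrite (@big_cat_nat _ _ _ M1)//= ?(ltnW NM)// lerD2l.
  apply: (@le_trans _ _ (\sum_(M1 <= n < N) eps / 2 / (C + 1) * `|w t n|)).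
    apply: ler_sum_nat => n /andP[Mn _]; rewrite ler_wpM2r// tail// ltnW//.
  rewrite [leRHS](@big_cat_nat _ _ _ M1)//= ?(ltnW NM)// lerDr.
  by apply: sumr_ge0 => n _; rewrite mulr_ge0// ltW.
have : eps / 2 / (C + 1) * \sum_(1 <= n < N) `|w t n| <= eps / 2.
  rewrite mulrAC ler_pdivrMr ?ltr_wpDl// ler_wpM2l ?(ltW e20)//.
  by rewrite (le_trans (wC t N t0))// lerDl.
rewrite -mulr_sumr; lra.
Unshelve. all: by end_near. Qed.

End riemann_kernel.

(** * Riemann's theory of the twice integrated series *)

Section cauchy_sequences.
Context {R : realType}.

(** Cauchy's criterion with an explicit rate, which passes to the limit. *)
Lemma cvg_of_tail (S tau : nat -> R) : tau @ \oo --> (0 : R) ->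
  (forall N M, (1 <= N <= M)%N -> `|S M - S N| <= tau N) ->
  exists2 l, S @ \oo --> l & forall N, (1 <= N)%N -> `|l - S N| <= tau N.
Proof.
move=> tau0 cS.
have t0 N : (1 <= N)%N -> 0 <= tau N.
  by move=> N1; rewrite (le_trans _ (cS N N _)) ?N1/=.
pose E := [set x | exists2 N, (1 <= N)%N & x = S N - tau N].
have ubE N : (1 <= N)%N -> ubound E (S N + tau N).
  move=> N1 _ [M M1 ->]; case/orP: (leq_total M N) => MN.
    have := cS M N; rewrite M1 MN => /(_ isT); rewrite ler_norml => /andP[h _].
    have := t0 _ N1; lra.
  have := cS N M; rewrite N1 MN => /(_ isT); rewrite ler_norml => /andP[_ h].
  have := t0 _ M1; lra.
have E0 : E !=set0 by exists (S 1%N - tau 1%N), 1%N.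
have supE : has_sup E by split => //; exists (S 1%N + tau 1%N); exact: ubE.
have lS N : (1 <= N)%N -> `|sup E - S N| <= tau N.
  move=> N1; rewrite ler_norml; apply/andP; split.
    by rewrite lerBrDr addrC ub_le_sup//; [case: supE|exists N].
  by rewrite lerBlDr addrC ge_sup//; exact: ubE.
exists (sup E) => //.
apply/cvgrPdist_le => e e0; move/cvgrPdist_le : tau0 => /(_ e e0).
apply: filter_app; near=> N => h.
have N1 : (1 <= N)%N by near: N; exists 1%N.
rewrite (le_trans (lS N N1))//; move: h; rewrite sub0r normrN.
exact: le_trans (ler_norm _).
Unshelve. all: by end_near. Qed.

Lemma cvg_inv_nat : (fun N : nat => N%:R^-1 : R) @ \oo --> (0 : R).
Proof.
by rewrite -(cvg_shiftS (fun N : nat => N%:R^-1 : R)); exact: cvg_harmonic.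
Qed.

Lemma sum_inv_sq_le (m N : nat) : (1 <= m)%N ->
  \sum_(m <= n < N) 1 / n%:R ^+ 2 <= 2 / m%:R :> R.
Proof.
move=> m1; have m0 : 0 <= 2 / m%:R :> R by rewrite divr_ge0.
have [Nm|mN] := leqP N m; first by rewrite big_geq.
apply: (@le_trans _ _ (\sum_(m <= n < N) (- (2 / n.+1%:R) - - (2 / n%:R)))).
  apply: ler_sum_nat => n /andP[mn _].
  have n0 : 0 < n%:R :> R by rewrite ltr0n (leq_trans m1).
  have n1 : 0 < n.+1%:R :> R by rewrite ltr0n.
  have -> : - (2 / n.+1%:R) - - (2 / n%:R) = 2 / (n%:R * n.+1%:R) :> R.
    by rewrite -natr1 in n1 *; field; rewrite !gt_eqF.
  rewrite ler_pdivrMr ?exprn_gt0// mulrAC ler_pdivlMr ?mulr_gt0//.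
  have h1 : 1 <= n%:R :> R by rewrite ler1n (leq_trans m1).
  have : 0 <= n%:R * (n%:R - 1) :> R by rewrite mulr_ge0 ?subr_ge0.
  rewrite -natr1; lra.
rewrite (telescope_sumr (fun n => - (2 / n%:R)) (ltnW mN)) opprK addrC.
by rewrite gerBl divr_ge0.
Qed.

Lemma abel_sum (s phi : nat -> R) (N : nat) :
  \sum_(1 <= n < N.+2) (s n - s n.-1) * phi n =
  \sum_(1 <= n < N.+1) s n * (phi n - phi n.+1) - s 0%N * phi 1%N + s N.+1 * phi N.+1.
Proof.
elim: N => [|N IH]; first by rewrite big_nat1 big_geq//=; ring.
by rewrite big_nat_recr//= IH [in RHS]big_nat_recr//=; ring.
Qed.

End cauchy_sequences.

Section second_primitive.
Context {R : realType}.
Variables (a : nat -> R) (A c : R).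
Hypothesis aA : forall n, (1 <= n)%N -> 0 <= a n <= A.

(** Partial sums of the series; [N] is excluded. Cosine series are the case
    [c = 0], and sine series the case [c = - (pi / 2)]. *)
Definition trig_sum (N : nat) (x : R) : R :=
  \sum_(1 <= n < N) a n * cos (n%:R * x + c).

(** The series integrated twice, Riemann's auxiliary function. *)
Definition riemann_sum (N : nat) (x : R) : R :=
  - \sum_(1 <= n < N) a n * cos (n%:R * x + c) / n%:R ^+ 2.

Definition riemann_fun (x : R) : R := limn (riemann_sum ^~ x).

Let A0 : 0 <= A.
Proof. by have /andP[] := aA (leqnn 1); exact: le_trans. Qed.

Lemma riemann_sum_term_le (n : nat) (y : R) : (1 <= n)%N ->
  `|a n * cos y / n%:R ^+ 2| <= A * (1 / n%:R ^+ 2).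
Proof.
move=> n1; rewrite mul1r normrM [`|n%:R ^- 2|]ger0_norm ?invr_ge0 ?sqr_ge0//.
rewrite ler_wpM2r ?invr_ge0 ?sqr_ge0// normrM.
have /andP[a0 aAn] := aA n1.
by rewrite -[leRHS]mulr1 ler_pM ?cos_max// ger0_norm.
Qed.

Lemma riemann_fun_spec x : riemann_sum ^~ x @ \oo --> riemann_fun x /\
  forall N, (1 <= N)%N -> `|riemann_fun x - riemann_sum N x| <= A * (2 / N%:R).
Proof.
have [||l lS lN] := @cvg_of_tail R (riemann_sum ^~ x) (fun N => A * (2 / N%:R)).
- rewrite -[X in _ --> X](mulr0 A); apply: cvgMl_tmp.
  rewrite -[X in _ --> X](mulr0 2); apply: cvgMl_tmp.
  exact: cvg_inv_nat.
- move=> N M /andP[N1 NM]; rewrite /riemann_sum (big_cat_nat N1 NM)/=.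
  rewrite opprD addrAC subrr add0r normrN (le_trans (ler_norm_sum _ _ _))//.
  apply: (@le_trans _ _ (\sum_(N <= n < M) A * (1 / n%:R ^+ 2))).
    apply: ler_sum_nat => n /andP[Nn _]; apply: riemann_sum_term_le.
    exact: leq_trans Nn.
  by rewrite -mulr_sumr ler_wpM2l// sum_inv_sq_le.
by rewrite (_ : riemann_fun x = l)//; exact/cvg_lim.
Qed.

Lemma continuous_riemann_fun : continuous riemann_fun.
Proof.
move=> x; apply/cvgrPdist_le => e e0.
have e3 : 0 < e / 3 / (2 * A + 1) by rewrite !divr_gt0// ltr_wpDl// mulr_ge0.
have [M _ hM] := near_infty_natSinv_lt (PosNum e3).
pose N := M.+1.
have tail y : `|riemann_fun y - riemann_sum N y| <= e / 3.
  rewrite (le_trans ((riemann_fun_spec y).2 N _))// mulrA.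
  have h : N%:R^-1 <= e / 3 / (2 * A + 1) by apply: ltW; exact: (hM M (leqnn _)).
  have [NN] : 0 <= N%:R^-1 :> R by rewrite invr_ge0.
  apply: (@le_trans _ _ ((2 * A + 1) * N%:R^-1)).
    by rewrite ler_wpM2r//; lra.
  by rewrite mulrC -ler_pdivlMr// ltr_wpDl// mulr_ge0.
have cN : {for x, continuous (riemann_sum N)}.
  apply: cvgN; apply: (@cvg_big _ _ +%R) => //; first exact: add_continuous.
  move=> n _; apply: cvgMr_tmp; apply: cvgMl_tmp.
  apply: (@cvg_comp _ _ _ (fun y => n%:R * y + c) cos); last exact: continuous_cos.
  by apply: cvgD; [apply: cvgMl_tmp; exact: cvg_id|exact: cvg_cst].
have e30 : 0 < e / 3 by rewrite divr_gt0.
move/cvgrPdist_le : cN => /(_ _ e30).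
apply: filter_app; near=> y => h.
have := ler_normD (riemann_fun x - riemann_sum N x) (riemann_sum N x - riemann_fun y).
have := ler_normD (riemann_sum N x - riemann_sum N y) (riemann_sum N y - riemann_fun y).
have := tail x; have := tail y; rewrite [`|riemann_fun y - _|]distrC.
rewrite !addrA !subrK; lra.
Unshelve. all: by end_near. Qed.

(** The second symmetric difference of [F] at [x]. *)
Definition second_diff (F : R -> R) (t x : R) : R := F (x + t) + F (x - t) - 2 * F x.

Lemma second_diff_riemann_sum N t x : second_diff (riemann_sum N) t x =
  \sum_(1 <= n < N) 2 * a n * (1 - cos (n%:R * t)) / n%:R ^+ 2 * cos (n%:R * x + c).
Proof.
rewrite /second_diff /riemann_sum mulrN opprK -!opprD mulr_sumr -big_split/=.
rewrite addrC -sumrB; apply: eq_bigr => n _.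
have -> : n%:R * (x + t) + c = (n%:R * x + c) + n%:R * t by ring.
have -> : n%:R * (x - t) + c = (n%:R * x + c) - n%:R * t by ring.
rewrite (cosD (n%:R * x + c) (n%:R * t)) (cosB (n%:R * x + c) (n%:R * t)).
by ring.
Qed.

Lemma second_diff_riemann_fun_cvg t x :
  (fun N => second_diff (riemann_sum N) t x) @ \oo --> second_diff riemann_fun t x.
Proof.
rewrite /second_diff; apply: cvgB.
  by apply: cvgD; exact: (riemann_fun_spec _).1.
by apply: cvgMl_tmp; exact: (riemann_fun_spec _).1.
Qed.

Lemma second_diff_riemann_fun_tail N t x : (1 <= N)%N ->
  `|second_diff riemann_fun t x - second_diff (riemann_sum N) t x| <= 4 * (A * (2 / N%:R)).
Proof.
move=> N1; rewrite /second_diff.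
have := (riemann_fun_spec (x + t)).2 N N1.
have := (riemann_fun_spec (x - t)).2 N N1.
have := (riemann_fun_spec x).2 N N1.
rewrite !ler_norml => /andP[? ?] /andP[? ?] /andP[? ?]; apply/andP; split; lra.
Qed.

(** Riemann's first theorem: where the series converges, its sum is the second
    symmetric derivative of Riemann's function. Summation by parts turns the
    second difference into means of the partial sums against increments of the
    kernel. *)
Lemma riemann_first x (l : R) : trig_sum ^~ x @ \oo --> l ->
  forall eps : R, 0 < eps -> \forall t \near (0 : R)^'+,
    `|second_diff riemann_fun t x - l * t ^+ 2| <= eps * t ^+ 2.
Proof.
move=> Sl eps eps0.
pose s n := trig_sum n.+1 x - l.
have s0 : s @ \oo --> (0 : R).
  by rewrite -(subrr l); apply: cvgB; [rewrite (cvg_shiftS (trig_sum ^~ x))|exact: cvg_cst].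
pose w (t : R) (n : nat) := riemann_kernel (n%:R * t) - riemann_kernel (n.+1%:R * t).
have wC t N : 0 < t -> \sum_(1 <= n < N) `|w t n| <= 56.
  move=> t0.
  apply: (@le_trans _ _ (\sum_(1 <= n < N) 14 * (t * Num.min 1 (1 / (n%:R * t) ^+ 2)))).
    apply: ler_sum_nat => n /andP[n1 _]; rewrite mulrA /w.
    have -> : n.+1%:R * t = n%:R * t + t by rewrite -natr1 mulrDl mul1r.
    by apply: riemann_kernel_diff; rewrite t0/= ler_peMl ?(ltW t0)// ler1n.
  by rewrite -mulr_sumr; have := @sum_min_le R t N t0; lra.
have phi1 n : (1 <= n)%N -> riemann_kernel (n%:R * t) @[t --> (0 : R)^'+] --> (1 : R).
  move=> n1; apply/cvgrPdist_le => e e0; near=> t.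
  have t0 : 0 < t by near: t; exact: nbhs_right_gt.
  have nt0 : 0 < n%:R * t by rewrite mulr_gt0// ltr0n.
  rewrite ger0_norm ?subr_ge0 ?riemann_kernel_le1// lerBlDr addrC -lerBlDr.
  apply: le_trans (riemann_kernel_ge nt0); rewrite lerD2l lerN2.
  have nt1 : n%:R * t <= 1.
    rewrite mulrC -ler_pdivlMr ?ltr0n//; near: t; apply: nbhs_right_le.
    by rewrite divr_gt0// ltr0n.
  have nte : n%:R * t <= e.
    rewrite mulrC -ler_pdivlMr ?ltr0n//; near: t; apply: nbhs_right_le.
    by rewrite divr_gt0// ltr0n.
  by rewrite expr2 (le_trans _ nte)// ler_piMl// ltW.
have w0 n : (1 <= n)%N -> w t n @[t --> (0 : R)^'+] --> (0 : R).
  by move=> n1; have := @cvgB _ _ _ _ _ _ _ _ _ (phi1 n n1) (phi1 n.+1 isT); rewrite subrr; exact.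
have e3 : 0 < eps / 3 by rewrite divr_gt0.
have := toeplitz_null s0 wC w0 e3.
have l3 : 0 < eps / 3 / (`|l| + 1) by rewrite divr_gt0// ltr_wpDl.
have := phi1 1%N isT; move/cvgrPdist_le => /(_ _ l3).
apply: filter_app2; near=> t => ph tp.
have t0 : 0 < t by near: t; exact: nbhs_right_gt.
have t20 : 0 < t ^+ 2 by rewrite exprn_gt0.
have s00 : s 0%N = - l by rewrite /s /trig_sum big_geq// sub0r.
have cE n : (1 <= n)%N -> a n * cos (n%:R * x + c) = s n - s n.-1.
  by case: n => // n _; rewrite /s /= opprB addrA subrK /trig_sum [in RHS]big_nat_recr//= addrAC subrr add0r.
have parts N : second_diff (riemann_sum N.+2) t x = t ^+ 2 * (
    \sum_(1 <= n < N.+1) s n * w t n + l * riemann_kernel t +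
      s N.+1 * riemann_kernel (N.+1%:R * t)).
  have := abel_sum s (fun n => riemann_kernel (n%:R * t)) N.
  rewrite s00 mulNr opprK mul1r => <-.
  rewrite second_diff_riemann_sum mulr_sumr; apply: eq_big_nat => n /andP[n1 _].
  rewrite -cE// /riemann_kernel exprMn.
  by field; rewrite gt_eqF//= pnatr_eq0 -lt0n n1.
have lim : `|second_diff (riemann_sum N) t x - l * t ^+ 2| @[N --> \oo] -->
    `|second_diff riemann_fun t x - l * t ^+ 2|.
  apply: cvg_norm; apply: cvgB; last exact: cvg_cst.
  exact: second_diff_riemann_fun_cvg.
apply: (cvgr_to_le lim).
move/cvgrPdist_le : s0 => /(_ _ e3)[M _ sM]; exists M.+2 => // -[|[|N]] // /=.
rewrite !ltnS => MN; rewrite parts.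
have -> : forall u, t ^+ 2 * u - l * t ^+ 2 = t ^+ 2 * (u - l) by move=> u; ring.
rewrite normrM gtr0_norm// mulrC ler_wpM2r ?(ltW t20)//.
have b1 := tp N.+1.
have b2 : `|s N.+1 * riemann_kernel (N.+1%:R * t)| <= eps / 3.
  rewrite normrM -[leRHS]mulr1; apply: ler_pM => //.
    by have := sM N.+1; rewrite /= sub0r normrN; apply; exact: leqW.
  by rewrite ger0_norm ?riemann_kernel_ge0// riemann_kernel_le1// mulr_gt0.
have b3 : `|l * riemann_kernel t - l| <= eps / 3.
  rewrite -{2}(mulr1 l) -mulrBr normrM distrC; move: ph; rewrite mul1r => ph.
  apply: (@le_trans _ _ (`|l| * (eps / 3 / (`|l| + 1)))); first by rewrite ler_wpM2l.
  rewrite mulrC mulrAC ler_pdivrMr ?ltr_wpDl// ler_wpM2l ?(ltW e3)// lerDl//.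
move: b1 b2 b3; rewrite !ler_norml => /andP[? ?] /andP[? ?] /andP[? ?].
apply/andP; split; lra.
Unshelve. all: by end_near. Qed.

(** Riemann's second theorem, at the origin and for cosine sums: the only
    point where the series need not converge is a point of smoothness. *)
Lemma riemann_second : a @ \oo --> (0 : R) -> c = 0 ->
  forall eps : R, 0 < eps -> \forall t \near (0 : R)^'+,
    `|second_diff riemann_fun t 0| <= eps * t.
Proof.
move=> a0 c0 eps eps0.
pose w (t : R) (n : nat) := t * riemann_kernel (n%:R * t).
have wC t N : 0 < t -> \sum_(1 <= n < N) `|w t n| <= 16.
  move=> t0.
  apply: (@le_trans _ _ (\sum_(1 <= n < N) 4 * (t * Num.min 1 (1 / (n%:R * t) ^+ 2)))).
    apply: ler_sum_nat => n /andP[n1 _]; rewrite /w normrM gtr0_norm// mulrCA.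
    rewrite ler_wpM2l ?(ltW t0)// ger0_norm ?riemann_kernel_ge0//.
    have nt0 : 0 < n%:R * t by rewrite mulr_gt0// ltr0n.
    have h1 := riemann_kernel_le1 nt0; have h2 := riemann_kernel_le nt0.
    rewrite minr_pMr// le_min mulr1 mulrA mulr1; apply/andP; split; last by [].
    by lra.
  by rewrite -mulr_sumr; have := @sum_min_le R t N t0; lra.
have w0 n : (1 <= n)%N -> w t n @[t --> (0 : R)^'+] --> (0 : R).
  move=> n1; apply/cvgrPdist_le => e e0; near=> t.
  have t0 : 0 < t by near: t; exact: nbhs_right_gt.
  have nt0 : 0 < n%:R * t by rewrite mulr_gt0// ltr0n.
  rewrite sub0r normrN /w normrM gtr0_norm// ger0_norm ?riemann_kernel_ge0//.
  apply: (@le_trans _ _ (t * 1)).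
    by rewrite ler_wpM2l ?(ltW t0)// riemann_kernel_le1.
  by rewrite mulr1; near: t; exact: nbhs_right_le.
have := toeplitz_null a0 wC w0 eps0.
apply: filter_app; near=> t => tp.
have t0 : 0 < t by near: t; exact: nbhs_right_gt.
have lim : `|second_diff (riemann_sum N) t 0| @[N --> \oo] -->
    `|second_diff riemann_fun t 0|.
  by apply: cvg_norm; exact: second_diff_riemann_fun_cvg.
apply: (cvgr_to_le lim); apply: nearW => N.
have -> : second_diff (riemann_sum N) t 0 = t * \sum_(1 <= n < N) a n * w t n.
  rewrite second_diff_riemann_sum mulr_sumr; apply: eq_big_nat => n /andP[n1 _].
  rewrite c0 mulr0 addr0 cos0 /w /riemann_kernel.
  by field; rewrite gt_eqF//= pnatr_eq0 -lt0n n1.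
by rewrite normrM gtr0_norm// mulrC ler_wpM2r// ltW.
Unshelve. all: by end_near. Qed.

End second_primitive.

(** * Schwarz's uniqueness theorem *)

Section schwarz_uniqueness.
Context {R : realType}.
Notation mu := (@lebesgue_measure R).
Implicit Types (al be x t : R).

(** A function with positive second differences at small scales has no
    interior maximum. *)
Lemma maximum_principle (V : R -> R) al be : al < be ->
  {within `[al, be], continuous V} ->
  (forall x, al < x < be -> \forall t \near (0 : R)^'+, 0 < second_diff V t x) ->
  forall x, al <= x <= be -> V x <= Num.max (V al) (V be).
Proof.
move=> ab cV d2 x xab.
have [c cab cmax] := EVT_max (ltW ab) cV.
have xc : V x <= V c by apply: cmax; rewrite in_itv.
apply: (le_trans xc); rewrite le_max.
move: cab; rewrite in_itv/= => /andP[ac cb].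
have [->|ca] := eqVneq c al; first by rewrite lexx.
have [->|cnb] := eqVneq c be; first by rewrite lexx orbT.
have {}ac : al < c by rewrite lt_neqAle eq_sym ca.
have {}cb : c < be by rewrite lt_neqAle cnb.
have /d2 : al < c < be by rewrite ac.
move=> dc; exfalso.
have : \forall t \near (0 : R)^'+, False.
  move: dc; apply: filter_app; near=> t.
  have t0 : 0 < t by near: t; exact: nbhs_right_gt.
  have t1 : t <= c - al by near: t; apply: nbhs_right_le; rewrite subr_gt0.
  have t2 : t <= be - c by near: t; apply: nbhs_right_le; rewrite subr_gt0.
  have h1 : V (c + t) <= V c by apply: cmax; rewrite in_itv/=; lra.
  have h2 : V (c - t) <= V c by apply: cmax; rewrite in_itv/=; lra.
  by rewrite /second_diff; lra.
by move/filter_ex => [].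
Unshelve. all: by end_near. Qed.

(** The convex function whose second derivative is the indicator of [B]. *)
Definition ramp_integral (B : set R) x : R :=
  (\int[mu]_(s in B) Num.max (x - s) 0)%R.

Section ramp_integral_theory.
Variables (al be dl : R) (B : set R).
Hypotheses (mB : measurable (B : set (measurableTypeR R))) (Bab : B `<=` `[al, be]).
Hypotheses (dl0 : 0 <= dl) (muB : (mu B <= dl%:E)%E).

Local Notation G := (ramp_integral B).

Let mramp x : measurable_fun B (fun s : R => Num.max (x - s) 0).
Proof. by apply: measurable_maxr => //; apply: measurable_funB. Qed.

Let muBfin : (mu B < +oo)%E.
Proof. exact: le_lt_trans muB (ltry _). Qed.

Let iramp x : mu.-integrable B (EFin \o (fun s : R => Num.max (x - s) 0)).
Proof.
apply: measurable_bounded_integrable => //; first exact: mramp.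
exists (`|x| + `|al| + `|be|); split; first by rewrite num_real.
move=> M hM s Bs; have := Bab Bs; rewrite /= in_itv/= => /andP[as1 sb].
apply: (le_trans _ (ltW hM)).
have h0 : 0 <= Num.max (x - s) 0 by rewrite le_max lexx orbT.
rewrite (ger0_norm h0) ge_max; apply/andP; split; last by rewrite !addr_ge0.
have := ler_norm x; have := ler_norm (- al); have := normr_ge0 be; rewrite normrN; lra.
Qed.

Let icst (r : R) : mu.-integrable B (EFin \o cst r).
Proof.
apply: measurable_bounded_integrable => //.
by exists `|r|; split; [rewrite num_real|move=> M hM s _; exact: ltW].
Qed.

Let iadd (f g : R -> R) : mu.-integrable B (EFin \o f) -> mu.-integrable B (EFin \o g) ->
  mu.-integrable B (EFin \o (fun s => f s + g s)).
Proof. by move=> i1 i2; exact: (integrableD mB i1 i2). Qed.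

Let fmuB : fine (mu B) <= dl.
Proof. by rewrite -lee_fin fineK// ge0_fin_numE. Qed.

Lemma ramp_integral_ge0 x : 0 <= G x.
Proof. by apply: Rintegral_ge0 => s _; rewrite le_max lexx orbT. Qed.

Lemma ramp_integral_ndecr x y : x <= y -> G x <= G y.
Proof.
move=> xy; apply: le_Rintegral => // s _.
by rewrite ge_max !le_max lexx orbT andbT lerD2r xy.
Qed.

Lemma ramp_integral_lip x y : x <= y -> G y <= G x + (y - x) * dl.
Proof.
move=> xy.
apply: (@le_trans _ _ (\int[mu]_(s in B) (Num.max (x - s) 0 + cst (y - x) s))).
  apply: le_Rintegral => //; first exact: iadd.
  move=> s _ /=; rewrite ge_max; apply/andP; split.
    by rewrite -lerBlDr le_max; apply/orP; left; lra.
  by rewrite addr_ge0 ?subr_ge0// le_max lexx orbT.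
rewrite RintegralD// Rintegral_cst// lerD2l ler_wpM2l// subr_ge0//.
Qed.

Lemma ramp_integral_le x : al <= x <= be -> G x <= (be - al) * dl.
Proof.
move=> /andP[ax xb].
apply: (@le_trans _ _ (\int[mu]_(s in B) (cst (be - al) s))).
  apply: le_Rintegral => //.
  move=> s /Bab; rewrite /= in_itv/= => /andP[h1 h2].
  by rewrite ge_max; apply/andP; split; lra.
by rewrite Rintegral_cst// ler_wpM2l// subr_ge0 (le_trans ax).
Qed.

Lemma second_diff_ramp_integral_ge0 x t : 0 <= t -> 0 <= second_diff G t x.
Proof.
move=> t0; have twoG : 2 * G x = G x + G x by ring.
rewrite /second_diff subr_ge0 twoG -!RintegralD//.
apply: le_Rintegral => //; [exact: iadd|exact: iadd|].
move=> s _ /=; rewrite /Num.max.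
by case: ifPn; case: ifPn; case: ifPn; rewrite -?leNgt => *; lra.
Qed.

Lemma second_diff_ramp_integral_ge x t : 0 < t ->
  `[x - t / 2, x + t / 2] `<=` B -> t ^+ 2 / 2 <= second_diff G t x.
Proof.
move=> t0 IB; set I := `[x - t / 2, x + t / 2]%classic.
have mI : measurable (I : set (measurableTypeR R)) by exact: measurable_itv.
have iI : mu.-integrable B (EFin \o (fun s : R => t / 2 * \1_I s)).
  by rewrite /comp; under eq_fun do rewrite EFinM; apply: integrableZl => //;
    apply: (integrableS measurableT) => //; exact: integrable_indic_itv.
have -> : t ^+ 2 / 2 = \int[mu]_(s in B) (t / 2 * \1_I s).
  rewrite RintegralZl//; last first.
    by apply: (integrableS measurableT) => //; exact: integrable_indic_itv.
  rewrite /Rintegral integral_indic// setIidl//.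
  rewrite [X in fine X](_ : _ = t%:E) /=; first by field.
  rewrite -[LHS]/(lebesgue_measure I) lebesgue_measure_itv/= lte_fin ifT; last by lra.
  by rewrite -EFinB; congr (_%:E); field.
have twoG : 2 * G x = G x + G x by ring.
rewrite /second_diff lerBrDr twoG -!RintegralD//; last exact: iadd.
apply: le_Rintegral => //.
- by apply: iadd => //; exact: iadd.
- exact: iadd.
move=> s _ /=; rewrite indicE /Num.max.
have [|] := boolP (s \in I); rewrite /I ?inE ?notin_setE/= in_itv/=.
  move=> /andP[h1 h2].
  by case: ifPn; case: ifPn; case: ifPn; rewrite -?leNgt => *; lra.
move=> _.
by case: ifPn; case: ifPn; case: ifPn; rewrite -?leNgt => *; lra.
Qed.

End ramp_integral_theory.

(** Countably many negligible sets admit a small convex function whose second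
    symmetric derivative is at least [k] on the [k]-th of them. *)
Lemma convex_barrier al be (N : nat -> set R) (eps : R) : al < be -> 0 < eps ->
  (forall k, mu.-negligible (N k)) ->
  exists U : R -> R, [/\ (forall x, al <= x <= be -> 0 <= U x <= eps),
    continuous U, (forall x t, 0 <= t -> 0 <= second_diff U t x) &
    forall k x, N k x -> al < x < be ->
      \forall t \near (0 : R)^'+, k%:R * t ^+ 2 <= second_diff U t x].
Proof.
move=> ab eps0 N0.
pose L := be - al; have L0 : 0 < L by rewrite subr_gt0.
pose eta := eps / L; have eta0 : 0 < eta by rewrite divr_gt0.
(* The [k]-th set is covered by an open set so small that the ramp of its
   indicator with slope [wt k] contributes at most [eta / 2 ^ k.+1]. *)
pose wt (k : nat) : R := 2 * k%:R.
have wt0 k : 0 <= wt k by rewrite mulr_ge0.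
pose dl (k : nat) := eta / 2 ^+ k.+1 / (wt k + 1).
have dl0 k : 0 < dl k by rewrite !divr_gt0 ?exprn_gt0// ltr_wpDl.
have [Op OpP] : exists Op : nat -> set R,
    forall k, [/\ open (Op k), N k `<=` Op k & (mu (Op k) <= (dl k)%:E)%E].
  suff : forall k, exists V : set R, [/\ open V, N k `<=` V & (mu V <= (dl k)%:E)%E].
    by move=> /choice[Op OpP]; exists Op.
  move=> k; have [V [oV NV]] := @outer_measure_open_le R (N k) _ (dl0 k).
  have /negligible_outer_measure -> := N0 k.
  by rewrite add0e => muV; exists V.
pose B k := Op k `&` `[al, be]%classic.
have mB k : measurable (B k : set (measurableTypeR R)).
  by apply: measurableI; [apply: open_measurable; case: (OpP k)|exact: measurable_itv].
have Bab k : B k `<=` `[al, be]%classic by move=> x [].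
have muB k : (mu (B k) <= (dl k)%:E)%E.
  case: (OpP k) => oO _; apply: le_trans; apply: le_measure; rewrite ?inE//.
    exact: open_measurable.
  exact: subIsetl.
have wdl k : wt k * dl k <= eta / 2 ^+ k.+1.
  have X0 : 0 <= eta / 2 ^+ k.+1 by rewrite divr_ge0 ?exprn_ge0// ltW.
  by rewrite /dl mulrA ler_pdivrMr ?ltr_wpDl// mulrC ler_wpM2l// lerDl.
have geo n : \sum_(k < n) eta / 2 ^+ k.+1 <= eta.
  have -> : \sum_(k < n) eta / 2 ^+ k.+1 = eta - eta / 2 ^+ n.
    elim: n => [|n IH]; first by rewrite big_ord0 expr0 divr1 subrr.
    rewrite big_ord_recr/= IH exprS; field.
    by rewrite expf_neq0// pnatr_eq0.
  by rewrite gerBl divr_ge0 ?exprn_ge0// ltW.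
pose u k x := wt k * ramp_integral (B k) x.
have u0 k x : 0 <= u k x by rewrite mulr_ge0// ramp_integral_ge0.
have uinc k x y : x <= y -> u k x <= u k y.
  by move=> xy; rewrite ler_wpM2l// (ramp_integral_ndecr (mB k) (Bab k) (muB k)).
have ulip k x y : x <= y -> u k y <= u k x + (y - x) * (eta / 2 ^+ k.+1).
  move=> xy; apply: (@le_trans _ _ (wt k * (ramp_integral (B k) x + (y - x) * dl k))).
    by rewrite ler_wpM2l// (ramp_integral_lip (mB k) (Bab k) (muB k)).
  rewrite mulrDr lerD2l mulrCA ler_wpM2l ?subr_ge0//.
have uL k x : al <= x <= be -> u k x <= L * (eta / 2 ^+ k.+1).
  move=> xab; apply: (@le_trans _ _ (wt k * (L * dl k))).
    by rewrite ler_wpM2l// (ramp_integral_le (mB k) (Bab k) (muB k)).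
  by rewrite mulrCA ler_wpM2l// ltW.
pose Un n x := \sum_(k < n) u k x.
have UnL n x : al <= x <= be -> Un n x <= eps.
  move=> xab; apply: (@le_trans _ _ (L * eta)); last by rewrite /eta mulrC divfK ?gt_eqF.
  apply: (@le_trans _ _ (\sum_(k < n) L * (eta / 2 ^+ k.+1))).
    by apply: ler_sum => k _; exact: uL.
  by rewrite -mulr_sumr ler_wpM2l// ltW.
have Uninc n x y : x <= y -> Un n x <= Un n y.
  by move=> xy; apply: ler_sum => k _; exact: uinc.
have Unlip n x y : x <= y -> Un n y <= Un n x + (y - x) * eta.
  move=> xy; apply: (@le_trans _ _ (\sum_(k < n) (u k x + (y - x) * (eta / 2 ^+ k.+1)))).
    by apply: ler_sum => k _; exact: ulip.
  by rewrite big_split/= lerD2l -mulr_sumr ler_wpM2l ?subr_ge0//; exact: geo.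
have aab : al <= al <= be by rewrite lexx ltW.
pose U x := limn (Un ^~ x).
have UnU x : Un ^~ x @ \oo --> U x.
  apply: nondecreasing_is_cvgn.
    by apply/nondecreasing_seqP => n; rewrite /Un big_ord_recr/= lerDl.
  exists (eps + (Num.max x al - al) * eta) => _ [n _ <-].
  apply: (@le_trans _ _ (Un n (Num.max x al))); first by apply: Uninc; rewrite le_max lexx.
  apply: (le_trans (@Unlip n al (Num.max x al) _)); first by rewrite le_max lexx orbT.
  by rewrite lerD2r UnL.
have sdn n t x : second_diff (Un n) t x = \sum_(k < n) wt k * second_diff (ramp_integral (B k)) t x.
  rewrite /second_diff /Un mulr_sumr -big_split/= -sumrB.
  by apply: eq_bigr => k _; rewrite /u; ring.
have sdU t x : second_diff (Un n) t x @[n --> \oo] --> second_diff U t x.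
  by rewrite /second_diff; apply: cvgB; [exact: cvgD|exact: cvgMl_tmp].
have sd0 k t x : 0 <= t -> 0 <= second_diff (ramp_integral (B k)) t x.
  exact: (second_diff_ramp_integral_ge0 (mB k) (Bab k) (muB k)).
exists U; split.
- move=> x xab; apply/andP; split.
    by apply: (cvgr_to_ge (UnU x)); apply: nearW => n; apply: sumr_ge0.
  by apply: (cvgr_to_le (UnU x)); apply: nearW => n; exact: UnL.
- have Ulip x y : x <= y -> `|U x - U y| <= (y - x) * eta.
    move=> xy.
    have lim : Un n x - Un n y @[n --> \oo] --> U x - U y by exact: cvgB.
    apply: (cvgr_to_le (cvg_norm lim)); apply: nearW => n.
    have := Uninc n _ _ xy; have := Unlip n _ _ xy.
    by move=> h1 h2; rewrite distrC ger0_norm ?subr_ge0// lerBlDl.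
  move=> x; apply/cvgrPdist_le => e e0.
  have ee : 0 < e / eta by rewrite divr_gt0.
  apply/nbhs_ballP; exists (e / eta) => //= y; rewrite /ball/= => xy.
  have [h|/ltW h] := leP x y.
    rewrite (le_trans (Ulip _ _ h))// -ler_pdivlMr//.
    by rewrite (le_trans _ (ltW xy))// distrC ler_norm.
  rewrite distrC (le_trans (Ulip _ _ h))// -ler_pdivlMr//.
  by rewrite (le_trans _ (ltW xy))// ler_norm.
- move=> x t t0; apply: (cvgr_to_ge (sdU t x)); apply: nearW => n.
  by rewrite sdn; apply: sumr_ge0 => k _; rewrite mulr_ge0// sd0.
- move=> k x Nkx /andP[ax xb].
  have [oO NO _] := OpP k.
  have : nbhs x (B k).
    apply: filterI; first by apply: open_nbhs_nbhs; split => //; exact: NO.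
    apply: (@filterS _ _ _ `]al, be[%classic); first exact: subset_itv_oo_cc.
    by apply: open_nbhs_nbhs; split; [exact: interval_open|rewrite /= in_itv/= ax].
  move=> /nbhs_ballP[r /= r0 rB].
  near=> t; have t0 : 0 < t by near: t; exact: nbhs_right_gt.
  have tr : t < r by near: t; exact: nbhs_right_lt.
  apply: (cvgr_to_ge (sdU t x)); exists k.+1 => // n /= kn.
  rewrite sdn (bigD1 (Ordinal kn))//= -[leLHS]addr0 lerD//; last first.
    by apply: sumr_ge0 => j _; rewrite mulr_ge0// sd0// ltW.
  have := second_diff_ramp_integral_ge (mB k) (Bab k) (muB k) t0.
  have IB : `[x - t / 2, x + t / 2]%classic `<=` B k.
    move=> y; rewrite /= in_itv/= => /andP[h1 h2]; apply: rB.
    by rewrite /ball/= ltr_norml; apply/andP; split; lra.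
  move=> /(_ x IB) h; apply: (@le_trans _ _ (wt k * (t ^+ 2 / 2))); last by rewrite ler_wpM2l.
  by rewrite /wt le_eqVlt; apply/orP; left; apply/eqP; field.
Unshelve. all: by end_near. Qed.

(** A continuous function whose second symmetric derivative vanishes almost
    everywhere and is bounded at every point at small scales is affine. The
    barrier absorbs the exceptional set, which is sorted by the size of the
    bound, and the maximum principle applies to [H] and to [- H]. *)
Lemma schwarz_affine (H : R -> R) al be : al < be ->
  {within `[al, be], continuous H} ->
  (forall x, al < x < be -> exists M, \forall t \near (0 : R)^'+,
    `|second_diff H t x| <= M * t ^+ 2) ->
  {ae mu, forall x, al < x < be -> forall eps : R, 0 < eps ->
    \forall t \near (0 : R)^'+, `|second_diff H t x| <= eps * t ^+ 2} ->
  forall x, al <= x <= be ->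
    H x = H al + (H be - H al) / (be - al) * (x - al).
Proof.
move=> ab cH HM Hae.
pose good x := forall eps : R, 0 < eps ->
    \forall t \near (0 : R)^'+, `|second_diff H t x| <= eps * t ^+ 2.
pose N (k : nat) := [set x | [/\ al < x < be, ~ good x &
  \forall t \near (0 : R)^'+, `|second_diff H t x| <= k%:R * t ^+ 2]].
have N0 k : mu.-negligible (N k).
  case: Hae => Z [mZ Z0 ZH]; exists Z; split => // x [xab ng _].
  by apply: ZH => /= /(_ xab).
pose ell x := H al + (H be - H al) / (be - al) * (x - al).
have L0 : 0 < be - al by rewrite subr_gt0.
have ellb : ell be = H be by rewrite /ell divfK ?gt_eqF//; ring.
have ella : ell al = H al by rewrite /ell; ring.
have cell : continuous ell.
  move=> x; apply: cvgD; first exact: cvg_cst.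
  by apply: cvgMl_tmp; apply: cvgB; [exact: cvg_id|exact: cvg_cst].
(* [sg] is the sign with which [H - ell] enters. *)
have main (sg : R) : `|sg| = 1 -> forall x, al <= x <= be -> sg * (H x - ell x) <= 0.
  move=> sg1 x xab; apply/ler_addgt0Pr => e e0; rewrite add0r.
  pose eps := e / 2 / ((be - al) ^+ 2 + 1).
  have q0 : 0 < (be - al) ^+ 2 + 1 by rewrite ltr_wpDl ?sqr_ge0.
  have eps0 : 0 < eps by rewrite !divr_gt0.
  have e20 : 0 < e / 2 by rewrite divr_gt0.
  have [U [Ub cU U0 UN]] := convex_barrier ab e20 N0.
  pose V x := sg * (H x - ell x) + U x + eps * (x - al) ^+ 2.
  have cV : {within `[al, be], continuous V}.
    have cc (F : R -> R) : continuous F -> {within `[al, be], continuous F}.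
      by move=> cF; exact: continuous_subspaceT.
    have h1 : {within `[al, be], continuous (fun x => sg * (H x - ell x))}.
      move=> z; apply: cvgMl_tmp; apply: cvgB; first exact: cH.
      exact: (cc _ cell).
    have h2 : {within `[al, be], continuous (fun x => eps * (x - al) ^+ 2)}.
      apply: cc => z; apply: cvgMl_tmp; rewrite expr2; under eq_fun do rewrite expr2.
      by apply: cvgM; apply: cvgB; [exact: cvg_id|exact: cvg_cst|exact: cvg_id|exact: cvg_cst].
    by move=> z; apply: cvgD; [apply: cvgD; [exact: h1|exact: (cc _ cU)]|exact: h2].
  have sdV t z : second_diff V t z = sg * second_diff H t z + second_diff U t z + eps * (2 * t ^+ 2).
    by rewrite /second_diff /V /ell; ring.
  have pos z : al < z < be -> \forall t \near (0 : R)^'+, 0 < second_diff V t z.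
    move=> zab; have [gz|ngz] := pselect (good z).
      move/(_ _ eps0) : (gz); apply: filter_app; near=> t => h.
      have t0 : 0 < t by near: t; exact: nbhs_right_gt.
      rewrite sdV; have := U0 z t (ltW t0).
      have t20 : 0 < eps * t ^+ 2 by rewrite mulr_gt0// exprn_gt0.
      have : `|sg * second_diff H t z| <= eps * t ^+ 2 by rewrite normrM sg1 mul1r.
      by rewrite ler_norml => /andP[? ?]; lra.
    have [M HMz] := HM z zab.
    pose k := (Num.truncn `|M|).+1.
    have Mk : M <= k%:R by rewrite (le_trans (ler_norm _))// ltW// truncnS_gt.
    have Nz : N k z.
      split => //; move: HMz; apply: filter_app; near=> t => h.
      by rewrite (le_trans h)// ler_wpM2r// sqr_ge0.
    have [_ _ Hk] := Nz.
    move: Hk (UN k z Nz zab); apply: filter_app2; near=> t => h1 h2.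
    have t0 : 0 < t by near: t; exact: nbhs_right_gt.
    have t20 : 0 < eps * t ^+ 2 by rewrite mulr_gt0// exprn_gt0.
    rewrite sdV.
    have : `|sg * second_diff H t z| <= k%:R * t ^+ 2 by rewrite normrM sg1 mul1r.
    by rewrite ler_norml => /andP[? ?]; lra.
  have := maximum_principle ab cV pos xab.
  have /andP[Ux0 _] := Ub x xab.
  have /andP[_ Ua] : 0 <= U al <= e / 2 by apply: Ub; rewrite lexx ltW.
  have /andP[_ Ube] : 0 <= U be <= e / 2 by apply: Ub; rewrite lexx ltW.
  have Va : V al <= e.
    by rewrite /V ella !subrr mulr0 expr0n/= mulr0; lra.
  have eq2 : eps * (be - al) ^+ 2 <= e / 2.
    by rewrite /eps mulrAC ler_pdivrMr// ler_wpM2l ?(ltW e20)// lerDl.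
  have Vb : V be <= e by rewrite /V ellb subrr mulr0; lra.
  have ex : 0 <= eps * (x - al) ^+ 2 by rewrite mulr_ge0 ?sqr_ge0// ltW.
  have : Num.max (V al) (V be) <= e by rewrite ge_max Va.
  by move=> h1 h2; have := le_trans h2 h1; rewrite /V; lra.
move=> x xab; have := main 1 (normr1 _) x xab; have := main (-1) _ x xab.
rewrite normrN1 => /(_ erefl); rewrite -/(ell x); lra.
Unshelve. all: by end_near. Qed.

End schwarz_uniqueness.

(** * Primitives of a function Lipschitz in the mean *)

Lemma lebesgue_measure_cc {R : realType} (a b : R) : a <= b ->
  lebesgue_measure (`[a, b]%classic : set (measurableTypeR R)) = (b - a)%:E.
Proof.
rewrite le_eqVlt lebesgue_measure_itv/= lte_fin => /predU1P[->|ab].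
  by rewrite ltxx subrr.
by rewrite ab -EFinB.
Qed.

Section primitive_derivative.
Context {R : realType}.
Notation mu := (@lebesgue_measure R).

(** Lebesgue's differentiation theorem on a bounded interval. *)
Lemma integral_ae_derive (f : R -> R) (a b : R) : a < b ->
  mu.-integrable `[a, b] (EFin \o f) ->
  {ae mu, forall x : R, a < x < b ->
    is_derive x (1 : R) (fun y => parameterized_integral mu a y f) (f x)}.
Proof.
move=> ab intf; pose g := f \_ `[a, b].
have lg : locally_integrable setT g by exact: integrable_locally.
have intg u : mu.-integrable `[a, u] (EFin \o g).
  have ig : mu.-integrable setT (EFin \o g).
    rewrite /g -restrict_EFin.
    by apply: (proj1 (@integrable_mkcond _ _ R mu `[a, b]%classic (EFin \o f) (measurable_itv _))).
  by apply: integrableS ig.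
have := @FTC1 R g (BLeft a) intg lg.
apply: filterS; first exact: (ae_filter_ringOfSetsType mu).
move=> x /= + /andP[ax xb].
rewrite lte_fin => /(_ ax)[D E].
have gf : g x = f x by rewrite /g patchE mem_set//= in_itv/= !ltW.
rewrite gf derive1E in E.
apply: near_eq_is_derive (DeriveDef D E).
have : nbhs x `]a, b[%classic.
  by apply: open_nbhs_nbhs; split; [exact: interval_open|rewrite /= in_itv/= ax].
apply: filterS => y; rewrite /= in_itv/= => /andP[ay yb].
rewrite /parameterized_integral; apply: eq_Rintegral => z.
rewrite inE/= in_itv/= => /andP[az zy].
by rewrite /g patchE mem_set//= in_itv/= az (le_trans zy)// ltW.
Qed.

Lemma parameterized_integralB (f : R -> R) (a b x y : R) : mu.-integrable `[a, b] (EFin \o f) ->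
  a <= x -> x <= y -> y <= b ->
  parameterized_integral mu a y f - parameterized_integral mu a x f =
  \int[mu]_(z in `[x, y]) f z.
Proof.
move=> intf ax xy yb; rewrite /parameterized_integral Rintegral_itvB//.
  rewrite Rintegral_itv_obnd_cbnd//; apply: integrableS intf => //.
  by apply: subset_itv; rewrite bnd_simp.
by apply: integrableS intf => //; apply: subset_itv; rewrite bnd_simp.
Qed.

Lemma integral_increment_le (f G : R -> R) (x y : R) : x <= y -> mu.-integrable `[x, y] (EFin \o f) ->
  G y - G x = \int[mu]_(z in `[x, y]) f z ->
  (`|G y - G x|%:E <= \int[mu]_(z in `[x, y]) `|f z|%:E)%E.
Proof.
move=> xy intf ->.
rewrite -[leLHS]/(`| (fine (\int[mu]_(s in `[x, y]) (f s)%:E))%:E|)%E.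
rewrite fineK; last exact: integrable_fin_num.
apply: le_abse_integral => //.
by case/integrableP : intf.
Qed.

End primitive_derivative.

Section primitives.
Context {R : realType}.
Notation mu := (@lebesgue_measure R).
Variable f : R -> R.
Hypothesis mf : measurable_fun setT f.
Hypothesis intf : mu.-integrable `[(- 2 : R), 2] (EFin \o f).

(** The first primitive, based at the left endpoint of the interval on which
    [f] is known to be integrable. *)
Definition primitive (x : R) : R := parameterized_integral mu (- 2) x f.

Local Notation P := primitive.

Let intfS (u v : R) : -2 <= u -> v <= 2 -> mu.-integrable `[u, v] (EFin \o f).
Proof.
move=> u2 v2; apply: integrableS intf => //.
by apply: subset_itv; rewrite bnd_simp.
Qed.

Lemma primitiveB (u v : R) : -2 <= u -> u <= v -> v <= 2 ->
  P v - P u = \int[mu]_(s in `[u, v]) f s.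
Proof. exact: (parameterized_integralB intf). Qed.

Let intshift (t u v : R) : 0 <= t -> -2 <= u -> v + t <= 2 ->
  mu.-integrable `[u, v] (EFin \o (fun s => f (s + t))).
Proof.
move=> t0 u2 vt.
have mft : measurable_fun setT (fun s : R => f (s + t)).
  by apply: (measurableT_comp mf); exact: measurable_shift.
apply/integrableP; split; first by apply/measurable_EFinP; exact: measurable_funTS.
have ut : -2 <= u + t by lra.
have /integrableP[mg] := intfS ut vt.
by rewrite (@ge0_integral_itv_shift R t u v (fun s => `|(f s)%:E|)%E)//;
  apply/measurable_funTS/measurableT_comp => //; exact/measurable_EFinP.
Qed.

Lemma primitive_shiftB (t u v : R) : 0 <= t -> -2 <= u -> u <= v -> v + t <= 2 ->
  P (v + t) - P (u + t) - (P v - P u) = \int[mu]_(s in `[u, v]) (f (s + t) - f s).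
Proof.
move=> t0 u2 uv vt.
have v2 : v <= 2 by lra.
have ut : -2 <= u + t by lra.
have uvt : u + t <= v + t by rewrite lerD2r.
rewrite (primitiveB ut uvt vt) (primitiveB u2 uv v2).
rewrite RintegralB//; [|exact: intshift|exact: intfS].
congr (_ - _); rewrite /Rintegral; congr fine.
apply: (@integral_itv_shift R t u v (EFin \o f)); last exact: intfS.
exact/measurable_EFinP.
Qed.

Lemma primitive_shiftB_le (t u v : R) : 0 <= t -> -2 <= u -> u <= v -> v + t <= 2 ->
  (`|P (v + t) - P v - (P (u + t) - P u)|%:E <=
   \int[mu]_(s in `[u, v]) `|f (s + t) - f s|%:E)%E.
Proof.
move=> t0 u2 uv vt; have v2 : v <= 2 by lra.
have mI : measurable (`[u, v]%classic : set (measurableTypeR R)) by exact: measurable_itv.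
apply: (@integral_increment_le R (fun s => f (s + t) - f s) (fun x => P (x + t) - P x)) => //.
  exact: (integrableB mI (intshift t0 u2 vt) (intfS u2 v2)).
by rewrite -primitive_shiftB//; ring.
Qed.

Lemma primitive_continuous : {within `[- 2, 2], continuous P}.
Proof. by apply: parameterized_integral_continuous => //; lra. Qed.

Lemma primitive_ae_derive :
  {ae mu, forall x : R, -2 < x < 2 -> is_derive x (1 : R) P (f x)}.
Proof. by apply: integral_ae_derive => //; lra. Qed.

End primitives.

Section lipschitz_in_mean.
Context {R : realType}.
Notation mu := (@lebesgue_measure R).
Variables (f : R -> R) (p C h0 : R).
Hypothesis mf : measurable_fun setT f.
Hypothesis intf : mu.-integrable `[(- 2 : R), 2] (EFin \o f).
Hypotheses (p1 : 1 < p) (C0 : 0 <= C) (h00 : 0 < h0) (h01 : h0 <= 1).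
Hypothesis lipf : forall t : R, 0 < t -> t <= h0 ->
  (\int[mu]_(s in `[(-2)%R, 2%R]) (`|f (s + t) - f s| `^ p)%:E <= ((C * t) `^ p)%:E)%E.

Local Notation P := (primitive f).

Let p0 : 0 < p. Proof. exact: lt_trans p1. Qed.

Let mdiff t : measurable_fun setT (fun s : R => `|f (s + t) - f s|).
Proof.
apply: measurableT_comp => //; apply: measurable_funB => //.
by apply: (measurableT_comp mf); exact: measurable_shift.
Qed.

(** Hölder's inequality localizes the hypothesis to short windows. *)
Lemma integral_window_le (x l t : R) : 0 < t -> t <= h0 -> 0 < l ->
  -2 <= x -> x + l <= 2 ->
  (\int[mu]_(s in `[x, (x + l)%R]) `|f (s + t) - f s|%:E <= (C * t * l `^ (1 - p^-1))%:E)%E.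
Proof.
move=> t0 th l0 x2 xl.
have mI : measurable (`[x, x + l]%classic : set (measurableTypeR R)) by exact: measurable_itv.
have -> : C * t * l `^ (1 - p^-1) = l * (C * t * l `^ (- p^-1)).
  rewrite powRD; last by rewrite (gt_eqF l0) implybT.
  by rewrite powRr1 ?(ltW l0)//; ring.
apply: (@integral_power_mean _ _ R mu _ (fun s : R => `|f (s + t) - f s|) p l) => //.
- by apply: measurable_funTS; exact: mdiff.
- exact: ltW.
- have xxl : x <= x + l by rewrite lerDl ltW.
  have := lebesgue_measure_cc xxl; rewrite addrAC subrr add0r => h.
  exact: (eq_ind_r (fun z => z <= l%:E)%E (lexx _) h).
- by rewrite !mulr_ge0 ?powR_ge0// ltW.
- have -> : l * (C * t * l `^ (- p^-1)) `^ p = (C * t) `^ p.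
    rewrite powRM ?powR_ge0 ?mulr_ge0 ?(ltW t0)// -powRrM mulNr mulVf ?gt_eqF//.
    by rewrite powR_inv1 ?(ltW l0)// mulrCA divff ?gt_eqF// mulr1.
  apply: le_trans (lipf t0 th); apply: ge0_subset_integral => //=.
  + apply/measurable_funTS/measurable_EFinP.
    by apply: (measurableT_comp (measurable_powR p)); exact: mdiff.
  + by apply: subset_itv; rewrite bnd_simp.
Qed.

(** The first primitive is Lipschitz near the origin, although the function
    itself may be unbounded there. *)
Lemma primitive_lip : exists2 M, 0 <= M & forall x h : R, -1 <= x -> x <= 1 ->
  0 < h -> h <= h0 -> `|P (x + h) - P x| <= M * h.
Proof.
have h1 : h0 <= 1 by [].
pose q := 1 - p^-1; pose rho := hardy_ratio p.
have q0 : 0 < q by exact: hardy_exponent_gt0.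
have rho0 : 0 <= rho by exact: hardy_ratio_ge0.
have rho1 : rho < 1 by exact: hardy_ratio_lt1.
pose I := fine (\int[mu]_(s in `[(-2)%R, 2%R]) `|f s|%:E)%E.
have I0 : 0 <= I by rewrite fine_ge0// integral_ge0// => s _; rewrite lee_fin.
have base (x h : R) : -1 <= x -> x <= 1 -> 0 < h -> h <= h0 -> `|P (x + h) - P x| <= I.
  move=> x1 x1' h0' hh; rewrite primitiveB//; [|lra|lra|lra].
  have ii : mu.-integrable `[x, x + h] (EFin \o f).
    by apply: integrableS intf => //; apply: subset_itv; rewrite bnd_simp; lra.
  rewrite (le_trans (le_normr_Rintegral _ ii))// /I /Rintegral.
  have /integrableP[_ il] := intf.
  rewrite fine_le//.
  - exact: (integrable_fin_num _ (integrable_norm ii)).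
  - by rewrite ge0_fin_numE// integral_ge0// => s _; rewrite lee_fin.
  - apply: ge0_subset_integral => //=.
    + by apply/measurable_EFinP; apply: measurable_funTS; exact: measurableT_comp.
    + by apply: subset_itv; rewrite bnd_simp; lra.
pose M0 := 2 * I / h0.
have M00 : 0 <= M0 by rewrite divr_ge0 ?mulr_ge0// ltW.
pose D k := M0 + C * \sum_(i < k.+1) rho ^+ i.
have Dinc k : D k <= D k.+1.
  by rewrite /D lerD2l ler_wpM2l// [leRHS]big_ord_recr/= lerDl exprn_ge0.
have DM k : D k <= M0 + C / (1 - rho).
  by rewrite /D lerD2l ler_wpM2l// geometric_sum_le// rho0.
(* Doubling the step [h] changes the difference quotient by at most a term of
   a geometric series. *)
have main k : forall x h : R, -1 <= x -> x <= 1 -> h0 / 2 ^+ k.+1 < h -> h <= h0 ->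
    `|P (x + h) - P x| <= D k * h.
  elim: k => [|k IH] x h x1 x1' hk hh.
    have hp : 0 < h by rewrite (lt_trans _ hk)// divr_gt0.
    apply: (le_trans (base x h x1 x1' hp hh)).
    apply: (@le_trans _ _ (M0 * h)); last first.
      rewrite ler_wpM2r ?(ltW hp)// /D lerDl mulr_ge0// sumr_ge0// => i _.
      by rewrite exprn_ge0.
    rewrite /M0 mulrAC ler_pdivlMr//.
    have : 0 <= I * (2 * h - h0).
      by rewrite mulr_ge0//; move: hk; rewrite expr1 ltr_pdivrMr//; lra.
    lra.
  have hp : 0 < h by rewrite (lt_trans _ hk)// divr_gt0// exprn_gt0.
  have [hbig|hsmall] := ltP (h0 / 2 ^+ k.+1) h.
    by rewrite (le_trans (IH x h x1 x1' hbig hh))// ler_wpM2r// ltW.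
  have h2k : h0 / 2 ^+ k.+1 < 2 * h.
    move: hk; rewrite (exprS _ k.+1) invfM mulrCA mulrA => hk.
    by rewrite -ltr_pdivrMl// mulrC (lt_le_trans _ (lexx _))//; lra.
  have h2h : 2 * h <= h0.
    rewrite -ler_pdivlMl// mulrC (le_trans hsmall)//.
    rewrite ler_wpM2l ?(ltW h00)// lef_pV2 ?posrE ?exprn_gt0//.
    by rewrite exprS ler_peMr// exprn_ege1//; lra.
  have := IH x (2 * h) x1 x1' h2k h2h.
  have := @primitive_shiftB_le R f mf intf h x (x + h).
  move=> /(_ (ltW hp))/(_ _)/(_ _)/(_ _) Hs.
  have {Hs} : `|P (x + h + h) - P (x + h) - (P (x + h) - P x)| <= C * h * h `^ q.
    rewrite -lee_fin; apply: le_trans (integral_window_le hp hh hp _ _); [apply: Hs| |]; lra.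
  have -> : x + h + h = x + 2 * h by ring.
  have hq : h `^ q <= rho ^+ k.+1.
    rewrite -powR_mulrn// /rho /hardy_ratio powRAC.
    rewrite ge0_ler_powR ?nnegrE ?powR_ge0 ?(ltW q0) ?(ltW hp)//.
    rewrite powR_mulrn; last by rewrite divr_ge0.
    rewrite (le_trans hsmall)// expr_div_n expr1n.
    by rewrite ler_wpM2r// invr_ge0 exprn_ge0.
  have : C * h * h `^ q <= C * rho ^+ k.+1 * h.
    by rewrite mulrAC ler_wpM2r ?(ltW hp)// ler_wpM2l.
  rewrite /D [in X in _ -> _ -> _ -> X]big_ord_recr/= mulrDr.
  set S := C * \sum_(i < _) _; set T := C * rho ^+ k.+1 => e1.
  have T0 : 0 <= T * h by rewrite !mulr_ge0 ?exprn_ge0// ltW.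
  rewrite !ler_norml => /andP[a1 a2] /andP[a3 a4].
  move: (P x) (P (x + h)) (P (x + 2 * h)) a1 a2 a3 a4 e1 => u1 u2 u3 a1 a2 a3 a4 e1.
  by clear -a1 a2 a3 a4 e1 T0; apply/andP; split; lra.
exists (M0 + C / (1 - rho)); first by rewrite addr_ge0// divr_ge0// subr_ge0 ltW.
move=> x h x1 x1' hp hh.
pose k := Num.truncn (h0 / h).
have hk : h0 / 2 ^+ k.+1 < h.
  rewrite ltr_pdivrMr ?exprn_gt0// mulrC -ltr_pdivrMr//.
  rewrite (lt_le_trans (truncnS_gt _))// -natrX ler_nat -/k.
  exact: ltnW (ltn_expl _ _).
by rewrite (le_trans (main k x h x1 x1' hk hh))// ler_wpM2r// ltW.
Qed.

End lipschitz_in_mean.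

Section second_primitive_of_function.
Context {R : realType}.
Notation mu := (@lebesgue_measure R).

Lemma is_derive_reflect (Q : R -> R) (x s l : R) :
  is_derive (x + s) (1 : R) Q l -> is_derive s (1 : R) (fun r => Q (x + r)) l.
Proof.
move=> D.
have D1 : is_derive s (1 : R) (fun r : R => x + r) 1.
  by have := @is_deriveD R R R (cst x) id s 1 0 1 _ _; rewrite add0r; exact.
have := @is_derive1_comp R Q (fun r => x + r) s _ _ D D1.
by rewrite mulr1; exact.
Qed.

Lemma is_derive_reflectN (Q : R -> R) (x s l : R) :
  is_derive (x - s) (1 : R) Q l -> is_derive s (1 : R) (fun r => Q (x - r)) (- l).
Proof.
move=> D.
have D1 : is_derive s (1 : R) (fun r : R => x - r) (-1).
  by have := @is_deriveB R R R (cst x) id s 1 0 1 _ _; rewrite sub0r; exact.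
have := @is_derive1_comp R Q (fun r => x - r) s _ _ D D1.
by rewrite mulrN1; exact.
Qed.

(** The mean value theorem applied to the symmetric difference. *)
Lemma second_diff_mvt (Q P : R -> R) (x t l : R) : 0 < t ->
  (forall y, x - t <= y -> y <= x + t -> is_derive y (1 : R) Q (P y)) ->
  exists2 xi, 0 < xi < t &
    second_diff Q t x - l * t ^+ 2 = t * (P (x + xi) - P (x - xi) - 2 * l * xi).
Proof.
move=> t0 dQ.
pose q r := Q (x + r) + Q (x - r) - l * r ^+ 2.
have dq s : 0 <= s -> s <= t -> is_derive s (1 : R) q (P (x + s) - P (x - s) - 2 * l * s).
  move=> s0 st.
  have D1 : is_derive s (1 : R) (fun r => Q (x + r)) (P (x + s)).
    by apply: is_derive_reflect; apply: dQ; lra.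
  have D2 : is_derive s (1 : R) (fun r => Q (x - r)) (- P (x - s)).
    by apply: is_derive_reflectN; apply: dQ; lra.
  by apply: is_derive_eq; rewrite /GRing.scale/=; ring.
have [s||xi] := @MVT R q (fun s => P (x + s) - P (x - s) - 2 * l * s) 0 t t0.
- by rewrite in_itv/= => /andP[s0 st]; apply: dq; exact: ltW.
- apply: derivable_within_continuous => s; rewrite in_itv/= => /andP[s0 st].
  by case: (dq s s0 st).
rewrite in_itv/= => xit E; exists xi => //.
rewrite [RHS]mulrC; move: E; rewrite subr0 => <-.
rewrite /second_diff /q addr0 subr0 expr0n/=; ring.
Qed.

Variables (f : R -> R).
Hypothesis mf : measurable_fun setT f.
Hypothesis intf : mu.-integrable `[(- 2 : R), 2] (EFin \o f).
Local Notation P := (primitive f).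

(** The second primitive. *)
Definition second_primitive (x : R) : R := parameterized_integral mu (- 2) x P.

Local Notation Q := second_primitive.

Lemma second_primitive_derive (x : R) : -2 < x -> x < 2 -> is_derive x (1 : R) Q (P x).
Proof.
move=> x2 x2'.
have iP : mu.-integrable `[(- 2 : R), 2] (EFin \o P).
  apply: continuous_compact_integrable; first exact: segment_compact.
  exact: primitive_continuous.
have cP : {for x, continuous P}.
  have := primitive_continuous intf.
  rewrite continuous_within_itvP; last by lra.
  by case=> + _ _; apply; rewrite in_itv/= x2.
have [D E] := @continuous_FTC1 R P (BLeft (-2)) x 2 x2' iP x2 cP.
by rewrite derive1E in E; exact: DeriveDef D E.
Qed.

(** Where the first primitive is Lipschitz, the second one has bounded second
    differences. *)
Lemma second_primitive_bound (M h0 x : R) : 0 < h0 ->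
  (forall y h : R, -1 <= y -> y <= 1 -> 0 < h -> h <= h0 -> `|P (y + h) - P y| <= M * h) ->
  -1 < x -> x < 1 ->
  \forall t \near (0 : R)^'+, `|second_diff Q t x| <= 2 * `|M| * t ^+ 2.
Proof.
move=> h00 lip x1 x1'.
near=> t; have t0 : 0 < t by near: t; exact: nbhs_right_gt.
have t1 : t <= x + 1 by near: t; apply: nbhs_right_le; lra.
have t2 : t <= 1 - x by near: t; apply: nbhs_right_le; lra.
have t3 : t <= h0 / 2 by near: t; apply: nbhs_right_le; rewrite divr_gt0.
have [y y1 y2|xi /andP[xi0 xit] E] := @second_diff_mvt Q P x t 0 t0.
  by apply: second_primitive_derive; lra.
move: E; rewrite mul0r subr0 mulr0 mul0r subr0 => ->.
have h2 : 0 < 2 * xi by lra.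
have := lip (x - xi) (2 * xi) _ _ h2 _.
rewrite (_ : x - xi + 2 * xi = x + xi); last by ring.
move=> H; rewrite normrM gtr0_norm//.
apply: (@le_trans _ _ (t * (M * (2 * xi)))).
  by rewrite ler_wpM2l ?(ltW t0)//; apply: H; lra.
apply: (@le_trans _ _ (t * (`|M| * (2 * t)))); last first.
  by rewrite le_eqVlt; apply/orP; left; apply/eqP; ring.
rewrite ler_wpM2l ?(ltW t0)//.
apply: (@le_trans _ _ (`|M| * (2 * xi))); first by rewrite ler_wpM2r ?(ltW h2)// ler_norm.
by rewrite ler_wpM2l// ler_wpM2l// ltW.
Unshelve. all: by end_near. Qed.

(** Where the first primitive has the derivative [f x], the second one has the
    second symmetric derivative [f x]. *)
Lemma second_primitive_schwarz (x : R) : -1 < x -> x < 1 -> is_derive x (1 : R) P (f x) ->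
  forall eps : R, 0 < eps -> \forall t \near (0 : R)^'+,
    `|second_diff Q t x - f x * t ^+ 2| <= eps * t ^+ 2.
Proof.
move=> x1 x1' dP eps eps0.
have e2 : 0 < eps / 2 by rewrite divr_gt0.
have [rho /= rho0 Prho] : exists2 rho : R, 0 < rho &
    forall r, `|r| < rho -> `|P (x + r) - P x - f x * r| <= eps / 2 * `|r|.
  have [dd dv] := dP.
  move: dd; rewrite /derivable => /cvg_ex[l hl].
  have lE : l = f x by rewrite -dv; apply/esym/cvg_lim.
  move: hl; rewrite lE => /cvgrPdist_le /(_ _ e2).
  rewrite /dnbhs /within/= => /nbhs_ballP[rho /= rho0 H].
  exists rho => // r rr; have [->|r0] := eqVneq r 0.
    by rewrite addr0 subrr mulr0 subrr normr0 mulr0.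
  have := H r; rewrite /ball/= sub0r normrN => /(_ rr r0).
  rewrite /GRing.scale/= mulr1 [r + x]addrC => h.
  have -> : P (x + r) - P x - f x * r = - (f x - r^-1 * (P (x + r) - P x)) * r.
    by field.
  by rewrite normrM normrN ler_wpM2r.
near=> t; have t0 : 0 < t by near: t; exact: nbhs_right_gt.
have t1 : t <= x + 1 by near: t; apply: nbhs_right_le; lra.
have t2 : t <= 1 - x by near: t; apply: nbhs_right_le; lra.
have t3 : t < rho by near: t; exact: nbhs_right_lt.
have [y y1 y2|xi /andP[xi0 xit] E] := @second_diff_mvt Q P x t (f x) t0.
  by apply: second_primitive_derive; lra.
rewrite E normrM gtr0_norm//.
have a1 := Prho xi; have a2 := Prho (- xi).
rewrite normrN gtr0_norm// in a1 a2.
have {}a1 := a1 (lt_trans xit t3); have {}a2 := a2 (lt_trans xit t3).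
apply: (@le_trans _ _ (t * (eps * xi))).
  rewrite ler_wpM2l ?(ltW t0)//.
  move: a1 a2; rewrite !ler_norml => /andP[b1 b2] /andP[b3 b4].
  by clear -b1 b2 b3 b4; apply/andP; split; lra.
rewrite mulrCA expr2 ler_wpM2l ?(ltW eps0)// ler_wpM2l ?(ltW t0)// ltW.
Unshelve. all: by end_near. Qed.

End second_primitive_of_function.

(** * Second differences and the modulus of continuity *)

Section identification.
Context {R : realType}.
Notation mu := (@lebesgue_measure R).
Variables (a : nat -> R) (A c : R).
Hypothesis aA : forall n, (1 <= n)%N -> 0 <= a n <= A.
Variables (f : R -> R) (M h0 : R).
Hypothesis mf : measurable_fun setT f.
Hypothesis intf : mu.-integrable `[(- 2 : R), 2] (EFin \o f).
Hypothesis h00 : 0 < h0.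
Hypothesis lipP : forall y h : R, -1 <= y -> y <= 1 -> 0 < h -> h <= h0 ->
  `|primitive f (y + h) - primitive f y| <= M * h.
Hypothesis sumf : forall x : R, -1 < x -> x < 1 -> x != 0 ->
  trig_sum a c ^~ x @ \oo --> f x.
Hypothesis smooth0 : forall eps : R, 0 < eps -> \forall t \near (0 : R)^'+,
  `|second_diff (riemann_fun a c) t 0| <= eps * t.

Local Notation F := (riemann_fun a c).
Local Notation Q := (second_primitive f).

Let H x := F x - Q x.

Let second_diffH t x : second_diff H t x = second_diff F t x - second_diff Q t x.
Proof. by rewrite /second_diff /H; ring. Qed.

Let continuousH x : -2 < x -> x < 2 -> {for x, continuous H}.
Proof.
move=> x2 x2'; apply: cvgB; first exact: (continuous_riemann_fun aA).
apply: differentiable_continuous; apply/derivable1_diffP.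
by case: (second_primitive_derive intf x2 x2').
Qed.

Let affineH (al be : R) : al < be -> -1 <= al -> be <= 1 -> (be <= 0) || (0 <= al) ->
  forall x, al <= x <= be -> H x = H al + (H be - H al) / (be - al) * (x - al).
Proof.
move=> ab al1 be1 alb.
have n0 (x : R) : al < x < be -> x != 0.
  move=> /andP[ax xb]; case/orP: alb => h; first by rewrite lt_eqF// (lt_le_trans xb).
  by rewrite gt_eqF// (le_lt_trans h).
apply: schwarz_affine => //.
- apply: continuous_in_subspaceT => x; rewrite inE/= in_itv/= => /andP[ax xb].
  by apply: continuousH; lra.
- move=> x xab; have /andP[ax xb] := xab.
  have x1 : -1 < x by lra.
  have x1' : x < 1 by lra.
  exists (`|f x| + 1 + 2 * `|M|).
  have := riemann_first aA (sumf x1 x1' (n0 x xab)) ltr01.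
  have := second_primitive_bound intf h00 lipP x1 x1'.
  apply: filter_app2; near=> t => h1 h2; rewrite second_diffH.
  have t20 : 0 <= t ^+ 2 by rewrite sqr_ge0.
  have h3 : `|f x * t ^+ 2| <= `|f x| * t ^+ 2 by rewrite normrM (ger0_norm t20).
  move: h1 h2 h3; rewrite !ler_norml => /andP[? ?] /andP[? ?] /andP[? ?].
  by apply/andP; split; lra.
- have := primitive_ae_derive intf.
  apply: filterS; first exact: (ae_filter_ringOfSetsType mu).
  move=> x Px xab eps eps0; have /andP[ax xb] := xab.
  have x1 : -1 < x by lra.
  have x1' : x < 1 by lra.
  have {}Px : is_derive x (1 : R) (primitive f) (f x) by apply: Px; lra.
  have e2 : 0 < eps / 2 by rewrite divr_gt0.
  have := riemann_first aA (sumf x1 x1' (n0 x xab)) e2.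
  have := second_primitive_schwarz intf x1 x1' Px e2.
  apply: filter_app2; near=> t => h1 h2; rewrite second_diffH.
  move: h1 h2; rewrite !ler_norml => /andP[? ?] /andP[? ?].
  by apply/andP; split; lra.
Unshelve. all: by end_near. Qed.

(** Riemann's function is a second primitive of the sum, up to an affine
    function. The affine pieces found on both sides of the origin agree since
    the difference is smooth there. *)
Lemma riemann_fun_second_primitive (x t : R) : 0 <= t -> -1 <= x - t -> x + t <= 1 ->
  second_diff F t x = second_diff Q t x.
Proof.
move=> t0 xt1 xt2.
pose sr := H 1 - H 0; pose sl := H 0 - H (-1).
have Hr y : 0 <= y -> y <= 1 -> H y = H 0 + sr * y.
  move=> y0 y1; have := @affineH 0 1 ltr01 _ (lexx _).
  move=> /(_ _ _ y) ->; [|lra|by rewrite lexx orbT|by rewrite y0].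
  by rewrite !subr0 divr1.
have Hl y : -1 <= y -> y <= 0 -> H y = H 0 + sl * y.
  move=> y1 y0; have := @affineH (-1) 0 _ (lexx _).
  move=> /(_ _ _ _ y) ->; [|lra|lra|by rewrite lexx|by rewrite y1].
  by rewrite /sl sub0r opprK divr1; ring.
clearbody sr sl.
have slsr : sr = sl.
  apply/eqP; rewrite -subr_eq0 -normr_le0; apply/ler_addgt0Pr => e e0; rewrite add0r.
  have e2 : 0 < e / 2 by rewrite divr_gt0.
  have m11 : (-1 : R) < 0 by lra.
  have := second_primitive_bound intf h00 lipP m11 ltr01.
  have := smooth0 e2.
  have ee : 0 < e / 2 / (2 * `|M| + 1) by rewrite !divr_gt0// ltr_wpDl// mulr_ge0.
  have [r r0 h] : exists2 r : R, 0 < r & `|sr - sl| * r <= e * r.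
    suff : \forall r \near (0 : R)^'+, 0 < r /\ `|sr - sl| * r <= e * r.
      by move/filter_ex => [r [r0 hr]]; exists r.
    move: (smooth0 e2) (second_primitive_bound intf h00 lipP m11 ltr01).
    apply: filter_app2; near=> r => h1 h2.
    have r0 : 0 < r by near: r; exact: nbhs_right_gt.
    have r1 : r <= 1 by near: r; apply: nbhs_right_le.
    have r2 : r <= e / 2 / (2 * `|M| + 1) by near: r; apply: nbhs_right_le.
    split => //.
    have E : second_diff H r 0 = (sr - sl) * r.
      rewrite /second_diff add0r sub0r (Hr r) ?(ltW r0)// (Hl (- r)); [|lra|lra].
      by move: (H 0) => u; ring.
    rewrite -[X in _ * X <= _](gtr0_norm r0) -normrM -E second_diffH.
    have h3 : 2 * `|M| * r ^+ 2 <= e / 2 * r.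
      rewrite expr2 mulrA ler_wpM2r ?(ltW r0)//.
      rewrite (le_trans (ler_wpM2l _ r2)) ?mulr_ge0//.
      rewrite mulrC mulrAC ler_pdivrMr ?ltr_wpDl ?mulr_ge0//.
      by rewrite ler_wpM2l ?(ltW e2)// lerDl.
    move: h1 h2; rewrite !ler_norml => /andP[? ?] /andP[? ?].
    by apply/andP; split; lra.
  by move=> _ _; rewrite -(ler_pM2r r0).
have Hall y : -1 <= y -> y <= 1 -> H y = H 0 + sr * y.
  move=> y1 y1'; case/orP: (le_total 0 y) => h; first exact: Hr.
  by rewrite slsr; exact: Hl.
apply/eqP; rewrite -subr_eq0 -second_diffH /second_diff.
rewrite (Hall (x + t)) ?(Hall (x - t)) ?(Hall x); [|lra..].
by apply/eqP; move: (H 0) => u; ring.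
Unshelve. all: by end_near. Qed.

(** The oscillation of the second differences is controlled by the mean
    modulus of continuity of the sum. *)
Lemma second_diff_osc_le (h x y E : R) : 0 < h -> h <= y -> y <= 1 / 2 ->
  0 <= x -> x <= y ->
  (\int[mu]_(s in `[(- y)%R, y]) `|f (s + h) - f s|%:E <= E%:E)%E ->
  `|second_diff F h x - second_diff F h 0| <= h * E.
Proof.
move=> hp hy y2 x0 xy hE.
rewrite !riemann_fun_second_primitive; [|lra..].
pose G z := Q (z + h) - Q z.
pose D z := primitive f (z + h) - primitive f z.
have dG (z : R) : -1 <= z -> z <= 1 / 2 -> is_derive z (1 : R) G (D z).
  move=> z1 z2.
  have D1 : is_derive z (1 : R) Q (primitive f z) by apply: second_primitive_derive => //; lra.
  have D2 : is_derive z (1 : R) (fun r => Q (h + r)) (primitive f (h + z)).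
    by apply: is_derive_reflect; apply: second_primitive_derive => //; lra.
  rewrite /G /D [z + h]addrC.
  have -> : (fun z : R => Q (z + h) - Q z) = (fun r => Q (h + r)) - Q.
    by apply/funext => r; rewrite [r + h]addrC.
  exact: is_deriveB.
have mvt (z : R) : 0 <= z -> z <= y -> exists2 xi, - y <= xi <= y & second_diff Q h z = h * D xi.
  move=> z0 zy; have zh : z - h < z by lra.
  have [s||xi] := @MVT R G D (z - h) z zh.
  - by rewrite in_itv/= => /andP[s0 st]; apply: dG; lra.
  - apply: derivable_within_continuous => s; rewrite in_itv/= => /andP[s0 st].
    have D1 : is_derive s (1 : R) G (D s) by apply: dG; lra.
    by case: D1.
  rewrite in_itv/= => /andP[xi1 xi2] E1; exists xi; first by lra.
  have -> : h * D xi = G z - G (z - h) by rewrite E1; ring.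
  by rewrite /second_diff /G subrK; ring.
have [xi1 /andP[x1 x1'] ->] := mvt x x0 xy.
have [xi2 /andP[x2 x2'] ->] : exists2 xi, - y <= xi <= y & second_diff Q h 0 = h * D xi.
  by apply: mvt => //; lra.
rewrite -mulrBr normrM gtr0_norm// ler_wpM2l ?(ltW hp)//.
wlog le21 : xi1 xi2 x1 x1' x2 x2' / xi2 <= xi1.
  move=> W; case/orP: (le_total xi2 xi1) => le; first exact: W.
  by rewrite distrC; exact: W.
rewrite -lee_fin (le_trans _ hE)//.
have := @primitive_shiftB_le R f mf intf h xi2 xi1 (ltW hp) _ le21 _.
move=> Hs; apply: le_trans (le_trans (Hs _ _) _); [|lra|lra|].
  by rewrite lee_fin.
apply: ge0_subset_integral => //=.
- apply: measurable_funTS; apply/measurable_EFinP; apply: measurableT_comp => //.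
  apply: measurable_funB => //.
  by apply: (measurableT_comp mf); exact: measurable_shift.
- by apply: subset_itv; rewrite bnd_simp.
Qed.

End identification.

(** * Coefficients in a block and second differences *)

Section block_coefficients.
Context {R : realType}.
Variables (a : nat -> R) (A : R).
Hypothesis aA : forall n, (1 <= n)%N -> 0 <= a n <= A.

Let a0 n : (1 <= n)%N -> 0 <= a n.
Proof. by move=> /aA /andP[]. Qed.

(** For cosine sums the second differences of Riemann's function at [0] and at
    [y] differ by a series of nonnegative terms. *)
Lemma cos_second_diff_sum_le (h y B : R) :
  `|second_diff (riemann_fun a 0) h y - second_diff (riemann_fun a 0) h 0| <= B ->
  forall N, \sum_(1 <= n < N) 2 * a n * (1 - cos (n%:R * h)) / n%:R ^+ 2 *
    (1 - cos (n%:R * y)) <= B.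
Proof.
move=> hB N.
pose u N := second_diff (riemann_sum a 0 N) h 0 - second_diff (riemann_sum a 0 N) h y.
have uE K : u K = \sum_(1 <= n < K) 2 * a n * (1 - cos (n%:R * h)) / n%:R ^+ 2 *
    (1 - cos (n%:R * y)).
  rewrite /u !second_diff_riemann_sum -sumrB; apply: eq_bigr => n _.
  by rewrite mulr0 !addr0 cos0; ring.
have ucvg : u K @[K --> \oo] --> second_diff (riemann_fun a 0) h 0 - second_diff (riemann_fun a 0) h y.
  by apply: cvgB; exact: second_diff_riemann_fun_cvg aA _ _.
apply: (@le_trans _ _ (second_diff (riemann_fun a 0) h 0 - second_diff (riemann_fun a 0) h y)).
  rewrite -uE; apply: (cvgr_to_ge ucvg); exists N => // K /= NK.
  rewrite !uE; case: N NK => [|N] NK.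
    rewrite big_geq//; rewrite big_nat; apply: sumr_ge0 => n /andP[n1 _].
    by rewrite !mulr_ge0 ?invr_ge0 ?sqr_ge0 ?subr_ge0 ?cos_le1 ?a0.
  rewrite [leRHS](@big_cat_nat _ _ _ N.+1)//= lerDl big_nat.
  apply: sumr_ge0 => n /andP[n1 _].
  by rewrite !mulr_ge0 ?invr_ge0 ?sqr_ge0 ?subr_ge0 ?cos_le1 ?a0// (leq_trans _ n1).
by rewrite (le_trans _ hB)// distrC ler_norm.
Qed.

Local Notation c := (- (pi / 2) : R).

Lemma sin_second_diff0 t : second_diff (riemann_fun a c) t 0 = 0.
Proof.
have := @second_diff_riemann_fun_cvg R a A c aA t 0.
have -> : (fun N => second_diff (riemann_sum a c N) t 0) = cst (0 : R).
  apply/funext => N; rewrite second_diff_riemann_sum big1// => n _.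
  by rewrite mulr0 cosBpihalf sin0 mulr0.
by move=> h; apply/esym; apply: (cvg_unique _ _ h); [exact: Rhausdorff|exact: cvg_cst].
Qed.

(** For sine sums an integration in [y] makes the terms nonnegative; the
    integral is estimated through the mean value theorem, applied to the
    partial sums. *)
Lemma sin_second_diff_sum_le (h y B : R) : 0 < y ->
  (forall x, 0 <= x -> x <= y -> `|second_diff (riemann_fun a c) h x| <= B) ->
  forall N, \sum_(1 <= n < N) 2 * a n * (1 - cos (n%:R * h)) / n%:R ^+ 3 *
    (1 - cos (n%:R * y)) <= y * B.
Proof.
move=> y0 hB N.
pose w n : R := 2 * a n * (1 - cos (n%:R * h)) / n%:R ^+ 3.
have w0 n : (1 <= n)%N -> 0 <= w n.
  by move=> n1; rewrite !mulr_ge0 ?invr_ge0 ?exprn_ge0 ?subr_ge0 ?cos_le1 ?a0.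
pose K N z : R := \sum_(1 <= n < N) w n * (1 - cos (n%:R * z)).
have Kinc N1 N2 : (N1 <= N2)%N -> K N1 y <= K N2 y.
  move=> N12; case: N1 N12 => [|N1] N12.
    rewrite /K big_geq//; rewrite big_nat; apply: sumr_ge0 => n /andP[n1 _].
    by rewrite mulr_ge0 ?subr_ge0 ?cos_le1 ?w0.
  rewrite /K [leRHS](@big_cat_nat _ _ _ N1.+1)//= lerDl big_nat.
  apply: sumr_ge0 => n /andP[n1 _].
  by rewrite mulr_ge0 ?subr_ge0 ?cos_le1 ?w0// (leq_trans _ n1).
have dK L z : is_derive z (1 : R) (K L) (second_diff (riemann_sum a c L) h z).
  rewrite second_diff_riemann_sum /K.
  have -> : (fun z : R => \sum_(1 <= n < L) w n * (1 - cos (n%:R * z))) =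
     \sum_(1 <= n < L) (fun z => w n * (1 - cos (n%:R * z))).
    by apply/funext => r; rewrite fct_sumE.
  elim: L => [|L IH].
    by rewrite !big_geq//; exact: is_derive_cst.
  have [->|L0] := posnP L; first by rewrite !big_geq//; exact: is_derive_cst.
  rewrite !big_nat_recr//=; apply: is_deriveD.
  have D1 : is_derive z (1 : R) (fun z : R => L%:R * z) L%:R.
    by apply: is_derive_eq; rewrite /GRing.scale/= mulr1.
  have D2 := @is_derive1_comp R cos (fun z => L%:R * z) z _ _ (is_derive_cos _) D1.
  rewrite cosBpihalf.
  apply: is_derive_eq; rewrite /GRing.scale/= /w.
  by field; rewrite pnatr_eq0 -lt0n.
have lim : y * (B + 4 * (A * (2 / N0%:R))) @[N0 --> \oo] --> y * B.
  rewrite -[X in _ --> y * X]addr0; apply: cvgMl_tmp; apply: cvgD; first exact: cvg_cst.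
  rewrite -[X in _ --> X](mulr0 4); apply: cvgMl_tmp.
  rewrite -[X in _ --> X](mulr0 A); apply: cvgMl_tmp.
  rewrite -[X in _ --> X](mulr0 2); apply: cvgMl_tmp.
  exact: cvg_inv_nat.
rewrite -/(K N y); apply: (cvgr_to_ge lim); exists N.+1 => // L /= NL.
have L1 : (1 <= L)%N by rewrite (leq_trans _ NL).
rewrite (le_trans (Kinc _ _ (ltnW NL)))//.
have [|xi] := @MVT_segment R (K L) (fun z => second_diff (riemann_sum a c L) h z) 0 y (ltW y0) (fun z _ => dK L z).
  apply: derivable_within_continuous => s _.
  by case: (dK L s).
rewrite in_itv/= => /andP[xi0 xiy].
have -> : K L 0 = 0.
  by rewrite /K big1// => n _; rewrite mulr0 cos0 subrr mulr0.
rewrite !subr0 mulrC => ->; rewrite ler_wpM2l ?(ltW y0)//.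
have := @second_diff_riemann_fun_tail R a A c aA L h xi L1.
have := hB xi xi0 xiy.
by rewrite !ler_norml => /andP[? ?] /andP[? ?]; lra.
Qed.

(** At a frequency comparable with [1 / y], the cosine factors are bounded
    below. *)
Lemma one_sub_cos_block_ge (h y : R) (m1 m2 n : nat) : 0 < h -> h <= y ->
  1 / 2 <= m1%:R * y -> m2%:R * y <= 2 -> (m1 <= n < m2.+1)%N ->
  1 / 2 <= n%:R * y /\
  (n%:R * h) ^+ 2 / 4 * ((n%:R * y) ^+ 2 / 4) <=
    (1 - cos (n%:R * h)) * (1 - cos (n%:R * y)).
Proof.
move=> h0 hy m1y m2y /andP[mn nm].
have y0 : 0 <= y by exact: le_trans (ltW h0) hy.
have ny : n%:R * y <= 2 by apply: le_trans m2y; rewrite ler_wpM2r// ler_nat -ltnS.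
have ny2 : 1 / 2 <= n%:R * y by apply: (le_trans m1y); rewrite ler_wpM2r// ler_nat.
have nh : n%:R * h <= n%:R * y by rewrite ler_wpM2l.
split=> //; apply: ler_pM; rewrite ?divr_ge0 ?sqr_ge0//; apply: one_sub_cos_ge.
  by rewrite mulr_ge0 ?(ltW h0)//=; lra.
by apply/andP; split; lra.
Qed.

Lemma cos_block_le (h y E : R) (m1 m2 : nat) : 0 < h -> h <= y ->
  (1 <= m1)%N -> 1 / 2 <= m1%:R * y -> m2%:R * y <= 2 ->
  `|second_diff (riemann_fun a 0) h y - second_diff (riemann_fun a 0) h 0| <= h * E ->
  h * \sum_(m1 <= n < m2.+1) a n <= 32 * E.
Proof.
move=> h0 hy m11 m1y m2y hE.
have [m21|m12] := leqP m2.+1 m1.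
  rewrite big_geq// mulr0 mulr_ge0// -(pmulr_rge0 _ h0).
  exact: le_trans (normr_ge0 _) hE.
have := cos_second_diff_sum_le hE m2.+1.
rewrite (@big_cat_nat _ _ _ m1)//=; last exact: ltnW.
have s0 : 0 <= \sum_(1 <= n < m1) 2 * a n * (1 - cos (n%:R * h)) / n%:R ^+ 2 * (1 - cos (n%:R * y)).
  rewrite big_nat; apply: sumr_ge0 => n /andP[n1 _].
  by rewrite !mulr_ge0 ?invr_ge0 ?sqr_ge0 ?subr_ge0 ?cos_le1 ?a0.
have : \sum_(m1 <= n < m2.+1) a n * (h ^+ 2 / 32) <=
   \sum_(m1 <= n < m2.+1) 2 * a n * (1 - cos (n%:R * h)) / n%:R ^+ 2 * (1 - cos (n%:R * y)).
  apply: ler_sum_nat => n nm; have [ny c3] := one_sub_cos_block_ge h0 hy m1y m2y nm.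
  have n1 : (1 <= n)%N by apply: leq_trans m11 _; case/andP: nm.
  have x0 : 0 < n%:R :> R by rewrite ltr0n.
  move: (n%:R : R) x0 ny c3 => x x0 ny c3.
  have xy2 : 1 / 4 <= (x * y) ^+ 2.
    have : 0 <= (x * y - 1 / 2) * (x * y + 1 / 2) by rewrite mulr_ge0//; lra.
    lra.
  have -> : 2 * a n * (1 - cos (x * h)) / x ^+ 2 * (1 - cos (x * y)) =
     a n * ((1 - cos (x * h)) * (1 - cos (x * y)) * 2 / x ^+ 2) by ring.
  rewrite ler_wpM2l ?a0// ler_pdivlMr ?exprn_gt0//.
  have : (x * h) ^+ 2 / 4 * (1 / 16) <= (x * h) ^+ 2 / 4 * ((x * y) ^+ 2 / 4).
    by rewrite ler_wpM2l ?divr_ge0 ?sqr_ge0//; lra.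
  move: c3; rewrite !(exprMn _ x h); lra.
rewrite -mulr_suml => b1 b2.
have : (\sum_(m1 <= n < m2.+1) a n) * (h ^+ 2 / 32) <= h * E by lra.
set S := \sum_(m1 <= n < m2.+1) a n => b3.
rewrite -(ler_pM2l h0); lra.
Qed.

Lemma sin_block_le (h y E : R) (m1 m2 : nat) : 0 < h -> h <= y ->
  (1 <= m1)%N -> 1 / 2 <= m1%:R * y -> m2%:R * y <= 2 ->
  (forall x, 0 <= x -> x <= y -> `|second_diff (riemann_fun a c) h x| <= h * E) ->
  h * \sum_(m1 <= n < m2.+1) a n <= 32 * E.
Proof.
move=> h0 hy m11 m1y m2y hE.
have y0 : 0 < y by exact: lt_le_trans hy.
have E0 : 0 <= E.
  rewrite -(pmulr_rge0 _ h0).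
  exact: le_trans (normr_ge0 _) (hE 0 (lexx _) (ltW y0)).
have [m21|m12] := leqP m2.+1 m1.
  by rewrite big_geq// mulr0 mulr_ge0.
have := sin_second_diff_sum_le y0 hE m2.+1.
rewrite (@big_cat_nat _ _ _ m1)//=; last exact: ltnW.
have s0 : 0 <= \sum_(1 <= n < m1) 2 * a n * (1 - cos (n%:R * h)) / n%:R ^+ 3 * (1 - cos (n%:R * y)).
  rewrite big_nat; apply: sumr_ge0 => n /andP[n1 _].
  by rewrite !mulr_ge0 ?invr_ge0 ?exprn_ge0 ?subr_ge0 ?cos_le1 ?a0.
have : \sum_(m1 <= n < m2.+1) a n * (h ^+ 2 * y / 16) <=
   \sum_(m1 <= n < m2.+1) 2 * a n * (1 - cos (n%:R * h)) / n%:R ^+ 3 * (1 - cos (n%:R * y)).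
  apply: ler_sum_nat => n nm; have [ny c3] := one_sub_cos_block_ge h0 hy m1y m2y nm.
  have n1 : (1 <= n)%N by apply: leq_trans m11 _; case/andP: nm.
  have x0 : 0 < n%:R :> R by rewrite ltr0n.
  move: (n%:R : R) x0 ny c3 => x x0 ny c3.
  have xy2 : x * y / 2 <= (x * y) ^+ 2 by rewrite expr2 ler_wpM2l; lra.
  have -> : 2 * a n * (1 - cos (x * h)) / x ^+ 3 * (1 - cos (x * y)) =
     a n * ((1 - cos (x * h)) * (1 - cos (x * y)) * 2 / x ^+ 3) by ring.
  rewrite ler_wpM2l ?a0// ler_pdivlMr ?exprn_gt0//.
  have : (x * h) ^+ 2 / 4 * (x * y / 8) <= (x * h) ^+ 2 / 4 * ((x * y) ^+ 2 / 4).
    by rewrite ler_wpM2l ?divr_ge0 ?sqr_ge0//; lra.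
  move: c3; rewrite !(exprMn _ x h); lra.
rewrite -mulr_suml => b1 b2.
set S := \sum_(m1 <= n < m2.+1) a n in b1 *.
have b3 : S * (h ^+ 2 * y / 16) <= y * (h * E) by lra.
have b4 : (y * h) * (h * S) <= (y * h) * (16 * E) by lra.
have : h * S <= 16 * E by rewrite -(ler_pM2l (mulr_gt0 y0 h0)).
lra.
Qed.

End block_coefficients.

(** * A dyadic form of Hardy's inequality *)

Section dyadic_hardy.
Context {R : realType}.
Notation mu := (@lebesgue_measure R).
Variables (p : R).
Hypothesis p1 : 1 < p.

Let p0 : 0 < p. Proof. exact: lt_trans p1. Qed.

Local Notation rho := (hardy_ratio p).
Local Notation q := (1 - p^-1).

Let I (k : nat) : set R := `[- (2 ^- k : R), 2 ^- k]%classic.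

Let mI k : measurable (I k : set (measurableTypeR R)).
Proof. exact: measurable_itv. Qed.

Let IS k : I k.+1 `<=` I k.
Proof.
have h : (2 ^- k.+1 : R) <= 2 ^- k.
  by rewrite lef_pV2 ?posrE ?exprn_gt0// exprS ler_peMl ?exprn_ge0//; lra.
by apply: subset_itv; rewrite bnd_simp ?lerN2.
Qed.

(* The shells of the decomposition of [I 0]; the last one is the whole
   interval [I M]. *)
Let T (M k : nat) : set R := if k == M then I M else I k `\` I k.+1.

Let mT M k : measurable (T M k : set (measurableTypeR R)).
Proof. by rewrite /T; case: ifP => // _; exact: measurableD. Qed.

Let TI M k : T M k `<=` I k.
Proof. by rewrite /T; case: eqP => [->//|_]; exact: subDsetl. Qed.

Let decomposition (v : R -> R) (M i : nat) : measurable_fun setT v ->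
  (forall x, 0 <= v x) -> (i <= M)%N ->
  (\int[mu]_(s in I (M - i)%N) (v s)%:E =
   \sum_(M - i <= k < M.+1) \int[mu]_(s in T M k) (v s)%:E)%E.
Proof.
move=> mv v0; elim: i => [|i IH] iM.
  by rewrite subn0 big_nat1 /T eqxx.
have Mi : (M - i.+1 < M.+1)%N by lia.
rewrite big_ltn//.
have E : (M - i.+1).+1 = (M - i)%N by lia.
rewrite E -IH; last exact: ltnW.
rewrite /T ifF; last by apply/negbTE; lia.
rewrite E.
have sub : I (M - i)%N `<=` I (M - i.+1)%N by rewrite -E.
rewrite -ge0_integral_setU//.
- by rewrite setUC setDUK.
- exact: measurableD.
- by apply: measurable_funTS; exact/measurable_EFinP.
- by move=> x _; rewrite lee_fin.
- by rewrite disj_set2E setDKI.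
Qed.

(** The integrals of [u] over the intervals [- 2 ^- j, 2 ^- j], suitably
    weighted, are bounded in l^p by the L^p norm of [u]. *)
Lemma dyadic_hardy (u : R -> R) (B : R) (M : nat) : measurable_fun setT u ->
  (forall x, 0 <= u x) -> 0 <= B ->
  (\int[mu]_(s in `[(-2)%R, 2%R]) (u s `^ p)%:E <= (B `^ p)%:E)%E ->
  exists E : nat -> R, (forall j, (j <= M)%N -> 0 <= E j /\
    (\int[mu]_(s in `[(- (2 ^- j))%R, (2 ^- j)%R]) (u s)%:E <= (E j)%:E)%E) /\
  \sum_(j < M.+1) ((2 ^+ j) `^ q * E j) `^ p <= (2 `^ q * (2 / (1 - rho)) * B) `^ p.
Proof.
move=> mU u0 B0 uB.
have mup : measurable_fun setT (fun x => u x `^ p).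
  exact: (measurableT_comp (measurable_powR p)).
have up0 x : 0 <= u x `^ p by exact: powR_ge0.
have I02 : I 0 `<=` `[(-2 : R), 2]%classic.
  by apply: subset_itv; rewrite bnd_simp expr0 invr1; lra.
have intI0 : (\int[mu]_(s in I 0) (u s `^ p)%:E <= (B `^ p)%:E)%E.
  apply: le_trans uB; apply: ge0_subset_integral => //=.
    by apply: measurable_funTS; exact/measurable_EFinP.
  by move=> x _; rewrite lee_fin.
have II k : I k `<=` I 0 by elim: k => // k IH; exact: subset_trans (@IS k) IH.
have fT k : (\int[mu]_(s in T M k) (u s `^ p)%:E \is a fin_num)%E.
  rewrite ge0_fin_numE; last by apply: integral_ge0 => x _; rewrite lee_fin.
  apply: (@le_lt_trans _ _ (B `^ p)%:E); last exact: ltry.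
  apply: le_trans intI0; apply: ge0_subset_integral => //=.
  - by apply: measurable_funTS; exact/measurable_EFinP.
  - by move=> x _; rewrite lee_fin.
  - exact: subset_trans (@TI M k) (@II k).
pose F k := fine (\int[mu]_(s in T M k) (u s `^ p)%:E)%E.
have F0 k : 0 <= F k by apply: fine_ge0; apply: integral_ge0 => x _; rewrite lee_fin.
pose e k := F k `^ p^-1.
have e0 k : 0 <= e k by exact: powR_ge0.
have eF k : e k `^ p = F k.
  by rewrite /e -powRrM mulVf ?gt_eqF// powRr1.
have sumF : \sum_(k < M.+1) e k `^ p <= B `^ p.
  rewrite -lee_fin; apply: le_trans intI0.
  have := @decomposition (fun x => u x `^ p) M M mup up0 (leqnn M).
  rewrite subnn => ->; rewrite -(big_mkord predT (fun k => e k `^ p)) -sumEFin.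
  by apply: lee_sum => k _; rewrite eF /F fineK.
pose cc (k : nat) : R := 2 * 2 ^- k.
have cc0 k : 0 < cc k by rewrite mulr_gt0// invr_gt0 exprn_gt0.
have Tk k : (\int[mu]_(s in T M k) (u s)%:E <= (cc k `^ q * e k)%:E)%E.
  have -> : cc k `^ q * e k = cc k * (cc k `^ (- p^-1) * e k).
    rewrite powRD; last by rewrite (gt_eqF (cc0 k)) implybT.
    by rewrite powRr1 ?(ltW (cc0 k))// mulrA.
  apply: (@integral_power_mean _ _ R mu (T M k) u p (cc k)) => //.
  - exact: measurable_funTS.
  - exact: ltW.
  - have Ik : - 2 ^- k <= 2 ^- k :> R by have : 0 <= 2 ^- k :> R by []; lra.
    have := lebesgue_measure_cc Ik.
    have -> : 2 ^- k - - 2 ^- k = cc k by rewrite /cc; ring.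
    move=> h; apply: (@le_trans _ _ (mu (I k))).
      by apply: le_measure; rewrite ?inE//; exact: TI.
    by rewrite -h.
  - by rewrite mulr_ge0// powR_ge0.
  - have -> : cc k * (cc k `^ (- p^-1) * e k) `^ p = F k.
      rewrite powRM ?powR_ge0// -powRrM mulNr mulVf ?gt_eqF// powR_inv1 ?(ltW (cc0 k))//.
      by rewrite mulrA divff ?gt_eqF// mul1r eF.
    by rewrite /F fineK.
pose E j := \sum_(j <= k < M.+1) cc k `^ q * e k.
exists E; split.
  move=> j jM; split; first by apply: sumr_ge0 => k _; rewrite mulr_ge0// powR_ge0.
  have := @decomposition u M (M - j) mU u0 (leq_subr _ _).
  rewrite subKn// => ->; rewrite -sumEFin.
  by apply: lee_sum => k _; exact: Tk.
have r01 : 0 <= rho < 1 by rewrite hardy_ratio_ge0 hardy_ratio_lt1.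
have W0 : 0 <= 2 / (1 - rho).
  by rewrite divr_ge0// subr_ge0 ltW//; case/andP: r01.
apply: (@le_trans _ _ (\sum_(j < M.+1) (2 `^ q) `^ p *
    (\sum_(k < M.+1) rho ^+ (j - k + (k - j)) * e k) `^ p)).
  apply: ler_sum => j _; rewrite -powRM ?powR_ge0//; last first.
    by apply: sumr_ge0 => k _; rewrite mulr_ge0// exprn_ge0// hardy_ratio_ge0.
  rewrite ge0_ler_powR ?nnegrE ?(ltW p0)//.
  - by rewrite mulr_ge0 ?powR_ge0// sumr_ge0// => k _; rewrite mulr_ge0// powR_ge0.
  - rewrite mulr_ge0 ?powR_ge0// sumr_ge0// => k _.
    by rewrite mulr_ge0// exprn_ge0// hardy_ratio_ge0.
  rewrite -(big_mkord predT (fun k => rho ^+ (j - k + (k - j)) * e k)).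
  rewrite (@big_cat_nat _ _ _ j)//=; last by rewrite ltnW// ltn_ord.
  rewrite mulrDr ler_wpDl//.
    rewrite mulr_ge0 ?powR_ge0// sumr_ge0// => k _.
    by rewrite mulr_ge0// exprn_ge0// hardy_ratio_ge0.
  rewrite !mulr_sumr; apply: ler_sum_nat => k /andP[jk _].
  rewrite !mulrA ler_wpM2r// -powRM ?exprn_ge0 ?(ltW (cc0 k))//.
  have -> : (j - k + (k - j))%N = (k - j)%N by rewrite (eqP jk).
  rewrite -(powR_mulrn (k - j)%N (hardy_ratio_ge0 p)) /hardy_ratio powRAC -powRM ?powR_ge0//.
  rewrite powR_mulrn ?divr_ge0//.
  rewrite le_eqVlt; apply/orP; left; apply/eqP; congr (_ `^ _).
  rewrite /cc expr_div_n expr1n mulrCA; congr (_ * _).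
  by rewrite -{1}(subnKC jk) exprD invfM mulrA divff ?mul1r ?div1r//.
rewrite -mulr_sumr.
apply: (@le_trans _ _ ((2 `^ q) `^ p * ((2 / (1 - rho)) `^ p * B `^ p))).
  rewrite ler_wpM2l ?powR_ge0//.
  apply: (le_trans (schur_geometric M.+1 M.+1 p1 r01 e0)).
  by rewrite ler_wpM2l ?powR_ge0.
rewrite (powRM _ (mulr_ge0 (powR_ge0 2 q) W0) B0) (powRM _ (powR_ge0 2 q) W0).
by rewrite mulrA.
Qed.

End dyadic_hardy.

(** * The Lipschitz condition implies the dyadic condition *)

Section coefficients_tend_to_0.
Context {R : realType}.
Implicit Types (a : nat -> R).

Lemma trig_sum_term_cvg0 a (c x l : R) : trig_sum a c ^~ x @ \oo --> l ->
  a n * cos (n%:R * x + c) @[n --> \oo] --> (0 : R).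
Proof.
move=> h.
have h1 : trig_sum a c n.+1 x @[n --> \oo] --> l by rewrite (cvg_shiftS (trig_sum a c ^~ x)).
have : (trig_sum a c n.+1 x - trig_sum a c n x) @[n --> \oo] --> l - l by exact: cvgB.
rewrite subrr; apply: cvg_trans; apply: near_eq_cvg.
exists 1%N => // n /= n1.
by rewrite /trig_sum big_nat_recr//= addrAC subrr add0r.
Qed.

Lemma abs_cos_pin (n : nat) : `|cos (n%:R * pi : R)| = 1.
Proof.
apply: sin0cos1; elim: n => [|n IH]; first by rewrite mul0r sin0.
by rewrite -natr1 mulrDl mul1r sinDpi IH oppr0.
Qed.

Lemma cvg0_normP (u : nat -> R) : u @ \oo --> (0 : R) <->
  forall e : R, 0 < e -> exists N, forall n, (N <= n)%N -> `|u n| <= e.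
Proof.
split=> [/cvgrPdist_le h e e0|h].
  by have [N _ hN] := h e e0; exists N => n /hN; rewrite /= sub0r normrN.
apply/cvgrPdist_le => e e0; have [N hN] := h e e0.
by exists N => // n /= /hN; rewrite sub0r normrN.
Qed.

Lemma cos_coefficients_cvg0 a (l : R) : (forall n, (1 <= n)%N -> 0 <= a n) ->
  trig_sum a 0 ^~ pi @ \oo --> l -> a @ \oo --> (0 : R).
Proof.
move=> a0 /trig_sum_term_cvg0 /cvg0_normP h; apply/cvg0_normP => e e0.
have [N hN] := h e e0; exists N => n /hN.
by rewrite addr0 normrM abs_cos_pin mulr1.
Qed.

(** Convergence of a sine series at [pi / 2] and [pi / 4] controls the
    coefficients of odd index and of index twice an odd number; the remaining
    ones are reached by one step of the bounded variation inequality. *)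
Lemma sin_coefficients_cvg0 a (l1 l2 : R) : NBVS a ->
  trig_sum a (- (pi / 2)) ^~ (pi / 2) @ \oo --> l1 ->
  trig_sum a (- (pi / 2)) ^~ (pi / 4) @ \oo --> l2 -> a @ \oo --> (0 : R).
Proof.
move=> /NBVS_const[K K1 aK] /trig_sum_term_cvg0 /cvg0_normP h1
  /trig_sum_term_cvg0 /cvg0_normP h2.
have sin_odd k : `|cos (k.*2.+1%:R * (pi / 2) + - (pi / 2)) : R| = 1.
  rewrite -[RHS](abs_cos_pin k); congr (`|cos _|).
  by rewrite -natr1 -mul2n natrM; field.
apply/cvg0_normP => e e0.
have e' : 0 < e / (1 + 2 * K) by rewrite divr_gt0//; lra.
have [N1 hN1] := h1 _ e'; have [N2 hN2] := h2 _ e'.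
have odd_le n : odd n -> (N1 <= n)%N -> `|a n| <= e / (1 + 2 * K).
  move=> on /hN1; rewrite -{2}(odd_double_half n) on add1n.
  by rewrite normrM sin_odd mulr1.
have twice_le n : odd n -> (N2 <= n)%N -> `|a (2 * n)%N| <= e / (1 + 2 * K).
  move=> on Nn; have /hN2 : (N2 <= 2 * n)%N by lia.
  have -> : (2 * n)%:R * (pi / 4) + - (pi / 2) = n%:R * (pi / 2) + - (pi / 2) :> R.
    by rewrite natrM; field.
  by rewrite -{2}(odd_double_half n) on add1n normrM sin_odd mulr1.
have ee : e / (1 + 2 * K) <= e by rewrite ler_pdivrMr; [rewrite ler_peMr ?(ltW e0)//; lra|lra].
exists (N1 + N2).+2 => n nN.
have [on|en] := boolP (odd n).
  rewrite (le_trans (odd_le n on _))//; by clear -nN; lia.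
(* An even [n] follows an odd index [m]. *)
case: n nN en => // m mN; rewrite /= negbK => on.
have [m0 m1 m2] : [/\ (0 < m)%N, (N1 <= m)%N & (N2 <= m)%N].
  by clear -mN; split; lia.
have [am0 am] := aK m m0.
have a20 : 0 <= a (2 * m)%N by apply: (aK _ _).1; rewrite muln_gt0.
have an0 : 0 <= a m.+1 by apply: (aK _ _).1.
have := odd_le m on m1; have := twice_le m on m2; rewrite !ger0_norm// => b2 b1.
have b3 : `|a m - a m.+1| <= K * (a m + a (2 * m)%N).
  by apply: le_trans am; rewrite big_ltn ?lerDl ?sumr_ge0// ltnS leq_pmull.
have b4 : K * (a m + a (2 * m)%N) <= K * (2 * (e / (1 + 2 * K))).
  by rewrite ler_wpM2l ?(le_trans ler01 K1)// mulr_natl mulr2n lerD.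
have b5 : (1 + 2 * K) * (e / (1 + 2 * K)) = e by rewrite mulrC divfK// gt_eqF//; lra.
move: b3; rewrite ler_norml => /andP[b3 _]; clear -b1 b3 b4 b5; lra.
Qed.

Lemma cvg0_bounded a : a @ \oo --> (0 : R) -> exists A, forall n, `|a n| <= A.
Proof.
move=> ac; have /cvg_seq_bounded[M [_ hM]] : cvgn a by apply/cvg_ex; exists 0.
by exists (M + 1) => n; apply: hM => //; rewrite ltrDl.
Qed.

End coefficients_tend_to_0.

Section necessity.
Context {R : realType}.
Implicit Types (a : nat -> R) (f : R -> R) (p c : R).
Notation mu := (@lebesgue_measure R).

(** The weights of the dyadic condition, in the form in which Hardy's
    inequality and Schur's test produce them. *)
Lemma weight_powR p (y s : R) : 1 < p -> 0 < y -> 0 <= s ->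
  (y `^ (1 - p^-1) * (y * s)) `^ p = y `^ (2 * p - 1) * s `^ p.
Proof.
move=> p1 y0 s0; rewrite mulrA powR_mulS// powRM ?powR_ge0// -powRrM.
by congr (_ `^ _ * _); field; rewrite gt_eqF// (lt_trans _ p1).
Qed.

(** A dyadic sample is controlled by the sum over a surrounding block. *)
Lemma NBVS_dyadic_le_sum a (K : R) (L : nat) :
  NBVS_bound a K ->
  1 <= K -> (0 < L)%N ->
  L%:R * a (2 * L)%N <= 4 * K * \sum_(L <= n < (4 * L).+1) a n.
Proof.
move=> aK K1 L0.
have a0 n : (0 < n)%N -> 0 <= a n by move=> /aK[].
have pos (m n : nat) : (0 < m)%N -> 0 <= \sum_(m <= i < n) a i.
  by move=> m0; rewrite big_nat sumr_ge0// => i /andP[mi _]; rewrite a0//; lia.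
have h1 : \sum_(L <= n < 2 * L) a (2 * L)%N <=
    \sum_(L <= n < 2 * L) 2 * K * (a n + a (2 * n)%N).
  apply: ler_sum_nat => n /andP[Ln nL]; apply: (@NBVS_le _ _ _ _ _ aK) => //; lia.
rewrite sumr_const_nat (_ : 2 * L - L = L)%N in h1; last by lia.
rewrite mulr_natl; apply: (le_trans h1); rewrite -mulr_sumr big_split/=.
have h2 : \sum_(L <= n < 2 * L) a n <= \sum_(L <= n < (4 * L).+1) a n.
  by rewrite [leRHS](@big_cat_nat _ _ _ (2 * L))/= ?lerDl ?pos//; lia.
have h3 : \sum_(L <= n < 2 * L) a (2 * n)%N <= \sum_(L <= n < (4 * L).+1) a n.
  apply: (le_trans (sum_even_block_le _ L0 a0)).
  rewrite [leRHS](@big_cat_nat _ _ _ (2 * L))/=; [|lia|lia].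
  rewrite ler_wpDl ?pos// mulnA [leRHS]big_nat_recr/=; last by lia.
  by rewrite lerDl a0//; lia.
have -> : 4 * K * \sum_(L <= n < (4 * L).+1) a n = 2 * K * (\sum_(L <= n < (4 * L).+1) a n + \sum_(L <= n < (4 * L).+1) a n) by ring.
by rewrite ler_wpM2l ?lerD//; lra.
Qed.

Lemma not_multiple_2pi (x : R) : x != 0 -> `|x| < pi *+ 2 ->
  forall k : int, x != (pi *+ 2) *~ k.
Proof.
move=> x0 xpi k; apply/eqP => xk; move: x0 xpi.
have pi2 : 0 < pi *+ 2 :> R by rewrite pmulrn_lgt0// pi_gt0.
have [k0|k0] := eqVneq k 0; first by rewrite xk k0 mulr0z eqxx.
move=> _; rewrite xk -mulrzr normrM gtr0_norm// gtr_pMr//.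
by rewrite ltNge norm_intr_ge1 ?intr_int// intr_eq0.
Qed.

Lemma integrable_of_Lp p f (D : set (measurableTypeR R)) : 1 < p -> measurable D ->
  (mu D < +oo)%E -> measurable_fun setT f ->
  (\int[mu]_(x in D) (`|f x| `^ p)%:E < +oo)%E -> mu.-integrable D (EFin \o f).
Proof.
move=> p1 mD fD mf fp; apply/integrableP; split.
  by apply/measurable_EFinP; apply: measurable_funTS.
have mfp := measurable_powR_norm p mf.
have m1 : measurable_fun D (fun x => (1 + `|f x| `^ p)%:E).
  by apply/measurable_EFinP; apply: measurable_funTS; apply: measurable_funD.
apply: (@le_lt_trans _ _ (\int[mu]_(x in D) (1 + `|f x| `^ p)%:E)%E).
  apply: ge0_le_integral => //=.
  - by apply/measurable_EFinP; apply: measurable_funTS; exact: measurableT_comp.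
  - move=> x _; rewrite lee_fin.
    have [f1|f1] := leP `|f x| 1; first by rewrite ler_wpDr// powR_ge0.
    apply: ler_wpDl => //; rewrite -[leLHS]powRr1//.
    by apply: ler_powR => //; exact: ltW.
under eq_integral do rewrite EFinD.
rewrite ge0_integralD//=; last by apply/measurable_EFinP; apply: measurable_funTS.
by rewrite lte_add_pinfty// integral_cst//= mul1e.
Qed.

(** A quantitative form of membership in the Lipschitz class, on an interval
    on which the local analysis takes place. *)
Lemma Lipschitz_p_local p f : 1 < p -> Lipschitz_p p f ->
  [/\ measurable_fun setT f,
      mu.-integrable `[(- 2 : R), 2] (EFin \o f) &
      exists C h0 : R, [/\ 0 <= C, 0 < h0, h0 <= 1 &
        forall t : R, 0 < t -> t <= h0 ->
        (\int[mu]_(s in `[(-2)%R, 2%R]) (`|f (s + t) - f s| `^ p)%:E <=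
          ((C * t) `^ p)%:E)%E]].
Proof.
move=> p1 [/(Lp_2piP _ (lt_trans ltr01 p1))[per mf fp] [C]].
have p0 : 0 < p by exact: lt_trans p1.
have sub : `[(- 2 : R), 2] `<=` `[(- (pi : R))%R, pi]%classic.
  by apply: subset_itv; rewrite bnd_simp ?lerN2 pi_ge2.
have restr (g : R -> R) : measurable_fun setT g ->
    (\int[mu]_(s in `[(-2)%R, 2%R]) (`|g s| `^ p)%:E <=
     \int[mu]_(s in `[(- (pi : R))%R, pi]) (`|g s| `^ p)%:E)%E.
  move=> mg; apply: ge0_subset_integral => //=.
  by apply/measurable_EFinP; apply: measurable_funTS; exact: measurable_powR_norm.
move=> [d /= d0 hd]; split => //.
  apply: (integrable_of_Lp p1) => //.
    by rewrite [X in (X < _)%E]lebesgue_measure_itv/=; case: ifP; rewrite ?ltry// EFinN -EFinD ltry.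
  exact: le_lt_trans (restr f mf) fp.
exists (Num.max 0 C), (Num.min 1 (d / 2)); split.
- by rewrite le_max lexx.
- by rewrite lt_min ltr01/= divr_gt0.
- by rewrite ge_min lexx.
move=> t t0; rewrite le_min => /andP[_ td].
have mft : measurable_fun setT (fun x : R => f (x + t) - f x).
  by apply: measurable_funB => //; apply: (measurableT_comp mf); exact: measurable_shift.
apply: (le_trans (restr _ mft)).
have c0 : 0 <= Num.max 0 C * t by rewrite mulr_ge0 ?(ltW t0)// le_max lexx.
rewrite -(norm_p_le p0 c0 mft).
have := hd t; rewrite /= sub0r normrN gtr0_norm// => /(_ _ t0).
have td' : t < d by lra.
move=> /(_ td') h1.
apply: (@le_trans _ _ (C * t)%:E); last by rewrite lee_fin ler_wpM2r ?(ltW t0)// le_max lexx orbT.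
apply: le_trans h1; apply: ereal_sup_ubound; exists t => //=.
by rewrite gtr0_norm.
Qed.

(** The Lipschitz condition forces the dyadic condition on the coefficients.
    With a step [h] finer than all the blocks considered, the coefficients at
    the scale [2 ^ j] are controlled by the integral of [|f (s + h) - f s|]
    over [- 2 ^- j, 2 ^- j], and Hardy's inequality sums these integrals. *)
Lemma Lipschitz_p_dyadic p a c f : 1 < p -> NBVS a ->
  c = 0 \/ c = - (pi / 2) ->
  (forall x : R, (forall k : int, x != (pi *+ 2) *~ k) ->
     trig_sum a c ^~ x @ \oo --> f x) ->
  Lipschitz_p p f -> exists B, forall J, \sum_(j < J) dyadic_term p a j <= B.
Proof.
move=> p1 aN cc cvgf Lf.
have [mf intf [C [h0 [C0 h00 h01 lipf]]]] := Lipschitz_p_local p1 Lf.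
have pi2 : 2 <= pi :> R := pi_ge2 R.
have [K K1 aK] := NBVS_const aN.
have anonneg n : (1 <= n)%N -> 0 <= a n by move=> /aK[].
have cvgx (x : R) : 0 < x -> x < 2 * pi -> trig_sum a c ^~ x @ \oo --> f x.
  move=> x0 x4; apply: cvgf; apply: not_multiple_2pi; first by rewrite gt_eqF.
  by rewrite gtr0_norm// -mulr_natl.
have a_0 : a @ \oo --> (0 : R).
  case: cc => cc; rewrite cc in cvgx cvgf.
    by apply: (cos_coefficients_cvg0 anonneg (cvgx pi _ _)); lra.
  by apply: (sin_coefficients_cvg0 aN (cvgx (pi / 2) _ _) (cvgx (pi / 4) _ _)); lra.
have [A hA] := cvg0_bounded a_0.
have aA n : (1 <= n)%N -> 0 <= a n <= A.
  by move=> n1; rewrite anonneg//= (le_trans (ler_norm _)).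
have [M M0 lipP] := primitive_lip mf intf p1 C0 h00 h01 lipf.
have sumf (x : R) : -1 < x -> x < 1 -> x != 0 -> trig_sum a c ^~ x @ \oo --> f x.
  move=> x1 x1' x0; apply: cvgf; apply: not_multiple_2pi => //.
  by rewrite mulr2n ltr_norml; apply/andP; split; lra.
have smooth0 (eps : R) : 0 < eps -> \forall t \near (0 : R)^'+,
    `|second_diff (riemann_fun a c) t 0| <= eps * t.
  move=> e0; case: cc => cc; first exact: (riemann_second aA a_0 cc e0).
  apply: filterS (nbhs_right_gt (0 : R)) => t t0.
  by rewrite cc (sin_second_diff0 aA) normr0 mulr_ge0// ltW.
have osc := second_diff_osc_le aA mf intf h00 lipP sumf smooth0.
pose q := 1 - p^-1; pose H := 2 `^ q * (2 / (1 - hardy_ratio p)) * C.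
exists (dyadic_term p a 0 + (256 * K * H) `^ p) => J.
have [M1 hM1] : exists M1 : nat, (J <= M1)%N /\ 2 ^- M1 <= h0.
  have [N hN] : exists N : nat, h0^-1 <= N%:R.
    by exists (Num.Def.truncn h0^-1).+1; apply: ltW; exact: truncnS_gt.
  exists (J + N)%N; split; first by rewrite leq_addr.
  rewrite -[leRHS]invrK lef_pV2 ?posrE ?invr_gt0// ?exprn_gt0//.
  apply: (le_trans hN); rewrite -natrX ler_nat.
  by apply: leq_trans (ltnW (ltn_expl _ (isT : (1 < 2)%N))) _; rewrite leq_exp2l// leq_addl.
have [JM hh] := hM1; set h : R := 2 ^- M1 in hh.
have h0' : 0 < h by rewrite invr_gt0 exprn_gt0.
pose u s := `|f (s + h) - f s|.
have mu_ : measurable_fun setT u.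
  apply: measurableT_comp => //; apply: measurable_funB => //; apply: (measurableT_comp mf); exact: measurable_shift.
have Ch : 0 <= C * h by rewrite mulr_ge0// ltW.
have [E [hE sE]] := dyadic_hardy p1 M1 mu_ (fun s => normr_ge0 _) Ch (lipf h h0' hh).
have p0 : 0 < p by exact: lt_trans p1.
have block j : (1 <= j <= M1)%N -> 2 ^+ j * a (2 ^ j)%N <= 256 * K / h * E j.
  move=> /andP[j1 jM]; have [Ej0 Ej] := hE j jM.
  case: j j1 jM Ej0 Ej => // i _ iM Ei0 Ei.
  have y0 : 0 < 2 ^- i.+1 :> R by rewrite invr_gt0 exprn_gt0.
  have hy : h <= 2 ^- i.+1 by rewrite lef_pV2 ?posrE ?exprn_gt0// ler_eXn2l// ltr1n.
  have y2 : 2 ^- i.+1 <= 1 / 2 :> R.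
    by rewrite mul1r lef_pV2 ?posrE ?exprn_gt0// exprS ler_peMr// exprn_ege1// ler1n.
  have L0 : (0 < 2 ^ i)%N by rewrite expn_gt0.
  have m1y : 1 / 2 <= (2 ^ i)%:R * 2 ^- i.+1 :> R.
    by rewrite natrX exprS invfM mulrCA divff ?expf_neq0// mul1r mulr1.
  have m2y : (4 * 2 ^ i)%:R * 2 ^- i.+1 <= 2 :> R.
    rewrite natrM natrX exprS invfM mulrACA divff ?expf_neq0//; lra.
  have S32 : h * \sum_(2 ^ i <= n < (4 * 2 ^ i).+1) a n <= 32 * E i.+1.
    have os x : 0 <= x -> x <= 2 ^- i.+1 ->
        `|second_diff (riemann_fun a c) h x - second_diff (riemann_fun a c) h 0| <= h * E i.+1.
      by move=> x0 xy; apply: (osc h x (2 ^- i.+1)).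
    case: cc => cc.
      apply: (cos_block_le aA h0' hy L0 m1y m2y).
      by rewrite -{1 2}cc os// ltW.
    apply: (sin_block_le aA h0' hy L0 m1y m2y) => x x0 xy.
    by have := os x x0 xy; rewrite cc (sin_second_diff0 aA) subr0.
  have := NBVS_dyadic_le_sum aK K1 L0; rewrite -expnS => hL.
  rewrite [leRHS]mulrAC ler_pdivlMr// exprS.
  have -> : 2 * 2 ^+ i * a (2 ^ i.+1)%N * h = 2 * h * ((2 ^ i)%:R * a (2 ^ i.+1)%N).
    by rewrite natrX; ring.
  apply: (@le_trans _ _ (2 * h * (4 * K * \sum_(2 ^ i <= n < (4 * 2 ^ i).+1) a n))).
    by rewrite ler_wpM2l// mulr_ge0// ltW.
  rewrite (_ : _ * (_ * _) = 8 * K * (h * \sum_(2 ^ i <= n < (4 * 2 ^ i).+1) a n)); last by ring.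
  rewrite (_ : 256 * K * _ = 8 * K * (32 * E i.+1)); last by ring.
  by rewrite ler_wpM2l// mulr_ge0// (le_trans ler01 K1).
have K0 : 0 <= K by exact: le_trans ler01 K1.
have Kh : 0 <= 256 * K / h.
  by apply: divr_ge0; [apply: mulr_ge0; [exact: ler0n|exact: K0]|exact: ltW].
have term j : (1 <= j <= M1)%N ->
    dyadic_term p a j <= (256 * K / h) `^ p * ((2 ^+ j) `^ q * E j) `^ p.
  move=> jM; have [Ej0 _] := hE j (proj2 (andP jM)).
  have a0 : 0 <= a (2 ^ j)%N by apply: anonneg; rewrite expn_gt0.
  have j0 : 0 < 2 ^+ j :> R by rewrite exprn_gt0.
  have -> : dyadic_term p a j = ((2 ^+ j) `^ q * (2 ^+ j * a (2 ^ j)%N)) `^ p.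
    by rewrite /q weight_powR// /dyadic_term natrX.
  have E0 : 0 <= (2 ^+ j) `^ q * E j by rewrite mulr_ge0 ?powR_ge0.
  rewrite -powRM//; apply: ge0_ler_powR; first exact: ltW.
  - by rewrite nnegrE mulr_ge0 ?powR_ge0// mulr_ge0// ltW.
  - by rewrite nnegrE mulr_ge0.
  by rewrite [leRHS]mulrCA ler_wpM2l ?powR_ge0// block.
case: J {hM1} JM => [|J] JM.
  by rewrite big_ord0 addr_ge0 ?dyadic_term_ge0 ?powR_ge0.
rewrite big_ord_recl lerD2l.
apply: (@le_trans _ _ (\sum_(i < J) (256 * K / h) `^ p * ((2 ^+ i.+1) `^ q * E i.+1) `^ p)).
  apply: ler_sum => i _; apply: (term i.+1) => /=.
  by apply: leq_trans JM; rewrite ltnS ltnW.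
rewrite -mulr_sumr.
have sJ : \sum_(i < J) ((2 ^+ i.+1) `^ q * E i.+1) `^ p <= (H * h) `^ p.
  rewrite /H -mulrA; apply: le_trans sE; rewrite [leRHS]big_ord_recl.
  apply: ler_wpDl; first exact: powR_ge0.
  rewrite -!(big_mkord xpredT (fun i => ((2 ^+ i.+1) `^ _ * E i.+1) `^ p)).
  rewrite [leRHS](@big_cat_nat _ _ _ J)//=; last exact: leq_trans JM.
  by rewrite lerDl sumr_ge0// => i _; exact: powR_ge0.
have H0 : 0 <= H by rewrite mulr_ge0// mulr_ge0 ?powR_ge0// divr_ge0// subr_ge0 ltW// hardy_ratio_lt1.
apply: (le_trans (ler_wpM2l (powR_ge0 _ _) sJ)).
rewrite -powRM// ?(mulr_ge0 H0 (ltW h0'))//.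
by rewrite (_ : _ * (H * h) = 256 * K * H)//; field; rewrite gt_eqF.
Qed.

End necessity.

(** * The fundamental theorem of calculus for absolutely continuous functions *)

Section absolute_continuity.
Context {R : realType}.
Notation mu := (@lebesgue_measure R).
Implicit Types (a b : R) (f g h : R -> R).

(** Induction along a compact interval: a property that passes across every
    point propagates from one endpoint to the other. *)
Lemma interval_induction a b (S : R -> Prop) : a <= b -> S a ->
  (forall c, a <= c -> c <= b -> exists2 r, 0 < r &
     forall x y, a <= x -> x <= c -> c <= y -> y <= b -> c - r < x -> y < c + r ->
       S x -> S y) ->
  S b.
Proof.
move=> ab Sa step; pose E := [set x | a <= x <= b /\ S x].
have Ea : E a by rewrite /E/= lexx ab.
have hE : has_sup E by split; [exists a|exists b => x [/andP[]]].
set c := sup E.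
have ac : a <= c by apply: sup_upper_bound.
have cb : c <= b by apply: sup_le_ub; [exists a|move=> x [/andP[]]].
have [r r0 hr] := step c ac cb.
have [x [/andP[ax xb] Sx] cx] := sup_adherent r0 hE.
have xc : x <= c by apply: sup_upper_bound => //; rewrite /E/= ax xb.
have [bc|cb'] := leP b (c + r / 2).
  by apply: (hr x) => //; lra.
have Ec : E (c + r / 2).
  split; first by apply/andP; split; lra.
  by apply: (hr x) => //; lra.
have := sup_upper_bound hE Ec; rewrite -/c; lra.
Qed.

(** Absolute continuity for a list of intervals sorted from right to left. *)
Lemma abs_continuous_on_seq a b h eps : abs_continuous_on a b h -> 0 < eps ->
  exists2 delta, 0 < delta & forall s : seq (R * R),
    all (fun q => [&& a <= q.1, q.1 <= q.2 & q.2 <= b]) s ->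
    pairwise (fun q q' => q'.2 <= q.1) s ->
    \sum_(q <- s) (q.2 - q.1) < delta ->
    \sum_(q <- s) `|h q.2 - h q.1| < eps.
Proof.
move=> hAC e0; have [d d0 hd] := hAC eps e0; exists d => // s sab sd.
rewrite !(big_nth (0, 0)) !big_mkord => sl.
apply: (hd (size s) (fun i => (nth (0, 0) s i).1) (fun i => (nth (0, 0) s i).2)) => //.
  move=> i; have := all_nthP (0, 0) sab i (ltn_ord i); by move=> /and3P[].
move/(pairwiseP (0, 0)) : sd => sd.
apply/trivIsetP => i j _ _ ij.
wlog lij : i j ij / (i < j)%N.
  move=> wl; have /orP[lij|lji] : (i < j)%N || (j < i)%N by rewrite -neq_ltn.
    exact: wl.
  by rewrite setIC; apply: wl => //; rewrite eq_sym.
have := sd i j; rewrite !inE !ltn_ord => /(_ isT isT lij) h1.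
apply/seteqP; split=> // x [/=]; rewrite !in_itv/= => /andP[h2 h3] /andP[h4 h5].
lra.
Qed.

Lemma derive0_step h (c eps : R) : 0 < eps -> is_derive c (1 : R) h 0 ->
  exists2 r, 0 < r & forall x y, x <= c -> c <= y -> c - r < x -> y < c + r ->
    `|h y - h x| <= eps * (y - x).
Proof.
move=> e0 [dh h0].
have hd : (fun t => t^-1 *: (h (t *: 1 + c) - h c)) t @[t --> 0^'] --> 'D_1 h c := dh.
rewrite h0 in hd.
move/cvgrPdist_le : hd => /(_ _ e0)[r /= r0 hr]; exists r => //.
have lin z : `|z - c| < r -> `|h z - h c| <= eps * `|z - c|.
  move=> zr; have [->|zc] := eqVneq z c; first by rewrite !subrr normr0 mulr0.
  have := hr (z - c); rewrite /= sub0r normrN => /(_ zr).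
  rewrite subr_eq0 => /(_ zc).
  rewrite sub0r normrN normrZ normfV [_ *: 1]mulr1 subrK ler_pdivrMl ?normr_gt0 ?subr_eq0//.
  by rewrite mulrC.
move=> x y xc cy cx yc.
have := lin x; rewrite ler0_norm ?subr_le0// => h1.
have := lin y; rewrite ger0_norm ?subr_ge0// => h2.
have {}h1 := h1 ltac:(lra); have {}h2 := h2 ltac:(lra).
have -> : h y - h x = (h y - h c) - (h x - h c) by ring.
apply: (le_trans (ler_normB _ _)); apply: (le_trans (lerD h2 h1)); lra.
Qed.

(** An absolutely continuous function with derivative 0 almost everywhere is
    constant. The exceptional set lies in an open set of small measure;
    going from [a] to [b], the increments of [h] are either small relative to
    the length or taken across intervals inside that open set. *)
Lemma abs_continuous_derive0 a b h : a <= b -> abs_continuous_on a b h ->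
  {ae mu, forall x, a < x < b -> is_derive x (1 : R) h 0} -> h b = h a.
Proof.
move=> ab hAC [N [mN N0 hN]].
pose B := N `|` [set a] `|` [set b].
have mB : measurable B by apply: measurableU; [apply: measurableU|].
have B0 : mu B = 0%E.
  rewrite measureU0//; [|exact: measurableU|exact: lebesgue_measure_set1].
  by rewrite measureU0//; exact: lebesgue_measure_set1.
apply/eqP; rewrite -subr_eq0 -normr_le0; apply/ler_addgt0Pr => eps1 eps10; rewrite add0r.
pose eps := eps1 / (b - a + 1).
have ba1 : 0 < b - a + 1 by lra.
have e0 : 0 < eps by rewrite divr_gt0.
have [d d0 hd] := abs_continuous_on_seq hAC e0.
have [U [oU BU]] := lebesgue_regularity_outer mB (eq_ind_r (fun z => z < +oo)%E (ltry 0) B0) d0.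
have mU : measurable (U : set (measurableTypeR R)) by exact: open_measurable.
move=> Ud0; have Ud : (mu (U : set (measurableTypeR R)) < d%:E)%E.
  apply: le_lt_trans Ud0; have UB : B `|` (U `\` B) = U by exact: setDUK.
  rewrite -{1}UB setUC measureU0//; exact: measurableD.
pose S x := exists s : seq (R * R),
  [/\ all (fun q => [&& a <= q.1, q.1 <= q.2 & q.2 <= x]) s,
      pairwise (fun q q' => q'.2 <= q.1) s,
      ((\sum_(q <- s) (q.2 - q.1))%:E <= mu (U `&` [set` `]-oo, x[]))%E &
      `|h x - h a| <= eps * (x - a) + \sum_(q <- s) `|h q.2 - h q.1|].
have [s [s1 s2 s3 s4]] : S b.
  apply: (interval_induction ab).
    by exists [::]; split => //; rewrite !big_nil ?subrr ?normr0 ?mulr0 ?addr0.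
  move=> c ac cb; have [Uc|Uc] := pselect (U c).
    have [r /= r0 hr] : nbhs c U by exact: open_nbhs_nbhs.
    exists r => // x y ax xc cy yb cx yc [s [s1 s2 s3 s4]].
    exists ((x, y) :: s); split.
    - rewrite /= ax (le_trans xc cy) lexx/=; apply: sub_all s1 => q /and3P[-> -> qx]/=.
      exact: le_trans (le_trans qx xc) cy.
    - by rewrite /= s2 andbT; apply: sub_all s1 => q /and3P[].
    - rewrite big_cons/= EFinD.
      apply: (@le_trans _ _ (mu `[x, y[ + mu (U `&` [set` `]-oo, x[]))%E).
        apply: leeD => //; rewrite lebesgue_measure_itv/= lte_fin.
        by case: ifPn => [_|]; [rewrite EFinN|rewrite -leNgt lee_fin subr_le0].
      rewrite -measureU//=; last 2 first.
      - by apply: measurableI.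
      - apply/seteqP; split=> // z [/=]; rewrite !in_itv/= => /andP[xz _] [_].
        by rewrite ltNge xz.
      apply: le_measure; rewrite ?inE.
      - by apply: measurableU => //; apply: measurableI.
      - by apply: measurableI.
      - move=> z [/=|[Uz /=]]; rewrite !in_itv/=.
          move=> /andP[xz zy]; split => //; apply: hr => /=.
          by rewrite ltr_distlC; apply/andP; split; lra.
        by move=> zx; split => //; lra.
    - rewrite big_cons/=.
      have -> : h y - h a = (h x - h a) + (h y - h x) by ring.
      apply: (le_trans (ler_normD _ _)).
      have : eps * (x - a) <= eps * (y - a) by rewrite ler_wpM2l ?(ltW e0)//; lra.
      lra.
  have hc : is_derive c (1 : R) h 0.
    have [ca cb'] : c != a /\ c != b.
      by split; apply/eqP => cE; apply/Uc/BU; [left; right|right].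
    have P : a < c < b -> is_derive c (1 : R) h 0.
      by apply: contrapT => nP; apply/Uc/BU; left; left; exact: hN.
    by apply: P; rewrite !lt_neqAle ac cb cb' eq_sym ca.
  have [r r0 hr] := derive0_step e0 hc.
  exists r => // x y ax xc cy yb cx yc [s [s1 s2 s3 s4]].
  have xy : x <= y by exact: le_trans cy.
  exists s; split => //.
  - by apply: sub_all s1 => q /and3P[-> -> qx]/=; exact: le_trans xy.
  - apply: (le_trans s3); apply: le_measure; rewrite ?inE; [exact: measurableI..|].
    by move=> z [Uz /=]; rewrite !in_itv/= => zx; split => //=; lra.
  - have := hr x y xc cy cx yc.
    have -> : h y - h a = (h x - h a) + (h y - h x) by ring.
    move=> h1; apply: (le_trans (ler_normD _ _)).
    have : eps * (y - a) = eps * (x - a) + eps * (y - x) by ring.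
    lra.
have sd : \sum_(q <- s) (q.2 - q.1) < d.
  rewrite -lte_fin; apply: le_lt_trans s3 _; apply: le_lt_trans Ud.
  by apply: le_measure; rewrite ?inE//; apply: measurableI.
have h1 := hd s s1 s2 sd; apply: (le_trans s4).
have : eps * (b - a + 1) = eps1 by rewrite /eps divfK// gt_eqF.
lra.
Qed.

End absolute_continuity.

Section integral_of_absolutely_continuous.
Context {R : realType}.
Notation mu := (@lebesgue_measure R).
Implicit Types (a b : R) (f g h G : R -> R).

Lemma integral_abs_continuous f G a b : mu.-integrable `[a, b] (EFin \o f) ->
  (forall x y, a <= x -> x <= y -> y <= b ->
    G y - G x = \int[mu]_(z in `[x, y]) f z) ->
  abs_continuous_on a b G.
Proof.
move=> intf Gf eps e0.
pose fab := f \_ `[a, b].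
have intfab : mu.-integrable setT (EFin \o fab).
  by rewrite -restrict_EFin; apply/integrable_restrict => //=; rewrite setTI.
have mfab : measurable_fun setT (fun z => `|fab z|%:E).
  by apply/measurable_EFinP; apply: measurableT_comp => //; case/integrableP : intfab => /measurable_EFinP.
have [d [d0 hd]] := integral_normr_continuous intfab e0.
exists d => // n u v uv tI sd.
pose I (i : 'I_n) := `]u i, v i[%classic : set (measurableTypeR R).
pose D := \big[setU/set0]_(i <- index_enum 'I_n) I i.
have mI i : measurable (I i) by exact: measurable_itv.
have mD : measurable D by apply: bigsetU_measurable.
have tI' : trivIset [set` index_enum 'I_n] I by apply: sub_trivIset tI.
have sumD (k : R -> \bar R) : measurable_fun setT k -> (forall x, 0 <= k x)%E ->
    (\int[mu]_(x in D) k x = \sum_(i < n) \int[mu]_(x in I i) k x)%E.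
  move=> mk k0; apply: ge0_integral_bigsetU => //; first exact: index_enum_uniq.
  exact: measurable_funTS.
have muI i : mu (I i) = (v i - u i)%:E.
  have [_ [ui _]] := uv i; rewrite lebesgue_measure_itv/= lte_fin.
  by case: ltP => // vu; congr EFin; lra.
have muD : mu D = (\sum_(i < n) (v i - u i))%:E.
  rewrite -[LHS]mul1e -integral_cst// sumD//.
  rewrite -sumEFin; apply: eq_bigr => i _; rewrite integral_cst// mul1e; exact: muI.
have lt_e : (\int[mu]_(x in D) `|fab x|%:E < eps%:E)%E.
  have := hd D mD (eq_ind_r (fun z => z < d%:E)%E (_ : (_ < _)%E) muD).
  rewrite lte_fin => /(_ sd).
  rewrite -lte_fin /Rintegral fineK//.
  apply: integrable_fin_num => //.
  have -> : (fun x => `|fab x|%:E) = abse \o (EFin \o fab) by apply/funext.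
  by apply: integrable_abse; apply: integrableS intfab.
rewrite -lte_fin; apply: le_lt_trans lt_e; rewrite sumD// -sumEFin.
apply: lee_sum => i _; have [aui [uvi vib]] := uv i.
have intI : mu.-integrable `[u i, v i] (EFin \o f).
  by apply: integrableS intf => //; apply: subset_itv; rewrite bnd_simp.
apply: (le_trans (integral_increment_le uvi intI (Gf _ _ aui uvi vib))).
rewrite integral_itv_bndoo; last first.
  apply/measurable_EFinP; apply: measurableT_comp => //.
  case/integrableP : intI => /measurable_EFinP mf _.
  by apply: measurable_funS mf => //; apply: subset_itv; rewrite bnd_simp.
rewrite le_eqVlt; apply/orP; left; apply/eqP; apply: eq_integral => z.
rewrite inE/= in_itv/= => /andP[uz zv].
by rewrite /fab patchE mem_set//= in_itv/=; apply/andP; split; lra.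
Qed.

Lemma abs_continuous_onB a b g h : abs_continuous_on a b g ->
  abs_continuous_on a b h -> abs_continuous_on a b (fun x => g x - h x).
Proof.
move=> gA hA eps e0; have e2 : 0 < eps / 2 by rewrite divr_gt0.
have [d1 d10 h1] := gA _ e2; have [d2 d20 h2] := hA _ e2.
exists (Num.min d1 d2); first by rewrite lt_min d10.
move=> n u v uv tI; rewrite lt_min => /andP[s1 s2].
rewrite [eps]splitr; apply: le_lt_trans (ltrD (h1 n u v uv tI s1) (h2 n u v uv tI s2)).
rewrite -big_split/=; apply: ler_sum => i _.
rewrite (_ : _ - _ = (g (v i) - g (u i)) - (h (v i) - h (u i))); last by ring.
exact: ler_normB.
Qed.

(** The fundamental theorem of calculus for absolutely continuous functions. *)
Lemma abs_continuous_FTC g dg a b : a <= b -> abs_continuous_on a b g ->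
  {ae mu, forall x, a < x < b -> is_derive x (1 : R) g (dg x)} ->
  mu.-integrable `[a, b] (EFin \o dg) ->
  g b - g a = \int[mu]_(z in `[a, b]) dg z.
Proof.
rewrite le_eqVlt => /predU1P[->|ab] gA gd intg.
  by rewrite subrr set_itv1 Rintegral_set1.
pose F y := parameterized_integral mu a y dg.
have FA : abs_continuous_on a b F.
  apply: (integral_abs_continuous intg) => x y ax xy yb.
  exact: (parameterized_integralB intg).
have := abs_continuous_derive0 (ltW ab) (abs_continuous_onB gA FA).
have Fa : F a = 0 by rewrite /F /parameterized_integral set_itv1 Rintegral_set1.
rewrite Fa subr0 => h.
rewrite -h; first by rewrite /F /parameterized_integral opprB addrC subrK.
have Fd := integral_ae_derive ab intg.
apply: filterS2 gd Fd; first exact: (ae_filter_ringOfSetsType mu).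
move=> x h1 h2 axb; have := is_deriveB (h1 axb) (h2 axb).
by rewrite subrr.
Qed.

End integral_of_absolutely_continuous.

Section periodic_integrals.
Local Open Scope ereal_scope.
Context {R : realType}.
Notation mu := (@lebesgue_measure R).

Lemma ge0_integral_cover_le (A B C : set (measurableTypeR R)) (w : R -> \bar R) :
  measurable A -> measurable B -> measurable C -> measurable_fun setT w ->
  (forall x, 0 <= w x) -> C `<=` A `|` B ->
  \int[mu]_(x in C) w x <= \int[mu]_(x in A) w x + \int[mu]_(x in B) w x.
Proof.
move=> mA mB mC mw w0 CAB.
apply: (@le_trans _ _ (\int[mu]_(x in A `|` (B `\` A)) w x)).
  apply: ge0_subset_integral => //.
  - by apply: measurableU => //; exact: measurableD.
  - exact: measurable_funTS.
  - move=> x /CAB[Ax|Bx]; first by left.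
    by have [Ax|Ax] := pselect (A x); [left|right].
rewrite ge0_integral_setU//; [|exact: measurableD|exact: measurable_funTS|].
  apply: leeD => //; apply: ge0_subset_integral => //; first exact: measurableD.
  exact: measurable_funTS.
by apply/disj_setPS => x [Ax []].
Qed.

Lemma ge0_integral_periodic_lty (w : R -> R) : measurable_fun setT w ->
  (forall x, 0 <= w x)%R -> periodic w (pi *+ 2) ->
  \int[mu]_(x in `[(- (pi : R))%R, pi%R]) (w x)%:E < +oo ->
  forall a b : R, \int[mu]_(x in `[a, b]) (w x)%:E < +oo.
Proof.
move=> mw w0 pw fw a b.
have mw' : measurable_fun setT (fun x => (w x)%:E) by exact/measurable_EFinP.
have shift (n : nat) (c d : R) : \int[mu]_(x in `[(c + (pi *+ 2) *+ n)%R, (d + (pi *+ 2) *+ n)%R]) (w x)%:E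
    = \int[mu]_(x in `[c, d]) (w x)%:E.
  rewrite ge0_integral_itv_shift//; first by apply: eq_integral => x _; rewrite periodicn.
    exact: measurable_funTS.
  by move=> x _; rewrite lee_fin.
have right n : \int[mu]_(x in `[(- (pi : R))%R, (pi + (pi *+ 2) *+ n)%R]) (w x)%:E < +oo.
  elim: n => [|n IH]; first by rewrite mulr0n addr0.
  apply: (@le_lt_trans _ _ (\int[mu]_(x in `[(- (pi : R))%R, pi]) (w x)%:E +
    \int[mu]_(x in `[(- (pi : R) + (pi *+ 2) *+ 1)%R, (pi + (pi *+ 2) *+ n + (pi *+ 2) *+ 1)%R]) (w x)%:E)).
    apply: ge0_integral_cover_le => //.
    move=> x /=; rewrite !in_itv/= => /andP[x1 x2].
    have [xp|xp] := leP x pi; [left|right].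
      by rewrite x1.
    apply/andP; split.
      by rewrite mulr1n mulr2n addrA addNr add0r ltW.
    by move: x2; rewrite mulr1n mulrSr addrA.
  by rewrite shift lte_add_pinfty.
pose m := (Num.Def.truncn `|a|).+1; pose n := (Num.Def.truncn `|b|).+1.
have pi1 : (1 <= pi *+ 2 :> R)%R by have := pi_ge2 R; rewrite mulr2n; lra.
have big (z : R) : (`|z| <= (pi *+ 2) *+ (Num.Def.truncn `|z|).+1)%R.
  apply: (@le_trans _ _ ((Num.Def.truncn `|z|).+1%:R)%R); first exact/ltW/truncnS_gt.
  by rewrite -[leRHS]mulr_natr -[leLHS]mul1r ler_wpM2r.
rewrite -(shift m); apply: le_lt_trans (right (m + n)%N).
apply: ge0_subset_integral => //; first exact: measurable_funTS.
  by move=> x _; rewrite lee_fin.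
apply: subset_itv; rewrite bnd_simp.
  have := big a; have := ler_norm (- a)%R; rewrite normrN -/m.
  have := pi_ge0 R; lra.
rewrite mulrnDr.
have := big b; have := ler_norm b; rewrite -/n.
have := pi_ge0 R; lra.
Qed.

End periodic_integrals.

(** Tonelli's theorem on a rectangle, for a nonnegative function defined on the
    whole plane. *)
Section tonelli.
Local Open Scope ereal_scope.
Context {R : realType}.
Notation mu := (@lebesgue_measure R).
Variables (F : R * R -> R) (A B : set (measurableTypeR R)).
Hypothesis mF : measurable_fun (setT : set (measurableTypeR R * measurableTypeR R)) F.
Hypothesis F0 : forall z, (0 <= F z)%R.
Hypotheses (mA : measurable A) (mB : measurable B).

Let H (z : measurableTypeR R * measurableTypeR R) : \bar R := ((EFin \o F) \_ (A `*` B)) z.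

Let mH : measurable_fun setT H.
Proof.
apply/(measurable_restrictT _ _).1 => //; first exact: measurableX.
by apply: measurable_funTS; exact/measurable_EFinP.
Qed.

Let H0 z : 0 <= H z.
Proof. by rewrite /H patchE; case: ifP => //= _; rewrite lee_fin. Qed.

Let Hl x : \int[mu]_y H (x, y) = ((fun x => \int[mu]_(y in B) (F (x, y))%:E) \_ A) x.
Proof.
rewrite /H [RHS]patchE; case: ifPn => xA.
  rewrite [RHS]integral_mkcond; apply: eq_integral => y _.
  by rewrite !patchE in_setX/= xA.
by rewrite integral0_eq// => y _; rewrite patchE in_setX/= (negbTE xA).
Qed.

Let Hr y : \int[mu]_x H (x, y) = ((fun y => \int[mu]_(x in A) (F (x, y))%:E) \_ B) y.
Proof.
rewrite /H [RHS]patchE; case: ifPn => yB.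
  rewrite [RHS]integral_mkcond; apply: eq_integral => x _.
  by rewrite !patchE in_setX/= yB andbT.
by rewrite integral0_eq// => x _; rewrite patchE in_setX/= (negbTE yB) andbF.
Qed.

Lemma tonelli_on : \int[mu]_(x in A) \int[mu]_(y in B) (F (x, y))%:E =
  \int[mu]_(y in B) \int[mu]_(x in A) (F (x, y))%:E.
Proof.
rewrite integral_mkcond [RHS]integral_mkcond.
rewrite -[LHS](eq_integral _ _ (fun x _ => Hl x)) -[RHS](eq_integral _ _ (fun y _ => Hr y)).
exact: (@fubini_tonelli _ _ _ _ _ mu mu H mH H0).
Qed.

Lemma measurable_integral_on : measurable_fun A (fun x => \int[mu]_(y in B) (F (x, y))%:E).
Proof.
apply/(measurable_restrictT _ _).2 => //.
rewrite -(funext Hl).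
exact: (@measurable_fun_fubini_tonelli_F _ _ _ _ _ mu H mH H0).
Qed.

End tonelli.

(** * Integrals of L^p functions are Lipschitz in the mean *)

Section Lipschitz_of_absolutely_continuous.
Context {R : realType}.
Notation mu := (@lebesgue_measure R).
Implicit Types (p t x y : R) (f g dg : R -> R).

Lemma ae_shift t (P : R -> Prop) : {ae mu, forall x, P x} ->
  {ae mu, forall x, P (x + t)}.
Proof.
move=> [N [mN N0 hN]]; exists ((fun x => x + t) @^-1` N); split.
- by rewrite -[X in measurable X]setTI; exact: (measurable_shift t measurableT mN).
- by rewrite -[LHS]/(pushforward mu _ N) lebesgue_measure_shift.
- by move=> x hx; exact: hN.
Qed.

(** Hölder's inequality for the increment of an indefinite integral. *)
Lemma increment_powR_le p t x g dg : 1 < p -> 0 < t -> measurable_fun setT dg ->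
  mu.-integrable `[x, x + t] (EFin \o dg) ->
  (\int[mu]_(z in `[x, (x + t)%R]) (`|dg z| `^ p)%:E < +oo)%E ->
  g (x + t) - g x = \int[mu]_(z in `[x, x + t]) dg z ->
  ((`|g (x + t) - g x| `^ p)%:E <=
    (t `^ p / t)%:E * \int[mu]_(z in `[0%R, t]) (`|dg (x + z)| `^ p)%:E)%E.
Proof.
move=> p1 t0 mdg intdg fin gE.
have p0 : 0 < p by exact: lt_trans p1.
have mw := measurable_powR_norm p mdg.
have -> : (\int[mu]_(z in `[0%R, t]) (`|dg (x + z)| `^ p)%:E =
    \int[mu]_(z in `[x, (x + t)%R]) (`|dg z| `^ p)%:E)%E.
  have := @ge0_integral_itv_shift R x 0 t (fun z => (`|dg z| `^ p)%:E).
  rewrite add0r [t + x]addrC => ->.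
  - by apply: eq_integral => z _; rewrite addrC.
  - by apply/measurable_EFinP; exact: measurable_funTS.
  - by move=> z _; rewrite lee_fin powR_ge0.
set I := (\int[mu]_(z in _) _)%E in fin *.
have I0 : (0 <= I)%E by apply: integral_ge0 => z _; rewrite lee_fin powR_ge0.
have If : I \is a fin_num by rewrite ge0_fin_numE.
pose W := fine I; have IW : I = W%:E by rewrite fineK.
have W0 : 0 <= W by exact: fine_ge0.
pose B := (W / t) `^ p^-1.
have Bp : B `^ p = W / t by rewrite -powRrM mulVf ?gt_eqF// powRr1// divr_ge0// ltW.
have incr : (`|g (x + t) - g x|%:E <= (t * B)%:E)%E.
  have xt : x <= x + t by lra.
  apply: (le_trans (integral_increment_le xt intdg gE)).
  apply: (@integral_power_mean _ _ _ mu `[x, x + t]%classic (fun z => `|dg z|) p) => //.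
  - by apply: measurableT_comp => //; exact: measurable_funTS.
  - exact: ltW.
  - by rewrite -[leLHS]/(lebesgue_measure _) lebesgue_measure_cc// addrAC subrr add0r.
  - exact: powR_ge0.
  - by rewrite Bp mulrCA divff ?gt_eqF// mulr1 -IW.
rewrite lee_fin in incr.
rewrite IW -EFinM lee_fin.
have -> : t `^ p / t * W = (t * B) `^ p.
  by rewrite powRM ?powR_ge0 ?(ltW t0)// Bp; ring.
by apply: ge0_ler_powR; rewrite ?nnegrE ?mulr_ge0 ?powR_ge0 ?(ltW p0) ?(ltW t0).
Qed.

Lemma bounded_Lp f g p M : 0 < p -> measurable_fun setT f ->
  {ae mu, forall x, f x = g x} -> (forall x, - pi <= x -> x <= pi -> `|g x| <= M) ->
  (\int[mu]_(x in `[(- (pi : R))%R, pi]) (`|f x| `^ p)%:E < +oo)%E.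
Proof.
move=> p0 mf fg gM.
apply: (@le_lt_trans _ _ (\int[mu]_(x in `[(- (pi : R))%R, pi]) (cst (M `^ p)%:E x))%E).
  apply: ae_ge0_le_integral => //.
  - by apply/measurable_EFinP; apply: measurable_funTS; exact: measurable_powR_norm.
  - by move=> x _; rewrite lee_fin powR_ge0.
  apply: filterS fg; first exact: (ae_filter_ringOfSetsType mu).
  move=> x -> /=; rewrite in_itv/= => /andP[x1 x2]; rewrite lee_fin.
  have gM' := gM x x1 x2.
  by apply: ge0_ler_powR; rewrite ?nnegrE ?(ltW p0)// (le_trans _ gM').
rewrite integral_cst//=.
have pp : - pi <= pi :> R by have := pi_ge0 R; lra.
by rewrite -[X in (_ * X < _)%E]/(lebesgue_measure _) lebesgue_measure_cc// -EFinM ltry.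
Qed.

(** Functions equivalent to an integral of an [L^p] function satisfy the
    Lipschitz condition in the mean. *)
Lemma equiv_AC_Lipschitz p f : 1 < p -> periodic f (pi *+ 2) ->
  measurable_fun setT f -> equiv_AC_deriv_Lp p f -> Lipschitz_p p f.
Proof.
move=> p1 pf mf [g [dg [fg gA gd Ldg]]].
have p0 : 0 < p by exact: lt_trans p1.
have pi2 := pi_ge2 R.
have [pdg mdg fdg] := (Lp_2piP dg p0).1 Ldg.
pose w z := `|dg z| `^ p.
have w0 z : 0 <= w z by exact: powR_ge0.
have mw : measurable_fun setT w by exact: measurable_powR_norm.
have wfin (a b : R) : (\int[mu]_(z in `[a, b]) (w z)%:E < +oo)%E.
  by apply: ge0_integral_periodic_lty => // z; rewrite /w pdg.
have intdg (a b : R) : mu.-integrable `[a, b] (EFin \o dg).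
  apply: (integrable_of_Lp p1) => //.
  have [ab|ba] := leP a b.
    by rewrite -[X in (X < _)%E]/(lebesgue_measure _) lebesgue_measure_cc// ltry.
  by rewrite set_itv_ge ?measure0// bnd_simp -ltNge.
have FTC (a b : R) : a <= b -> g b - g a = \int[mu]_(z in `[a, b]) dg z.
  move=> ab; apply: (abs_continuous_FTC ab (gA a b)) => //.
  by apply: filterS gd; first exact: (ae_filter_ringOfSetsType mu).
split.
  apply/(Lp_2piP _ p0); split; [exact: pf|exact: mf|].
  pose M := `|g (- pi)| + fine (\int[mu]_(z in `[(- (pi : R))%R, pi]) `|dg z|%:E)%E.
  apply: (@bounded_Lp f g p M) => // x x1 x2.
  have -> : g x = g (- pi) + (g x - g (- pi)) by ring.
  apply: (le_trans (ler_normD _ _)); rewrite lerD2l -lee_fin.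
  have finI : (\int[mu]_(z in `[(- (pi : R))%R, pi]) `|dg z|%:E)%E \is a fin_num.
    apply: integrable_fin_num => //.
    have -> : (fun z => `|dg z|%:E) = abse \o (EFin \o dg) by apply/funext.
    exact: integrable_abse.
  rewrite fineK//.
  apply: (le_trans (integral_increment_le x1 (intdg _ _) (FTC _ _ x1))).
  apply: ge0_subset_integral => //.
    by apply/measurable_EFinP; apply: measurableT_comp => //; exact: measurable_funTS.
  by apply: subset_itv; rewrite bnd_simp.
pose X := `[- pi - 1, pi + 1]%classic : set (measurableTypeR R).
have mX : measurable X by exact: measurable_itv.
pose IW := (\int[mu]_(z in `[(- (pi : R) - 1)%R, (pi + 2)%R]) (w z)%:E)%E.
have IW0 : (0 <= IW)%E by apply: integral_ge0 => z _; rewrite lee_fin.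
have IWf : IW \is a fin_num by rewrite ge0_fin_numE// wfin.
pose W := fine IW; have IWE : IW = W%:E by rewrite fineK.
have W0 : 0 <= W by exact: fine_ge0.
pose u t x := `|f (x + t) - f x| `^ p.
have mft t : measurable_fun setT (fun x : R => f (x + t) - f x).
  by apply: measurable_funB => //; apply: (measurableT_comp mf); exact: measurable_shift.
have mu_ t : measurable_fun setT (u t) by exact: measurable_powR_norm.
have key t : 0 < t -> t <= 1 -> (\int[mu]_(x in X) (u t x)%:E <= (t `^ p * W)%:E)%E.
  move=> t0 t1.
  pose F (z : R * R) := w (z.1 + z.2).
  have mF : measurable_fun (setT : set (measurableTypeR R * measurableTypeR R)) F.
    by apply: (measurableT_comp mw); apply: measurable_funD.
  have F0 z : 0 <= F z by exact: w0.
  have mT : measurable (`[0, t]%classic : set (measurableTypeR R)) by exact: measurable_itv.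
  apply: (@le_trans _ _ (\int[mu]_(x in X) ((t `^ p / t)%:E *
      \int[mu]_(y in `[0%R, t]) (F (x, y))%:E))%E).
    apply: ae_ge0_le_integral => //.
    - by move=> x _; rewrite lee_fin powR_ge0.
    - by apply/measurable_EFinP; apply: measurable_funTS; exact: mu_.
    - move=> x _; apply: mule_ge0.
        by rewrite lee_fin divr_ge0 ?powR_ge0// ltW.
      by apply: integral_ge0 => y _; rewrite lee_fin.
    - by apply: measurable_funeM; exact: (measurable_integral_on mF F0 mX mT).
    have fgt := ae_shift t fg.
    apply: filterS2 fg fgt; first exact: (ae_filter_ringOfSetsType mu).
    move=> x fx fxt _; rewrite /u fx fxt.
    apply: increment_powR_le => //; apply: FTC; lra.
  rewrite ge0_integralZl; last 4 first.
  - exact: mX.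
  - exact: (measurable_integral_on mF F0 mX mT).
  - by move=> x _; apply: integral_ge0 => y _; rewrite lee_fin.
  - by rewrite lee_fin divr_ge0 ?powR_ge0// ltW.
  rewrite (tonelli_on mF F0 mX mT).
  apply: (@le_trans _ _ ((t `^ p / t)%:E * \int[mu]_(y in `[0%R, t]) (cst W%:E y))%E).
    apply: lee_wpmul2l; first by rewrite lee_fin divr_ge0 ?powR_ge0// ltW.
    apply: ge0_le_integral; first exact: mT.
    - by move=> y _; apply: integral_ge0 => x _; rewrite lee_fin.
    - have mF' : measurable_fun (setT : set (measurableTypeR R * measurableTypeR R))
          (fun z : R * R => w (z.2 + z.1)).
        by apply: (measurableT_comp mw); apply: measurable_funD.
      exact: (measurable_integral_on mF' (fun z => w0 _) mT mX).
    - exact: measurable_cst.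
    move=> y /=; rewrite in_itv/= => /andP[y0 yt]; rewrite -IWE /IW.
    rewrite -[leLHS](@ge0_integral_itv_shift R y (- pi - 1) (pi + 1) (fun z => (w z)%:E)).
    - apply: ge0_subset_integral => //; first by apply/measurable_EFinP; exact: measurable_funTS.
        by move=> z _; rewrite lee_fin.
      by apply: subset_itv; rewrite bnd_simp; lra.
    - by apply/measurable_EFinP; exact: measurable_funTS.
    - by move=> z _; rewrite lee_fin.
  rewrite integral_cst//= -[X in (_ * (_ * X) <= _)%E]/(lebesgue_measure _).
  rewrite lebesgue_measure_cc ?(ltW t0)// subr0 -!EFinM lee_fin.
  by rewrite le_eqVlt; apply/orP; left; apply/eqP; field; rewrite gt_eqF.
pose C := W `^ p^-1.
have C0 : 0 <= C by exact: powR_ge0.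
have Cp t : 0 <= t -> (C * t) `^ p = t `^ p * W.
  by move=> t0; rewrite powRM// -powRrM mulVf ?gt_eqF// powRr1// mulrC.
(* For negative [t], a translation by [t] reduces to the positive case; this is
   why [key] is stated on an interval larger than a period. *)
exists C.
have bound t : `|t| <= 1 -> (norm_p p (fun x => (f (x + t) - f x)%R) <= (C * `|t|)%:E)%E.
  move=> t1; rewrite norm_p_le ?mulr_ge0// Cp//.
  have mX' : measurable_fun X (fun x => (u `|t| x)%:E).
    by apply/measurable_EFinP; apply: measurable_funTS; exact: mu_.
  have [t0|t0|t0] := ltgtP t 0.
  - rewrite ltr0_norm// in t1 *; apply: le_trans (key (- t) _ t1); last by rewrite oppr_gt0.
    have uE x : `|f (x + t) - f x| `^ p = u (- t) (x + t).
      by rewrite /u addrK distrC.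
    under eq_integral do rewrite uE.
    rewrite -(@ge0_integral_itv_shift R t (- pi) pi (fun z => (u (- t) z)%:E)).
    + apply: ge0_subset_integral => //.
      * by rewrite -(ltr0_norm t0).
      * by move=> z _; rewrite lee_fin powR_ge0.
      * by apply: subset_itv; rewrite bnd_simp; lra.
    + by apply/measurable_EFinP; apply: measurable_funTS; exact: mu_.
    + by move=> z _; rewrite lee_fin powR_ge0.
  - rewrite gtr0_norm// in t1 *; apply: le_trans (key t t0 t1).
    apply: ge0_subset_integral => //.
    + by rewrite -{1}(gtr0_norm t0).
    + by apply: subset_itv; rewrite bnd_simp; lra.
  - rewrite t0 normr0 powR0 ?gt_eqF// mul0r.
    by rewrite integral0_eq// => x _; rewrite addr0 subrr normr0 powR0 ?gt_eqF.
near=> h.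
apply: ge_ereal_sup => _ [t /= th <-].
have h1 : h <= 1 by near: h; exact: nbhs_right_le.
apply: (le_trans (bound t (le_trans th h1))).
by rewrite lee_fin ler_wpM2l.
Unshelve. all: by end_near.
Qed.

End Lipschitz_of_absolutely_continuous.

(** * The termwise differentiated series *)

Section dyadic_blocks.
Context {R : realType}.
Implicit Types (c x : R).

(** Summation by parts. *)
Lemma abel_inequality (b s : nat -> R) (C : R) (m n : nat) : (m <= n)%N ->
  (forall k, `|\sum_(m <= i < k) s i| <= C) ->
  `|\sum_(m <= i < n) b i * s i| <=
    C * (`|b n| + \sum_(m <= i < n) `|b i - b i.+1|).
Proof.
move=> mn sC.
have -> : \sum_(m <= i < n) b i * s i = b n * (\sum_(m <= i < n) s i) +
    \sum_(m <= i < n) (b i - b i.+1) * (\sum_(m <= k < i.+1) s k).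
  elim: n mn => [|n IH]; first by rewrite leqn0 => /eqP ->; rewrite !big_geq// mulr0 addr0.
  rewrite leq_eqVlt => /predU1P[->|mn]; first by rewrite !big_geq// mulr0 addr0.
  by rewrite big_nat_recr//= IH// [in RHS]big_nat_recr//= [X in _ = _ + X]big_nat_recr//= big_nat_recr//=; ring.
apply: (le_trans (ler_normD _ _)); rewrite mulrDr lerD//.
  by rewrite normrM mulrC ler_wpM2r.
rewrite mulr_sumr; apply: (le_trans (ler_norm_sum _ _ _)); apply: ler_sum => i _.
by rewrite normrM mulrC ler_wpM2r.
Qed.

Variables (a : nat -> R) (K : R).
Hypothesis K1 : 1 <= K.
Hypothesis aK : NBVS_bound a K.

(** Up to a constant, the weight bounds the sum of the coefficients in the
    dyadic block of index [j]. *)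
Definition block_weight (j : nat) : R := 2 ^+ j * (a (2 ^ j)%N + a (2 ^ j.+1)%N).

Local Notation t := block_weight.

Let a0 n : (0 < n)%N -> 0 <= a n.
Proof. by move=> /aK[]. Qed.

Lemma block_weight_ge0 j : 0 <= t j.
Proof. by rewrite /t mulr_ge0// addr_ge0// a0// expn_gt0. Qed.

Let Kt0 j : 0 <= K * t j.
Proof. by apply: mulr_ge0; [exact: le_trans ler01 K1|exact: block_weight_ge0]. Qed.

Let le2 j : (2 ^ j <= 2 ^ j.+1)%N.
Proof. by rewrite leq_exp2l. Qed.

Let a_le j n : (2 ^ j <= n <= 2 ^ j.+1)%N ->
  a n <= 2 * K * (a (2 ^ j)%N + a (2 ^ j.+1)%N).
Proof. by rewrite expnS => h; apply: (NBVS_le aK K1) => //; rewrite expn_gt0. Qed.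

Lemma block_sum_le j : \sum_(2 ^ j <= n < 2 ^ j.+1) a n <= 2 * K * t j.
Proof.
apply: (@le_trans _ _ (\sum_(2 ^ j <= n < 2 ^ j.+1) 2 * K * (a (2 ^ j)%N + a (2 ^ j.+1)%N))).
  by apply: ler_sum_nat => n /andP[n1 n2]; apply: a_le; rewrite n1 ltnW.
by rewrite sum_dyadic_cst natrX mulrCA.
Qed.

Lemma block_sum_succ_le j : \sum_(2 ^ j <= n < 2 ^ j.+1) a n.+1 <= 2 * K * t j.
Proof.
apply: (@le_trans _ _ (\sum_(2 ^ j <= n < 2 ^ j.+1) 2 * K * (a (2 ^ j)%N + a (2 ^ j.+1)%N))).
  by apply: ler_sum_nat => n /andP[n1 n2]; apply: a_le; rewrite n2 andbT ltnW.
by rewrite sum_dyadic_cst natrX mulrCA.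
Qed.

(** A block of the differentiated series. *)
Definition deriv_block c (j : nat) x : R :=
  \sum_(2 ^ j <= n < 2 ^ j.+1) - (n%:R * a n) * sin (n%:R * x + c).

(** The trivial bound, which is the better one for [|x| <= 2 ^- j]. *)
Lemma deriv_block_le c j x : `|deriv_block c j x| <= 6 * K * t j * 2 ^+ j.
Proof.
apply: (le_trans (ler_norm_sum _ _ _)).
apply: (@le_trans _ _ (\sum_(2 ^ j <= n < 2 ^ j.+1) 2 ^+ j.+1 * a n)).
  apply: ler_sum_nat => n /andP[n1 n2].
  have an0 : 0 <= a n by apply: a0; apply: leq_trans n1; rewrite expn_gt0.
  rewrite normrM normrN normrM normr_nat (ger0_norm an0) -[leRHS]mulr1.
  apply: ler_pM => //; first by rewrite mulr_ge0.
    by rewrite ler_wpM2r// -natrX ler_nat ltnW.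
  by rewrite ler_norml sin_geN1 sin_le1.
rewrite -mulr_sumr; apply: (@le_trans _ _ (2 ^+ j.+1 * (2 * K * t j))).
  by rewrite ler_wpM2l// block_sum_le.
have : 0 <= K * t j * 2 ^+ j by apply: mulr_ge0.
rewrite exprS; lra.
Qed.

(** The bound by summation by parts, which is the better one for larger [x]. *)
Lemma sin_deriv_block_le c j x : `|sin (x / 2)| * `|deriv_block c j x| <= 6 * K * t j.
Proof.
pose b n := n%:R * a n; pose s n := - (`|sin (x / 2)| * sin (n%:R * x + c)).
have -> : `|sin (x / 2)| * `|deriv_block c j x| = `|\sum_(2 ^ j <= n < 2 ^ j.+1) b n * s n|.
  rewrite -{1}(normr_id (sin (x / 2))) -normrM mulr_sumr; congr `|_|.
  by apply: eq_bigr => n _; rewrite /s /b; ring.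
have sC k : `|\sum_(2 ^ j <= i < k) s i| <= 1.
  by rewrite sumrN normrN -mulr_sumr normrM normr_id; exact: dirichlet_sin.
apply: (le_trans (abel_inequality b (le2 j) sC)); rewrite mul1r.
have t0 := block_weight_ge0 j.
have p0 : (0 < 2 ^ j)%N by rewrite expn_gt0.
have h1 : `|b (2 ^ j.+1)%N| <= 2 * t j.
  rewrite /b /t ger0_norm ?mulr_ge0 ?a0// ?expn_gt0// natrX exprS -!mulrA.
  by rewrite ler_wpM2l// ler_wpM2l// lerDr a0.
have h2 : \sum_(2 ^ j <= n < 2 ^ j.+1) `|b n - b n.+1| <= 4 * K * t j.
  apply: (@le_trans _ _ (\sum_(2 ^ j <= n < 2 ^ j.+1)
      (2 ^+ j.+1 * `|a n - a n.+1| + a n.+1))).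
    apply: ler_sum_nat => n /andP[n1 n2].
    have -> : b n - b n.+1 = n%:R * (a n - a n.+1) - a n.+1 by rewrite /b -natr1; ring.
    apply: (le_trans (ler_normB _ _)); rewrite (ger0_norm (a0 _))//.
    by rewrite lerD2r normrM normr_nat ler_wpM2r// -natrX ler_nat ltnW.
  rewrite big_split/= -mulr_sumr.
  have := block_sum_succ_le j.
  have : 2 ^+ j.+1 * \sum_(2 ^ j <= n < 2 ^ j.+1) `|a n - a n.+1| <= 2 * K * t j.
    rewrite exprS /t (_ : 2 * K * (_ * _) = 2 * 2 ^+ j * (K * (a (2 ^ j)%N + a (2 ^ j.+1)%N))); last by ring.
    rewrite ler_wpM2l//; have [_] := aK p0; rewrite -expnS; apply: le_trans.
    by rewrite [leRHS]big_nat_recr//= lerDl.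
  lra.
have : t j <= K * t j by rewrite ler_peMl.
lra.
Qed.

(** The majorant of the partial sums of the differentiated series. At the
    multiples of [2 * pi] the inverse is 0, so that the majorant vanishes there;
    this null set is excluded when it is used. *)
Definition deriv_majorant (J : nat) x : R :=
  \sum_(j < J) t j * Num.min (2 ^+ j) `|sin (x / 2)|^-1.

Lemma deriv_block_majorant c j x : sin (x / 2) != 0 ->
  `|deriv_block c j x| <= 6 * K * (t j * Num.min (2 ^+ j) `|sin (x / 2)|^-1).
Proof.
move=> sx; have K0 : 0 <= 6 * K * t j by rewrite -mulrA mulr_ge0.
rewrite mulrA minr_pMr// le_min deriv_block_le/=.
by rewrite ler_pdivlMr ?normr_gt0// mulrC sin_deriv_block_le.
Qed.

Lemma dyadic_shell (J : nat) x : `|x| <= 4 -> `|x| <= 4 * 2 ^- J \/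
  exists k, [/\ (k < J)%N, 4 * 2 ^- k.+1 < `|x| & `|x| <= 4 * 2 ^- k].
Proof.
move=> x4; elim: J => [|J [h|[k [kJ h1 h2]]]]; first by left; rewrite expr0 invr1 mulr1.
  by have [h'|h'] := leP `|x| (4 * 2 ^- J.+1); [left|right; exists J].
by right; exists k; rewrite ltnS ltnW.
Qed.

(** On the [k]-th dyadic shell around the origin the majorant is a discrete
    convolution. *)
Lemma deriv_majorant_shell (J : nat) x : `|x| <= 4 ->
  exists k, [/\ (k < J.+1)%N, `|x| <= 4 * 2 ^- k &
    deriv_majorant J x <= 3 * \sum_(j < J) t j * 2 ^+ (minn j k)].
Proof.
move=> x4; case: (dyadic_shell J x4) => [h|[k [kJ h1 h2]]]; [exists J|exists k].
  split => //; rewrite mulr_sumr; apply: ler_sum => j _.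
  rewrite mulrCA ler_wpM2l ?block_weight_ge0// ge_min; apply/orP; left.
  by rewrite (minn_idPl (ltnW (ltn_ord j))) ler_peMl//; lra.
split => //; first exact: ltnW.
rewrite mulr_sumr; apply: ler_sum => j _.
rewrite mulrCA ler_wpM2l ?block_weight_ge0// ge_min; apply/orP.
have [jk|kj] := leqP j k; [left|right].
  by rewrite ler_peMl//; lra.
have x0 : 0 < `|x| / 6.
  by rewrite divr_gt0//; apply: lt_trans h1; rewrite mulr_gt0// invr_gt0 exprn_gt0.
have sx := abs_sin_half_ge x4.
apply: (@le_trans _ _ (`|x| / 6)^-1).
  by rewrite lef_pV2 ?posrE//; exact: lt_le_trans sx.
rewrite invf_div ler_pdivrMr; last by rewrite -(pmulr_lgt0 _ (_ : 0 < 6^-1)).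
have p2 : 0 < 2 ^+ k :> R by rewrite exprn_gt0.
have : 3 * 2 ^+ k * (4 * 2 ^- k.+1) <= 3 * 2 ^+ k * `|x|.
  by rewrite ler_wpM2l ?(ltW h1)// mulr_ge0// ltW.
apply: le_trans; rewrite exprS; rewrite le_eqVlt; apply/orP; left; apply/eqP.
by field; rewrite gt_eqF.
Qed.

End dyadic_blocks.

Section majorant_in_Lp.
Context {R : realType}.
Notation mu := (@lebesgue_measure R).

(** The larger of the two decay ratios of the kernel below. *)
Definition dyadic_kernel_ratio (p : R) : R := 2 `^ (- Num.min p^-1 (1 - p^-1)).

Lemma dyadic_kernel_ratio_itv (p : R) : 1 < p -> 0 <= dyadic_kernel_ratio p < 1.
Proof.
move=> p1; rewrite powR_ge0/= /dyadic_kernel_ratio.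
have p0 : 0 < p by exact: lt_trans p1.
have m0 : 0 < Num.min p^-1 (1 - p^-1) by rewrite lt_min invr_gt0 p0 hardy_exponent_gt0.
rewrite powRN invf_lt1 ?powR_gt0//.
by have := gt0_ltr_powR m0 (_ : (1 : R) \in Num.nneg) (_ : (2 : R) \in Num.nneg);
  rewrite !nnegrE powR1; apply => //; rewrite ltr1n.
Qed.

(** The kernel relating the dyadic shells to the dyadic blocks decays
    geometrically off the diagonal. *)
Lemma dyadic_kernel_le (p : R) (j k : nat) : 1 < p ->
  (2 ^- k) `^ p^-1 * 2 ^+ minn j k <=
  dyadic_kernel_ratio p ^+ (k - j + (j - k)) * (2 ^+ j) `^ (1 - p^-1).
Proof.
move=> p1; have p0 : 0 < p by exact: lt_trans p1.
have p2 r s : (2 : R) `^ r * 2 `^ s = 2 `^ (r + s).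
  by rewrite powRD//; apply/implyP.
rewrite -!powR_mulrn ?powR_ge0//; rewrite -powRN /dyadic_kernel_ratio -!powRrM !p2.
apply: ler_powR; first by rewrite ler1n.
set m := Num.min _ _.
have m1 : m <= p^-1 by rewrite ge_min lexx.
have m2 : m <= 1 - p^-1 by rewrite ge_min lexx orbT.
have [jk|kj] := leqP j k.
  have -> : (k - j + (j - k))%:R = k%:R - j%:R :> R.
    by rewrite (eqP jk) addn0 natrB.
  have : m * (k%:R - j%:R) <= p^-1 * (k%:R - j%:R) by rewrite ler_wpM2r// subr_ge0 ler_nat.
  lra.
have -> : (k - j + (j - k))%:R = j%:R - k%:R :> R.
  by rewrite (eqP (ltnW kj)) add0n natrB// ltnW.
have : m * (j%:R - k%:R) <= (1 - p^-1) * (j%:R - k%:R).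
  by rewrite ler_wpM2r// subr_ge0 ler_nat ltnW.
lra.
Qed.

Variables (a : nat -> R) (K : R).
Hypothesis K1 : 1 <= K.
Hypothesis aK : NBVS_bound a K.
Variables (p B : R).
Hypothesis p1 : 1 < p.
Hypothesis aB : forall J, \sum_(j < J) dyadic_term p a j <= B.

Local Notation t := (block_weight a).
Local Notation q := (1 - p^-1).

Let p0 : 0 < p.
Proof. exact: lt_trans p1. Qed.

Let t0 j : 0 <= t j.
Proof. exact: (block_weight_ge0 aK). Qed.

Let B0 : 0 <= B.
Proof. by have := aB 0; rewrite big_ord0. Qed.

Lemma weighted_block_powR_le j : ((2 ^+ j) `^ q * t j) `^ p <=
  2 `^ p * (dyadic_term p a j + dyadic_term p a j.+1).
Proof.
have a0 i : 0 <= a (2 ^ i)%N by apply: (aK _).1; rewrite expn_gt0.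
have j0 : 0 < 2 ^+ j :> R by rewrite exprn_gt0.
rewrite weight_powR ?addr_ge0//.
apply: (@le_trans _ _ ((2 ^+ j) `^ (2 * p - 1) *
    (2 `^ p * (a (2 ^ j)%N `^ p + a (2 ^ j.+1)%N `^ p)))).
  by rewrite ler_wpM2l ?powR_ge0// powRD_le.
rewrite mulrCA ler_wpM2l ?powR_ge0// mulrDr /dyadic_term !natrX lerD2l.
rewrite ler_wpM2r ?powR_ge0//; have p1' : 1 < p by [].
apply: ge0_ler_powR; rewrite ?nnegrE ?exprn_ge0//; first by lra.
by rewrite exprS ler_peMl ?(ltW j0)//; lra.
Qed.

Lemma weighted_blocks_sum_le J :
  \sum_(j < J) ((2 ^+ j) `^ q * t j) `^ p <= 2 `^ p * (B + B).
Proof.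
apply: (@le_trans _ _ (\sum_(j < J) 2 `^ p * (dyadic_term p a j + dyadic_term p a j.+1))).
  by apply: ler_sum => j _; exact: weighted_block_powR_le.
rewrite -mulr_sumr big_split/= ler_wpM2l ?powR_ge0// lerD ?aB//.
have := aB J.+1; rewrite big_ord_recl; apply: le_trans.
by rewrite lerDr dyadic_term_ge0.
Qed.

Lemma block_weight_geometric_le j :
  t j <= (2 `^ p * (B + B)) `^ p^-1 * hardy_ratio p ^+ j.
Proof.
have h : ((2 ^+ j) `^ q * t j) `^ p <= 2 `^ p * (B + B).
  apply: le_trans (weighted_blocks_sum_le j.+1).
  by rewrite big_ord_recr/= lerDr sumr_ge0// => i _; exact: powR_ge0.
set e := (2 ^+ j) `^ q * t j in h.
have e0 : 0 <= e by rewrite mulr_ge0// powR_ge0.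
have {}h : e <= (2 `^ p * (B + B)) `^ p^-1.
  have -> : e = (e `^ p) `^ p^-1 by rewrite -powRrM divff ?gt_eqF// powRr1.
  apply: ge0_ler_powR; rewrite ?nnegrE ?powR_ge0 ?invr_ge0 ?(ltW p0)//.
  by rewrite mulr_ge0 ?powR_ge0// addr_ge0.
apply: le_trans (ler_wpM2r (exprn_ge0 j (hardy_ratio_ge0 p)) h).
have hr n : hardy_ratio p ^+ n = ((1 / 2) ^+ n) `^ q.
  elim: n => [|n IH]; first by rewrite !expr0 powR1.
  by rewrite !exprS IH [RHS]powRM ?exprn_ge0// divr_ge0.
rewrite /e hr mulrAC -powRM ?exprn_ge0 ?divr_ge0//.
by rewrite -exprMn mul1r divff// expr1n powR1 mul1r.
Qed.

Lemma block_weight_sum_le J : \sum_(j < J) t j <=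
  (2 `^ p * (B + B)) `^ p^-1 / (1 - hardy_ratio p).
Proof.
apply: (@le_trans _ _ (\sum_(j < J) (2 `^ p * (B + B)) `^ p^-1 * hardy_ratio p ^+ j)).
  by apply: ler_sum => j _; exact: block_weight_geometric_le.
rewrite -mulr_sumr ler_wpM2l ?powR_ge0// geometric_sum_le//.
by rewrite hardy_ratio_ge0 hardy_ratio_lt1.
Qed.

(** Schur's test bounds the majorant over all shells. *)
Lemma schur_shells J :
  \sum_(k < J.+1) 2 ^- k * (\sum_(j < J) t j * 2 ^+ (minn j k)) `^ p <=
  (2 / (1 - dyadic_kernel_ratio p)) `^ p * (2 `^ p * (B + B)).
Proof.
have rho := dyadic_kernel_ratio_itv p1.
pose e j := (2 ^+ j) `^ q * t j.
have e0 j : 0 <= e j by rewrite mulr_ge0 ?powR_ge0.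
apply: le_trans (ler_wpM2l (powR_ge0 _ _) (weighted_blocks_sum_le J)).
apply: le_trans (schur_geometric J J.+1 p1 rho e0).
apply: ler_sum => k _.
have X0 : 0 <= \sum_(j < J) t j * 2 ^+ (minn j k).
  by apply: sumr_ge0 => j _; rewrite mulr_ge0// exprn_ge0.
have k0 : 0 < 2 ^- k :> R by rewrite invr_gt0 exprn_gt0.
have -> : 2 ^- k = ((2 ^- k) `^ p^-1) `^ p :> R.
  by rewrite -powRrM mulVf ?gt_eqF// powRr1// ltW.
rewrite -powRM ?powR_ge0//.
apply: ge0_ler_powR; rewrite ?nnegrE ?(ltW p0) ?mulr_ge0 ?powR_ge0//.
  by apply: sumr_ge0 => j _; rewrite mulr_ge0// exprn_ge0//; case/andP : rho.
rewrite mulr_sumr; apply: ler_sum => j _.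
rewrite mulrCA [leRHS]mulrA [leRHS]mulrC ler_wpM2l//.
exact: dyadic_kernel_le.
Qed.

Lemma measurable_inv_abs_sin_half : measurable_fun setT (fun x : R => `|sin (x / 2)|^-1).
Proof.
have -> : (fun x : R => `|sin (x / 2)|^-1) = fun x => `|sin (x / 2)| `^ (-1).
  by apply/funext => x; rewrite powR_inv1.
apply: (measurableT_comp (measurable_powR (-1))).
apply: measurableT_comp => //; apply: continuous_measurable_fun => x.
apply: (@continuous_comp R R R (fun x => x / 2) sin); last exact: continuous_sin.
by apply: cvgM; [exact: cvg_id|exact: cvg_cst].
Qed.

Lemma measurable_deriv_majorant J : measurable_fun setT (deriv_majorant a J).
Proof.
apply: measurable_sum => j; apply: measurable_funM => //.
by apply: measurable_minr => //; exact: measurable_inv_abs_sin_half.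
Qed.

Lemma deriv_majorant_ge0 J x : 0 <= deriv_majorant a J x.
Proof.
by apply: sumr_ge0 => j _; rewrite mulr_ge0// le_min exprn_ge0 ?invr_ge0.
Qed.

Lemma integral_deriv_majorant_le J :
  (\int[mu]_(x in `[(- (pi : R))%R, pi]) (deriv_majorant a J x `^ p)%:E <=
   (8 * 3 `^ p * ((2 / (1 - dyadic_kernel_ratio p)) `^ p * (2 `^ p * (B + B))))%:E)%E.
Proof.
have mm := measurable_deriv_majorant J.
have mmp : measurable_fun setT (fun x => deriv_majorant a J x `^ p).
  exact: (measurableT_comp (measurable_powR p)).
pose c k := 3 * \sum_(j < J) t j * 2 ^+ (minn j k).
pose I k := `[- (4 * 2 ^- k), 4 * 2 ^- k]%classic : set (measurableTypeR R).
have mI k : measurable (I k) by exact: measurable_itv.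
have pi4 : pi < 4 :> R by have := pihalf_lt2 R; lra.
have c0 k : 0 <= c k.
  by rewrite mulr_ge0// sumr_ge0// => j _; rewrite mulr_ge0// exprn_ge0.
apply: (@le_trans _ _ (\int[mu]_(x in `[(- (pi : R))%R, pi])
    \sum_(k < J.+1) (c k `^ p * \1_(I k) x)%:E)%E).
  apply: ge0_le_integral => //=.
  - by move=> x _; rewrite lee_fin powR_ge0.
  - by apply/measurable_EFinP; exact: measurable_funTS.
  - apply: emeasurable_sum => k; apply/measurable_EFinP; apply: measurable_funTS.
    by apply: measurable_funM => //; exact: measurable_indic.
  move=> x; rewrite in_itv/= => /andP[x1 x2]; rewrite sumEFin lee_fin.
  have x4 : `|x| <= 4 by rewrite ler_norml; apply/andP; split; lra.
  have [k [kJ xk hk]] := deriv_majorant_shell aK J x4.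
  rewrite (bigD1 (Ordinal kJ))//=; apply: ler_wpDr.
    by apply: sumr_ge0 => i _; rewrite mulr_ge0 ?powR_ge0.
  have -> : \1_(I k) x = 1 :> R.
    by rewrite indicE mem_set ?/I/= ?in_itv/= -?ler_norml.
  rewrite mulr1; apply: ge0_ler_powR; rewrite ?nnegrE ?(ltW p0)//.
  exact: deriv_majorant_ge0.
rewrite ge0_integral_sum//; last 2 first.
- move=> k; apply/measurable_EFinP; apply: measurable_funTS.
  by apply: measurable_funM => //; exact: measurable_indic.
- by move=> k x _; rewrite lee_fin mulr_ge0 ?powR_ge0.
apply: (@le_trans _ _ (\sum_(k < J.+1) (c k `^ p * (8 * 2 ^- k))%:E)%E).
  apply: lee_sum => k _.
  under eq_integral do rewrite EFinM.
  rewrite ge0_integralZl//; [|by apply/measurable_EFinP; apply: measurable_funTS; exact: measurable_indic|by rewrite lee_fin powR_ge0].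
  rewrite EFinM lee_wpmul2l ?lee_fin ?powR_ge0// integral_indic//.
  apply: (@le_trans _ _ (mu (I k))).
    by apply: le_measure; rewrite ?inE//; exact: measurableI.
  have k0 : 0 < 2 ^- k :> R by rewrite invr_gt0 exprn_gt0.
  rewrite -[leLHS]/(lebesgue_measure _) lebesgue_measure_cc; first by rewrite lee_fin; lra.
  by lra.
rewrite sumEFin lee_fin -[leRHS]mulrA.
have -> : \sum_(k < J.+1) c k `^ p * (8 * 2 ^- k) = 8 * (3 `^ p *
    \sum_(k < J.+1) 2 ^- k * (\sum_(j < J) t j * 2 ^+ (minn j k)) `^ p).
  rewrite mulrA mulr_sumr; apply: eq_bigr => k _; rewrite /c powRM//; first by ring.
  by apply: sumr_ge0 => j _; rewrite mulr_ge0// exprn_ge0.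
by rewrite ler_wpM2l// ler_wpM2l ?powR_ge0// schur_shells.
Qed.

End majorant_in_Lp.

Section termwise_derivative.
Context {R : realType}.
Notation mu := (@lebesgue_measure R).
Implicit Types (c x y : R).

Lemma abs_summable_cvg (u : nat -> R) (M : R) :
  (forall J, \sum_(j < J) `|u j| <= M) -> cvgn (fun J => \sum_(j < J) u j).
Proof.
move=> uM.
have -> : (fun J => \sum_(j < J) u j) = series u.
  by apply/funext => J; rewrite /series/= big_mkord.
apply: normed_cvg; apply: nondecreasing_is_cvgn.
  by apply: nondecreasing_series => n *; exact: normr_ge0.
by exists M => _ [J _ <-]; have := uM J; rewrite -(big_mkord xpredT (fun j => `|u j|)).
Qed.

Lemma periodicz (T : R) (h : R -> R) : periodic h T -> forall (k : int) x, h (x + T *~ k) = h x.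
Proof.
move=> hT [n|n] x; first by rewrite -pmulrn periodicn.
by rewrite NegzE mulrNz -pmulrn -[in RHS](subrK (T *+ n.+1) x) periodicn.
Qed.

Lemma abs_sin_half_periodic : periodic (fun x : R => `|sin (x / 2)|) (pi *+ 2).
Proof.
move=> x; rewrite mulrDl (_ : pi *+ 2 / 2 = pi); first by rewrite sinDpi normrN.
by rewrite -[pi *+ 2]mulr_natr mulfK.
Qed.

Lemma sin_half_eq0 x : sin (x / 2) = 0 -> exists k : int, x = (pi *+ 2) *~ k.
Proof.
move=> sx; pose k := Num.floor ((x + pi) / (pi *+ 2)).
exists k; set r := x + (pi *+ 2) *~ (- k).
have pi0 := @pi_gt0 R; have pi20 : 0 < pi *+ 2 :> R by rewrite pmulrn_lgt0.
have k1 : k%:~R * (pi *+ 2) <= x + pi by rewrite -ler_pdivlMr// floor_le.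
have k2 : x + pi < (k%:~R + 1) * (pi *+ 2).
  by rewrite -ltr_pdivrMr// -[1]/(1%:~R) -intrD floorD1_gt.
have rE : r = x - k%:~R * (pi *+ 2) by rewrite /r mulrNz -mulrzl.
have r4 : `|r| <= 4.
  have := pihalf_lt2 R; move: k2; rewrite mulrDl mul1r mulr2n => k2 pi4.
  by rewrite ler_norml rE; apply/andP; split; lra.
have := abs_sin_half_ge r4.
rewrite (periodicz abs_sin_half_periodic) sx normr0 => h.
have : `|r| = 0 by apply/eqP; rewrite eq_le normr_ge0 andbT; lra.
by move/eqP; rewrite normr_eq0 /r mulrNz subr_eq0 => /eqP.
Qed.

Lemma sin_half_multiple (k : int) : sin ((pi *+ 2) *~ k / 2) = 0 :> R.
Proof.
apply/normr0_eq0; rewrite -[X in X / 2]add0r.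
by rewrite (periodicz abs_sin_half_periodic) mul0r sin0 normr0.
Qed.

(** The indicator of the complement of the multiples of [2 * pi], in a form
    whose measurability is immediate. *)
Definition off_period x : R := `|sin (x / 2)| * `|sin (x / 2)|^-1.

Lemma off_periodE x : off_period x = (sin (x / 2) != 0)%:R.
Proof.
rewrite /off_period; have [->|s0] := eqVneq (sin (x / 2)) 0.
  by rewrite normr0 mul0r.
by rewrite mulfV// normr_eq0.
Qed.

Lemma measurable_off_period : measurable_fun setT off_period.
Proof.
apply: measurable_funM; last exact: measurable_inv_abs_sin_half.
apply: measurableT_comp => //; apply: continuous_measurable_fun => x.
apply: (@continuous_comp R R R (fun x => x / 2) sin); last exact: continuous_sin.
by apply: cvgM; [exact: cvg_id|exact: cvg_cst].
Qed.

Lemma ae_not_multiple_2pi : {ae mu, forall x : R, forall k : int, x != (pi *+ 2) *~ k}.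
Proof.
pose Z := range (fun k : int => (pi *+ 2) *~ k : R).
have cZ : countable Z by exact: sub_countable (card_image_le _ _) (countableP _).
exists Z; split => //.
- by apply: countable_measurable.
- exact: countable_lebesgue_measure0.
- move=> x /= h; apply: contrapT => nZ; apply: h => k; apply/eqP => xk.
  by apply: nZ; exists k.
Qed.

Lemma is_derive_trig_term c (n : nat) x (b : R) :
  is_derive x (1 : R) (fun y => b * cos (n%:R * y + c)) (- (n%:R * b) * sin (n%:R * x + c)).
Proof.
have h : is_derive x (1 : R) (fun y : R => n%:R * y + c) (n%:R).
  have := is_deriveD (is_deriveZ n%:R (is_derive_id x (1 : R))) (is_derive_cst c x (1 : R)).
  by rewrite addr0 /GRing.scale/= mulr1.
have h2 : is_derive x (1 : R) (fun y : R => cos (n%:R * y + c)) (n%:R * - sin (n%:R * x + c)).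
  have := @is_derive1_comp R cos (fun y : R => n%:R * y + c) x (- sin (n%:R * x + c)) (n%:R) _ h.
  by move=> H; rewrite [n%:R * - _]mulrC; exact: (H (is_derive_cos _)).
have -> : - (n%:R * b) * sin (n%:R * x + c) = b *: (n%:R * - sin (n%:R * x + c)).
  by rewrite /GRing.scale/=; ring.
exact: (is_deriveZ b h2).
Qed.

Lemma is_derive_trig_sum (a : nat -> R) c (N : nat) x : is_derive x (1 : R) (trig_sum a c N)
  (\sum_(1 <= n < N) - (n%:R * a n) * sin (n%:R * x + c)).
Proof.
elim: N => [|N IH].
  rewrite (_ : trig_sum a c 0 = cst 0); last first.
    by apply/funext => y; rewrite /trig_sum big_geq.
  by rewrite big_geq//; exact: is_derive_cst.
case: N IH => [_|N IH].
  rewrite (_ : trig_sum a c 1 = cst 0); last first.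
    by apply/funext => y; rewrite /trig_sum big_geq.
  by rewrite big_geq//; exact: is_derive_cst.
rewrite big_nat_recr//=.
have := is_deriveD IH (is_derive_trig_term c N.+1 x (a N.+1)).
congr is_derive; apply/funext => y.
by rewrite /trig_sum [RHS]big_nat_recr.
Qed.

Lemma continuous_trig_sum (a : nat -> R) c (N : nat) : continuous (trig_sum a c N).
Proof.
move=> z; apply/differentiable_continuous/derivable1_diffP.
by have [] := is_derive_trig_sum a c N z.
Qed.

Variable a : nat -> R.

(** The differentiated series, summed over dyadic blocks. *)
Definition deriv_sum c (J : nat) x : R := \sum_(j < J) deriv_block a c j x.

Lemma deriv_sumE c J x :
  deriv_sum c J x = \sum_(1 <= n < 2 ^ J) - (n%:R * a n) * sin (n%:R * x + c).
Proof. by rewrite sum_dyadic. Qed.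

Lemma continuous_deriv_sum c J : continuous (deriv_sum c J).
Proof.
rewrite (_ : deriv_sum c J = trig_sum (fun n => - (n%:R * a n)) (c - pi / 2) (2 ^ J)).
  exact: continuous_trig_sum.
apply/funext => x; rewrite deriv_sumE; apply: eq_bigr => n _.
by rewrite addrA cosBpihalf.
Qed.

Lemma integral_deriv_sum c J x y : x <= y ->
  (\int[mu]_(z in `[x, y]) (deriv_sum c J z)%:E =
   (trig_sum a c (2 ^ J) y - trig_sum a c (2 ^ J) x)%:E)%E.
Proof.
rewrite le_eqVlt => /predU1P[->|xy]; first by rewrite set_itv1 integral_set1 subrr.
have D z : is_derive z (1 : R) (trig_sum a c (2 ^ J)) (deriv_sum c J z).
  by rewrite deriv_sumE; exact: is_derive_trig_sum.
have ct := @continuous_trig_sum a c (2 ^ J).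
rewrite EFinB; apply: continuous_FTC2 => //.
- by apply: continuous_subspaceT; exact: continuous_deriv_sum.
- split; first by move=> z _; exact: ex_derive.
    by apply: cvg_at_right_filter; exact: ct.
  by apply: cvg_at_left_filter; exact: ct.
- by move=> z _; rewrite derive1E derive_val.
Qed.

Lemma deriv_sum_periodic c J : periodic (deriv_sum c J) (pi *+ 2).
Proof.
move=> x; apply: eq_bigr => j _; apply: eq_bigr => n _; congr (_ * _).
have -> : n%:R * (x + pi *+ 2) + c = n%:R * x + c + (pi *+ 2) *+ n.
  by rewrite -[(_ *+ 2) *+ n]mulr_natl; ring.
by apply: periodicn => y; rewrite mulr2n addrA !sinDpi opprK.
Qed.

(** The sum of a trigonometric series is Borel measurable: on the multiples of
    [2 * pi], where convergence is not assumed, it is constant. *)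
Lemma measurable_trig_series c (f : R -> R) : periodic f (pi *+ 2) ->
  (forall x : R, (forall k : int, x != (pi *+ 2) *~ k) ->
     trig_sum a c ^~ x @ \oo --> f x) ->
  measurable_fun setT f.
Proof.
move=> pf cf.
pose F N x := off_period x * trig_sum a c N x + (1 - off_period x) * f 0.
have mF N : measurable_fun setT (F N).
  apply: measurable_funD; apply: measurable_funM => //.
  - exact: measurable_off_period.
  - by apply: continuous_measurable_fun; exact: continuous_trig_sum.
  - by apply: measurable_funB => //; exact: measurable_off_period.
apply: (measurable_fun_cvg mF) => x _.
rewrite /F off_periodE; have [/sin_half_eq0[k xk]|s0] := eqVneq (sin (x / 2)) 0.
  have -> : f x = f 0 by rewrite xk -[X in f X]add0r periodicz.
  rewrite /= subr0 mul1r (_ : (fun N => _) = cst (f 0)); first exact: cvg_cst.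
  by apply/funext => N; rewrite mul0r add0r.
rewrite /= subrr mul0r (_ : (fun N => _) = trig_sum a c ^~ x); last first.
  by apply/funext => N; rewrite mul1r addr0.
apply: cf => k; apply: contra_neq s0 => ->; exact: sin_half_multiple.
Qed.

End termwise_derivative.

(** * The dyadic condition yields an absolutely continuous representative *)

Section sufficiency.
Context {R : realType}.
Notation mu := (@lebesgue_measure R).
Variables (a : nat -> R) (K : R).
Hypothesis K1 : 1 <= K.
Hypothesis aK : NBVS_bound a K.
Variables (p B : R).
Hypothesis p1 : 1 < p.
Hypothesis aB : forall J, \sum_(j < J) dyadic_term p a j <= B.

Local Notation t := (block_weight a).

Let p0 : 0 < p.
Proof. exact: lt_trans p1. Qed.

Let t0 j : 0 <= t j.
Proof. exact: (block_weight_ge0 aK). Qed.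

Let K0 : 0 <= K.
Proof. exact: le_trans ler01 K1. Qed.

Let T := (2 `^ p * (B + B)) `^ p^-1 / (1 - hardy_ratio p).

Let T_le J : \sum_(j < J) t j <= T.
Proof. exact: (block_weight_sum_le aK p1 aB). Qed.

(** The supremum of the majorants. *)
Definition deriv_bound (x : R) : R := limn (deriv_majorant a ^~ x).

Local Notation Phi := deriv_bound.

Lemma deriv_majorant_nd (x : R) : nondecreasing_seq (deriv_majorant a ^~ x).
Proof.
apply/nondecreasing_seqP => J; rewrite /deriv_majorant big_ord_recr/= lerDl.
by rewrite mulr_ge0// le_min exprn_ge0 ?invr_ge0.
Qed.

Lemma deriv_majorant_cvg (x : R) : deriv_majorant a ^~ x @ \oo --> Phi x.
Proof.
apply: nondecreasing_is_cvgn; first exact: deriv_majorant_nd.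
exists (T * `|sin (x / 2)|^-1) => _ [J _ <-].
apply: (@le_trans _ _ (\sum_(j < J) t j * `|sin (x / 2)|^-1)).
  by apply: ler_sum => j _; rewrite ler_wpM2l// ge_min lexx orbT.
by rewrite -mulr_suml ler_wpM2r ?invr_ge0.
Qed.

Lemma deriv_majorant_le_bound J (x : R) : deriv_majorant a J x <= Phi x.
Proof.
apply: (nondecreasing_cvgn_le (@deriv_majorant_nd x)).
by apply/cvg_ex; exists (Phi x); exact: deriv_majorant_cvg.
Qed.

Lemma deriv_bound_ge0 (x : R) : 0 <= Phi x.
Proof. by apply: le_trans (deriv_majorant_le_bound 0 x); rewrite /deriv_majorant big_ord0. Qed.

Lemma deriv_bound_periodic : periodic Phi (pi *+ 2).
Proof.
move=> x; rewrite /Phi; congr (limn _); apply/funext => J.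
by apply: eq_bigr => j _; rewrite (@abs_sin_half_periodic R).
Qed.

Lemma measurable_deriv_bound : measurable_fun setT Phi.
Proof.
apply: (measurable_fun_cvg (@measurable_deriv_majorant R a)).
by move=> x _; exact: deriv_majorant_cvg.
Qed.

Lemma deriv_bound_powR_le (x L : R) : 0 <= L ->
  (forall J, deriv_majorant a J x `^ p <= L) -> Phi x `^ p <= L.
Proof.
move=> L0 hL.
have PL : Phi x <= L `^ p^-1.
  apply: (cvgr_to_le (@deriv_majorant_cvg x)); apply: nearW => J.
  have m0 : 0 <= deriv_majorant a J x by exact: (deriv_majorant_ge0 aK).
  have -> : deriv_majorant a J x = (deriv_majorant a J x `^ p) `^ p^-1.
    by rewrite -powRrM divff ?gt_eqF// powRr1.
  by apply: ge0_ler_powR; rewrite ?nnegrE ?powR_ge0 ?invr_ge0 ?(ltW p0).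
have -> : L = (L `^ p^-1) `^ p by rewrite -powRrM mulVf ?gt_eqF// powRr1.
by apply: ge0_ler_powR; rewrite ?nnegrE ?powR_ge0 ?(ltW p0) ?deriv_bound_ge0.
Qed.

Lemma deriv_bound_Lp :
  (\int[mu]_(x in `[(- (pi : R))%R, pi]) (`|Phi x| `^ p)%:E < +oo)%E.
Proof.
under eq_integral do rewrite (ger0_norm (deriv_bound_ge0 _)).
pose C := 8 * 3 `^ p * ((2 / (1 - dyadic_kernel_ratio p)) `^ p * (2 `^ p * (B + B))).
pose D := `[(- (pi : R))%R, pi]%classic : set (measurableTypeR R).
have mD : measurable D by exact: measurable_itv.
pose G J x := (deriv_majorant a J x `^ p)%:E.
have mG J : measurable_fun D (G J).
  apply/measurable_EFinP; apply: measurable_funTS.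
  by apply: (measurableT_comp (measurable_powR p)); exact: measurable_deriv_majorant.
have G0 J x : D x -> (0 <= G J x)%E by move=> _; rewrite lee_fin powR_ge0.
have m0 J x : 0 <= deriv_majorant a J x by exact: (deriv_majorant_ge0 aK).
have Gnd x : D x -> {homo G ^~ x : m n / (m <= n)%N >-> (m <= n)%E}.
  move=> _ m n mn; rewrite lee_fin; apply: ge0_ler_powR; rewrite ?nnegrE ?(ltW p0)//.
  exact: deriv_majorant_nd.
apply: (@le_lt_trans _ _ (\int[mu]_(x in D) limn (G ^~ x))%E).
  apply: ge0_le_integral => //.
  - by move=> x _; rewrite lee_fin powR_ge0.
  - apply/measurable_EFinP; apply: measurable_funTS.
    by apply: (measurableT_comp (measurable_powR p)); exact: measurable_deriv_bound.
  - rewrite -/D; apply: (@emeasurable_fun_cvg _ _ _ D G _ mG) => x Dx.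
    by apply: ereal_nondecreasing_is_cvgn; exact: Gnd.
  move=> x Dx.
  have le_lim J : (G J x <= limn (G ^~ x))%E.
    rewrite (cvg_lim _ (ereal_nondecreasing_cvgn (Gnd x Dx)))//.
    by apply: ereal_sup_ubound; exists J.
  move: le_lim; case: (limn _) => [L le_lim| |/(_ 0)]; last 2 first.
  - by move=> _; rewrite leey.
  - by rewrite leeNy_eq.
  have L0 : 0 <= L by have := le_lim 0; rewrite lee_fin; apply: le_trans; exact: powR_ge0.
  by rewrite lee_fin; apply: deriv_bound_powR_le.
rewrite (monotone_convergence mu mD mG G0 Gnd).
apply: (@le_lt_trans _ _ C%:E); last exact: ltry.
apply: lime_le.
  apply: ereal_nondecreasing_is_cvgn => m n mn.
  apply: ge0_le_integral => //; [exact: G0|by move=> x Dx; exact: Gnd].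
by apply: nearW => J; exact: (integral_deriv_majorant_le aK p1 aB).
Qed.

Variable c : R.

Local Notation cut := off_period.

Let cut_block_le j x : `|cut x * deriv_block a c j x| <=
  6 * K * (t j * Num.min (2 ^+ j) `|sin (x / 2)|^-1).
Proof.
rewrite off_periodE; have [s0|s0] := eqVneq (sin (x / 2)) 0; last first.
  by rewrite mul1r; exact: deriv_block_majorant.
rewrite /= mul0r normr0; apply: mulr_ge0; first by apply: mulr_ge0.
by apply: mulr_ge0 => //; rewrite le_min exprn_ge0 ?invr_ge0.
Qed.

Let cut_sum_abs_le J x : \sum_(j < J) `|cut x * deriv_block a c j x| <=
  6 * K * deriv_majorant a J x.
Proof. by rewrite mulr_sumr; apply: ler_sum => j _; exact: cut_block_le. Qed.

Let cut_sumE J x : cut x * deriv_sum a c J x = \sum_(j < J) cut x * deriv_block a c j x.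
Proof. by rewrite mulr_sumr. Qed.

(** The sum of the differentiated series, set to 0 at the multiples of
    [2 * pi]. *)
Definition deriv_series (x : R) : R := limn (fun J => cut x * deriv_sum a c J x).

Local Notation dg := deriv_series.

Let cut_cvg x : (fun J => cut x * deriv_sum a c J x) @ \oo --> dg x.
Proof.
rewrite /dg (_ : (fun J => _) = fun J => \sum_(j < J) cut x * deriv_block a c j x); last first.
  by apply/funext => J; exact: cut_sumE.
apply: (@abs_summable_cvg R (fun j => cut x * deriv_block a c j x) (6 * K * Phi x)) => J.
apply: (le_trans (cut_sum_abs_le J x)); rewrite ler_wpM2l ?mulr_ge0//.
exact: deriv_majorant_le_bound.
Qed.

Let cut_sum_le J x : `|cut x * deriv_sum a c J x| <= 6 * K * Phi x.
Proof.
rewrite cut_sumE; apply: (le_trans (ler_norm_sum _ _ _)).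
apply: (le_trans (cut_sum_abs_le J x)); rewrite ler_wpM2l ?mulr_ge0//.
exact: deriv_majorant_le_bound.
Qed.

Lemma deriv_series_le x : `|dg x| <= 6 * K * Phi x.
Proof.
by apply: (cvgr_to_le (cvg_norm (@cut_cvg x))); apply: nearW => J; exact: cut_sum_le.
Qed.

Lemma deriv_series_periodic : periodic dg (pi *+ 2).
Proof.
move=> x; rewrite /dg; congr (limn _); apply/funext => J.
by rewrite /off_period (@abs_sin_half_periodic R) (@deriv_sum_periodic R).
Qed.

Let measurable_cut_sum J : measurable_fun setT (fun x => cut x * deriv_sum a c J x).
Proof.
apply: measurable_funM; first exact: measurable_off_period.
by apply: continuous_measurable_fun; exact: continuous_deriv_sum.
Qed.

Lemma measurable_deriv_series : measurable_fun setT dg.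
Proof.
apply: (measurable_fun_cvg measurable_cut_sum).
by move=> x _; exact: cut_cvg.
Qed.

(** The sum of the series itself, along dyadic partial sums. *)
Definition series_sum (x : R) : R := limn (fun J => trig_sum a c (2 ^ J) x).

Local Notation g := series_sum.

Lemma series_sum_cvg x : (fun J => trig_sum a c (2 ^ J) x) @ \oo --> g x.
Proof.
rewrite /g (_ : (fun J => _) = fun J => \sum_(j < J) \sum_(2 ^ j <= n < 2 ^ j.+1) a n * cos (n%:R * x + c)); last first.
  by apply/funext => J; exact: sum_dyadic.
apply: (@abs_summable_cvg R (fun j => \sum_(2 ^ j <= n < 2 ^ j.+1) a n * cos (n%:R * x + c)) (2 * K * T)) => J.
apply: (@le_trans _ _ (\sum_(j < J) 2 * K * t j)); last first.
  by rewrite -mulr_sumr ler_wpM2l ?mulr_ge0.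
apply: ler_sum => j _; apply: (le_trans (ler_norm_sum _ _ _)).
apply: le_trans (block_sum_le K1 aK j); apply: ler_sum_nat => n /andP[n1 n2].
have an0 : 0 <= a n by apply: (aK _).1; apply: leq_trans n1; rewrite expn_gt0.
by rewrite normrM (ger0_norm an0) ler_piMr// ler_norml cos_geN1 cos_le1.
Qed.

Let deriv_bound_local (x y : R) : (\int[mu]_(z in `[x, y]) (`|Phi z| `^ p)%:E < +oo)%E.
Proof.
apply: ge0_integral_periodic_lty.
- by apply: measurable_powR_norm; exact: measurable_deriv_bound.
- by move=> z; exact: powR_ge0.
- by move=> z; rewrite deriv_bound_periodic.
- exact: deriv_bound_Lp.
Qed.

Let integrable_deriv_bound (x y : R) : mu.-integrable `[x, y] (EFin \o (fun z => 6 * K * Phi z)).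
Proof.
have mI : measurable (`[x, y]%classic : set (measurableTypeR R)) by exact: measurable_itv.
have iP : mu.-integrable `[x, y] (EFin \o Phi).
  apply: (integrable_of_Lp p1) => //; last exact: measurable_deriv_bound.
  have [xy|yx] := leP x y.
    by rewrite -[X in (X < _)%E]/(lebesgue_measure _) lebesgue_measure_cc// ltry.
  by rewrite set_itv_ge ?measure0// bnd_simp -ltNge.
have -> : EFin \o (fun z => 6 * K * Phi z) = (fun z => (6 * K)%:E * (EFin \o Phi) z)%E.
  by apply/funext => z /=; rewrite EFinM.
exact: integrableZl.
Qed.

(** Dominated convergence integrates the differentiated series termwise. *)
Lemma deriv_series_integral (x y : R) : x <= y ->
  mu.-integrable `[x, y] (EFin \o dg) /\
  g y - g x = \int[mu]_(z in `[x, y]) dg z.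
Proof.
move=> xy.
pose D := `[x, y]%classic : set (measurableTypeR R).
have mD : measurable D by exact: measurable_itv.
pose F (J : nat) (z : R) := (cut z * deriv_sum a c J z)%:E.
have mF J : measurable_fun D (F J).
  by apply/measurable_EFinP; apply: measurable_funTS; exact: measurable_cut_sum.
have mdg : measurable_fun D (EFin \o dg).
  by apply/measurable_EFinP; apply: measurable_funTS; exact: measurable_deriv_series.
have cF : {ae mu, forall z, D z -> F ^~ z @ \oo --> (EFin \o dg) z}.
  by apply: aeW => z _; apply: cvg_EFin; [exact: nearW|exact: cut_cvg].
have dF : {ae mu, forall z n, D z -> (`|F n z| <= (EFin \o (fun z : R => (6 * K * Phi z)%R)) z)%E}.
  by apply: aeW => z n _; rewrite lee_fin; exact: cut_sum_le.
have [idg _ lim] := dominated_convergence mD mF mdg cF (integrable_deriv_bound x y) dF.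
split=> //.
have intF J : (\int[mu]_(z in D) F J z = (trig_sum a c (2 ^ J) y - trig_sum a c (2 ^ J) x)%:E)%E.
  rewrite -(integral_deriv_sum a c J xy).
  apply: ae_eq_integral => //.
    apply/measurable_EFinP; apply: measurable_funTS; apply: continuous_measurable_fun.
    exact: continuous_deriv_sum.
  apply: filterS (@ae_not_multiple_2pi R); first exact: (ae_filter_ringOfSetsType mu).
  move=> z hz _; rewrite /F off_periodE.
  have -> : sin (z / 2) != 0.
    by apply/eqP => /sin_half_eq0[k zk]; have := hz k; rewrite -zk eqxx.
  by rewrite mul1r.
have l2 : (fun J => (trig_sum a c (2 ^ J) y - trig_sum a c (2 ^ J) x)%:E) @ \oo --> (g y - g x)%:E.
  by apply: cvg_EFin; [exact: nearW|apply: cvgB; exact: series_sum_cvg].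
rewrite /Rintegral.
suff -> : (\int[mu]_(z in `[x, y]) (dg z)%:E = (g y - g x)%:E)%E by [].
move: lim; rewrite (_ : [sequence _]_n = fun J => (trig_sum a c (2 ^ J) y - trig_sum a c (2 ^ J) x)%:E); last first.
  by apply/funext => J; exact: intF.
by move=> lim; apply: (cvg_unique _ lim l2); exact: ereal_hausdorff.
Qed.

Lemma deriv_series_Lp : Lp_2pi p dg.
Proof.
apply/(Lp_2piP _ p0); split; [exact: deriv_series_periodic|exact: measurable_deriv_series|].
apply: (@le_lt_trans _ _ (\int[mu]_(x in `[(- (pi : R))%R, pi]) (((6 * K)%R `^ p)%R%:E * (`|Phi x| `^ p)%R%:E))%E).
  apply: ge0_le_integral => //.
  - apply/measurable_EFinP; apply: measurable_funTS; apply: measurable_powR_norm.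
    exact: measurable_deriv_series.
  - apply: measurable_funeM; apply/measurable_EFinP; apply: measurable_funTS.
    by apply: measurable_powR_norm; exact: measurable_deriv_bound.
  move=> x _; rewrite -EFinM lee_fin -powRM ?mulr_ge0//.
  apply: ge0_ler_powR; rewrite ?nnegrE ?(ltW p0) ?mulr_ge0//.
  by rewrite (ger0_norm (deriv_bound_ge0 x)) deriv_series_le.
rewrite ge0_integralZl//; last 2 first.
- apply/measurable_EFinP; apply: measurable_funTS.
  by apply: measurable_powR_norm; exact: measurable_deriv_bound.
- by rewrite lee_fin powR_ge0.
by apply: lte_mul_pinfty; rewrite ?lee_fin ?powR_ge0.
Qed.

Lemma series_sum_ae_derive :
  {ae mu, forall x : R, is_derive x (1 : R) g (dg x)}.
Proof.
have h (n : nat) : {ae mu, forall x : R, - n.+1%:R < x < n.+1%:R ->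
    is_derive x (1 : R) g (dg x)}.
  have n0 : - n.+1%:R < n.+1%:R :> R by rewrite gtrN ?ltr0n.
  have [intn _] := deriv_series_integral (ltW n0).
  apply: filterS (integral_ae_derive n0 intn); first exact: (ae_filter_ringOfSetsType mu).
  move=> x hx xn; have D := hx xn.
  have := is_deriveD (is_derive_cst (g (- n.+1%:R)) x (1 : R)) D; rewrite add0r.
  apply: near_eq_is_derive; move: xn => /andP[x1 x2].
  have : nbhs x `]- n.+1%:R, n.+1%:R[%classic.
    by apply: open_nbhs_nbhs; split; [exact: interval_open|rewrite /= in_itv/= x1].
  apply: filterS => y; rewrite /= in_itv/= => /andP[y1 _].
  have [_ E] := deriv_series_integral (ltW y1).
  by rewrite -[RHS](subrK (g (- n.+1%:R))) E [RHS]addrC.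
have hall := ae_foralln h.
apply: (filterS _ hall).
move=> x hx; apply: (hx (Num.Def.truncn `|x|)).
by rewrite -ltr_norml truncnS_gt.
Qed.

(** The dyadic condition provides an absolutely continuous representative. *)
Lemma dyadic_equiv_AC f :
  (forall x : R, (forall k : int, x != (pi *+ 2) *~ k) ->
     trig_sum a c ^~ x @ \oo --> f x) ->
  equiv_AC_deriv_Lp p f.
Proof.
move=> hf; exists g, dg; split.
- apply: filterS (@ae_not_multiple_2pi R); first exact: (ae_filter_ringOfSetsType mu).
  move=> x /hf fx; apply/esym; apply/cvg_lim => //.
  have : (fun J => 2 ^ J)%N @ \oo --> \oo.
    apply/cvgnyPge => A; exists A => // n /= An.
    by apply: (leq_trans An); apply: ltnW; exact: ltn_expl.
  by move=> h; exact: (cvg_comp _ _ h fx).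
- move=> x y; have [xy|yx] := leP x y.
    apply: (integral_abs_continuous (deriv_series_integral xy).1) => u v _ uv _.
    exact: (deriv_series_integral uv).2.
  apply: (@integral_abs_continuous _ dg); last by move=> u v xu uv vy; lra.
  by rewrite set_itv_ge ?bnd_simp -?ltNge//; exact: integrable_set0.
- exact: series_sum_ae_derive.
- exact: deriv_series_Lp.
Qed.

End sufficiency.

(** * The equivalences *)

Section sum_functions.
Context {R : realType}.
Implicit Types (a : nat -> R) (f : R -> R).

Lemma sum_function_cos a f : sum_function cos a f ->
  forall x : R, (forall k : int, x != (pi *+ 2) *~ k) ->
    trig_sum a 0 ^~ x @ \oo --> f x.
Proof.
move=> [_ h] x /h hx; rewrite -(cvg_shiftS (trig_sum a 0 ^~ x)).
apply: cvg_trans hx; apply: near_eq_cvg; apply: nearW => N.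
by apply: eq_bigr => n _; rewrite addr0.
Qed.

Lemma sum_function_sin a f : sum_function sin a f ->
  forall x : R, (forall k : int, x != (pi *+ 2) *~ k) ->
    trig_sum a (- (pi / 2)) ^~ x @ \oo --> f x.
Proof.
move=> [_ h] x /h hx; rewrite -(cvg_shiftS (trig_sum a (- (pi / 2)) ^~ x)).
apply: cvg_trans hx; apply: near_eq_cvg; apply: nearW => N.
by apply: eq_bigr => n _; rewrite cosBpihalf.
Qed.

End sum_functions.


Unset Implicit Arguments.
Set Strict Implicit.

Theorem theorem4 (R : realType) (p : R) (a : nat -> R) (f : R -> R) :
  1 < p -> NBVS a -> sum_function cos a f \/ sum_function sin a f ->
  ((\sum_(1 <= n <oo) (n%:R `^ (2 * p - 2) * a n `^ p)%:E < +oo)%E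
     <-> Lipschitz_p p f) /\
  ((\sum_(1 <= n <oo) (n%:R `^ (2 * p - 2) * a n `^ p)%:E < +oo)%E
     <-> equiv_AC_deriv_Lp p f).
Proof.
move=> p1 aN sumf.
have pf : periodic f (pi *+ 2) by case: sumf => -[].
have [c [cc cf]] : exists c : R, (c = 0 \/ c = - (pi / 2)) /\
    forall x : R, (forall k : int, x != (pi *+ 2) *~ k) ->
      trig_sum a c ^~ x @ \oo --> f x.
  case: sumf => h; [exists 0|exists (- (pi / 2))]; (split; first by [left|right]).
    exact: sum_function_cos.
  exact: sum_function_sin.
have condE := NBVS_condition_dyadic p1 aN.
have [K K1 aK] := NBVS_const aN.
have mf := measurable_trig_series pf cf.
have AC : (\sum_(1 <= n <oo) (n%:R `^ (2 * p - 2) * a n `^ p)%:E < +oo)%E ->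
    equiv_AC_deriv_Lp p f.
  by move=> /condE[B aB]; exact: (dyadic_equiv_AC K1 aK p1 aB cf).
have Lip : equiv_AC_deriv_Lp p f -> Lipschitz_p p f by exact: equiv_AC_Lipschitz.
have back : Lipschitz_p p f ->
    (\sum_(1 <= n <oo) (n%:R `^ (2 * p - 2) * a n `^ p)%:E < +oo)%E.
  by move=> Lf; apply/condE; exact: (Lipschitz_p_dyadic p1 aN cc cf Lf).
by split; split => [h|h]; [exact/Lip/AC|exact: back|exact: AC|exact/back/Lip].
Qed.
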